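(* Let $u,v\in W$, and for $\gamma\in\mathcal{C}_0(u,v)$, written as $u=u_0 \to u_1 \to \dots \to u_m=v$ with $u_k=u_{k-1}s_{\beta_k}$, let $$E(\gamma)=\Lambda_v^-\prod_{k=1}^m\frac{\langle \omega_{i_k},\beta_k\rangle}{u_{k-1}\omega_{i_k}-v\omega_{i_k}},\qquad i_k=h(\beta_k).$$ **Part I.** (For any root system and any ordering of the simple roots.) The restriction of the equivariant Schubert class $\tau_u$ at $v$ is given by $$\tau_u(v)=\sum_{\gamma\in\mathcal{C}_0(u,v)}E(\gamma)=\sum_{\gamma\in\mathcal{C}_0(u,v)}\Lambda_v^-\prod_{k=1}^m\frac{\langle \omega_{i_k},\beta_k\rangle}{u_{k-1}\omega_{i_k}-v\omega_{i_k}} .$$ **Part II.** Suppose the root system is of type $A$, $B$ or $C$ and the simple roots are ordered in the standard way described in the context. Then for every $\gamma\in\mathcal{C}_0(u,v)$: - in types $A$ and $C$, $E(\gamma)\in\mathbb{Z}_{\geq 0}[\alpha_1,\dots,\alpha_n]$; - in type $B$, $E(\gamma)\in\frac{1}{2^m}\mathbb{Z}_{\geq 0}[\alpha_1,\dots,\alpha_n]$, where $m$ is the number of edges of $\gamma$. **Part III.** Suppose the simple roots are ordered in the standard way described in the context. - In type $A$: for every $u$ and $v$ there exist a reduced word $I$ for $v$ and a bijection $F_I\colon\mathcal{C}_0(u,v)\to\mathcal{R}(u,I)$ such that $E(\gamma)=SC(F_I(\gamma),I)$ for all $\gamma\in\mathcal{C}_0(u,v)$. - In type $C$: there exist elements $u$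 and $v$ such that, for every reduced word $I$ for $v$, the number of subwords in $\mathcal{R}(u,I)$ is not equal to the number of chains in $\mathcal{C}_0(u,v)$.
   Context: **Geometric setting.** $G$ is a connected complex semisimple Lie group, $B\subset G$ a Borel subgroup with simple roots $\alpha_1,\dots,\alpha_n$ (listed in a fixed order), $T^{\mathbb{C}}\subset B$ a maximal torus, $T$ its compact real form, $M=G/B$ with $T$ acting by left multiplication, $W$ the Weyl group. The fixed point set $M^T$ is identified with $W$. The restriction $H_T^*(M;\mathbb{Q})\to H_T^*(M^T;\mathbb{Q})=\mathrm{Maps}(W,\mathbb{Q}[\alpha_1,\dots,\alpha_n])$ is injective. The equivariant Schubert class $\tau_u$ ($u\in W$) is the class induced by the $T$-equivariant cycle $X_u=\overline{B_-uB}/B$, with $B_-$ the opposite Borel subgroup; $\tau_u(v)$ denotes its restriction to the fixed point $v$. Equivalently (combinatorially), $\tau_u$ is the unique map $W\to\mathbb{S}=\mathbb{Q}[\alpha_1,\dots,\alpha_n]$ such that: $\tau_u(ps_\beta)-\tau_u(p)\in (p\beta)\,\mathbb{S}$ for all $p\in W$ and positive roots $\beta$; every $\tau_u(p)$ is homogeneous of degree $\ell(u)$; $\tau_u(p)=0$ unless $u\preccurlyeq p$; and $\tau_u(u)=\Lambda_u^-$. **Notation.** $\mathfrak{t}^*$ is the real vector space with basis $\alpha_1,\dots,\alpha_n$, with $W$-invariant inner product $(\cdot,\cdot)$. For nonzero $\beta\in\mathfrak{t}^*$, $\beta\succ0$ means that all coordinates of $\beta$ in the basis of simple roots are non-negative,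 and $\beta\prec 0$ means $-\beta\succ 0$. $s_\beta$ is the reflection in $\beta$, $s_i=s_{\alpha_i}$, and $\ell$ is the length function on $W$. For a root $\beta$, $\langle\eta,\beta\rangle=2(\eta,\beta)/(\beta,\beta)$. The fundamental weights $\omega_1,\dots,\omega_n$ are defined by $\langle\omega_i,\alpha_j\rangle=\delta_{ij}$. For nonzero $\beta=\beta^1\alpha_1+\dots+\beta^n\alpha_n$, $h(\beta)=\min\{i: \beta^i\neq0\}$. $\preccurlyeq$ is the strong Bruhat order: the reflexive transitive closure of the relations $p\prec ps_\beta$ for $\beta\succ0$ a positive root with $p\beta\succ0$. For $v\in W$, $\Lambda_v^-$ is the product of all positive roots $\beta$ with $v^{-1}\beta\prec0$. **Chains.** $\mathcal{C}_0(u,v)$ is the set of ascending chains of maximal length $$\gamma:\ u=u_0\xrightarrow{*s_{\beta_1}}u_1\xrightarrow{*s_{\beta_2}}\cdots\xrightarrow{*s_{\beta_m}}u_m=v$$ (that is, $u_k=u_{k-1}s_{\beta_k}$ with $\beta_k$ a positive root, $u_{k-1}\beta_k\succ0$, and $\ell(u_k)=\ell(u_{k-1})+1$ for all $k$) satisfying $h(\beta_1)\leq h(\beta_2)\leq\dots\leq h(\beta_m)$. **Words.** For a reduced word $I=[i_1,\dots,i_m]$ for $v$ (i.e. $v=s_{i_1}\cdots s_{i_m}$ with $m=\ell(v)$), a subword is $J=[\epsilon_1i_1,\dots,\epsilon_mi_m]$ with $\epsilon_k\in\{0,1\}$. $\mathcal{R}(u,I)$ is the set of subwords of $I$ that, after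 deleting the zeroes, are reduced words for $u$. The subword contribution is $SC(J,I)=\prod_{j:\,\epsilon_j=1}s_{i_1}s_{i_2}\cdots s_{i_{j-1}}\alpha_{i_j}$. **Standard ordering of the simple roots.** In type $A$ the Dynkin diagram is the path $\alpha_1-\alpha_2-\cdots-\alpha_n$ with simple bonds. In type $B$ it is $\alpha_1-\cdots-\alpha_{n-1}\Rightarrow\alpha_n$, with a double bond between $\alpha_{n-1}$ and $\alpha_n$ and $\alpha_n$ the short simple root. In type $C$ it is $\alpha_1-\cdots-\alpha_{n-1}\Leftarrow\alpha_n$, with a double bond between $\alpha_{n-1}$ and $\alpha_n$ and $\alpha_n$ the long simple root. *)

(* Defs.v *)
From mathcomp Require Import all_boot all_order all_algebra all_fingroup.
From mathcomp Require Import fraction mpoly.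

Set Implicit Arguments.
Unset Strict Implicit.
Unset Printing Implicit Defensive.

Import Order.TTheory GRing.Theory Num.Theory.
Local Open Scope ring_scope.

Notation "x %:F" := (@FracField.tofrac _ x) : ring_scope.

(* Vectors are given by their coordinates in the basis of simple roots, so    *)
(* the i-th simple root is the i-th standard basis vector.                    *)

Definition simple_vec (R : realFieldType) (n : nat) (i : 'I_n) : 'rV[R]_n :=
  delta_mx 0 i.

(* (x, y), where F is the Gram matrix of the simple roots. *)
Definition inner (R : realFieldType) (n : nat) (F : 'M[R]_n) (x y : 'rV[R]_n)
    : R :=
  (x *m F *m y^T) 0 0.

(* <x, b> = 2 (x, b) / (b, b) *)
Definition pairing (R : realFieldType) (n : nat) (F : 'M[R]_n) (x b : 'rV[R]_n)
    : R :=
  2%:R * inner F x b / inner F b b.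

Definition reflect_vec (R : realFieldType) (n : nat) (F : 'M[R]_n)
    (b x : 'rV[R]_n) : 'rV[R]_n :=
  x - pairing F x b *: b.

(* Reduced crystallographic root systems of rank n with a chosen ordered base. *)
(* Nothing below uses the completeness of the real numbers, so the space of   *)
(* weights is taken over an arbitrary ordered field R.                        *)
Record root_system (R : realFieldType) (n : nat) := RootSystem {
  gram : 'M[R]_n;
  roots : seq 'rV[R]_n;
  gram_sym : gram^T = gram;
  gram_pos : forall x : 'rV[R]_n, x != 0 -> 0 < inner gram x x;
  roots_neq0 : 0 \notin roots;
  roots_reflect : {in roots &, forall b x, reflect_vec gram b x \in roots};
  roots_integral :
    {in roots &, forall x b, exists z : int, pairing gram x b = z%:~R};
  roots_reduced :
    {in roots, forall b (c : R), c *: b \in roots -> c = 1 \/ c = - 1};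
  roots_simple : forall i : 'I_n, simple_vec R i \in roots;
  roots_base : {in roots, forall b : 'rV[R]_n,
    (forall i, exists k : nat, b 0 i = k%:R) \/
    (forall i, exists k : nat, - b 0 i = k%:R)}
}.

Notation rootT Phi := (seq_sub (roots Phi)).

Section RootSystem.
Variables (R : realFieldType) (n : nat) (Phi : root_system R n).
Implicit Types (b : rootT Phi) (x : 'rV[R]_n).

Local Notation F := (gram Phi).

Lemma root_vec_neq0 b : val b != 0.
Proof.
by apply: contra (roots_neq0 Phi) => /eqP <-; apply: valP b.
Qed.

Lemma inner_root_neq0 b : inner F (val b) (val b) != 0.
Proof. by rewrite gt_eqF // gram_pos // root_vec_neq0. Qed.

Lemma pairingB (x y z : 'rV[R]_n) (c : R) :
  pairing F (x - c *: y) z = pairing F x z - c * pairing F y z.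
Proof.
rewrite /pairing /inner mulmxBl mulmxBl -!scalemxAl !mxE.
by rewrite mulrBr mulrBl !mulrA (mulrC 2%:R c).
Qed.

Lemma pairing_root b : pairing F (val b) (val b) = 2%:R.
Proof. by rewrite /pairing mulfK // inner_root_neq0. Qed.

Lemma reflect_vecK b : involutive (reflect_vec F (val b)).
Proof.
move=> x; rewrite /reflect_vec pairingB pairing_root.
rewrite -addrA -opprD -scalerDl addrCA.
have -> : pairing F x (val b) * 2%:R = pairing F x (val b) + pairing F x (val b).
  by rewrite mulr_natr mulr2n.
by rewrite opprD addNKr addrN scale0r subr0.
Qed.

Definition reflect_root b (c : rootT Phi) : rootT Phi :=
  SeqSub (roots_reflect (valP b) (valP c)).

Lemma reflect_root_inj b : injective (reflect_root b).
Proof.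
move=> c d /(congr1 val) /= e; apply: val_inj.
exact: (can_inj (reflect_vecK b)) e.
Qed.

Definition srefl b : {perm rootT Phi} := perm (@reflect_root_inj b).

Definition simple (i : 'I_n) : rootT Phi := SeqSub (roots_simple Phi i).

(* Weyl group elements are represented by their permutation of the roots.     *)
(* The library product of permutations (p * q)%g applies p first; wmul is the *)
(* product of the Weyl group as a group of linear maps, applying q first.     *)
Definition wmul (p q : {perm rootT Phi}) : {perm rootT Phi} := (q * p)%g.

Definition weyl : {set {perm rootT Phi}} := <<[set srefl b | b : rootT Phi]>>%g.

(* The linear extension of w, determined by its values on the simple roots. *)
Definition wact (w : {perm rootT Phi}) x : 'rV[R]_n :=
  \sum_i x 0 i *: val (w (simple i)).

Definition vec_pos x : bool := (x != 0) && [forall i, 0 <= x 0 i].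
Definition vec_neg x : bool := vec_pos (- x).
Definition pos b : bool := vec_pos (val b).
Definition neg b : bool := vec_neg (val b).

Definition word_prod (I : seq 'I_n) : {perm rootT Phi} :=
  foldr (fun i w => wmul (srefl (simple i)) w) 1%g I.

(* Least number of factors in an expression of w by simple reflections. The   *)
(* search is bounded by #|weyl| because the prefixes of a shortest word are   *)
(* pairwise distinct elements.                                                *)
Definition ell (w : {perm rootT Phi}) : nat :=
  \big[minn/#|weyl|]_(m < #|weyl|
      | [exists I : m.-tuple 'I_n, word_prod I == w]) m.

Definition bruhat : rel {perm rootT Phi} :=
  connect (fun p q : {perm rootT Phi} =>
    [exists b, [&& pos b, pos (p b) & q == wmul p (srefl b)]]).

Definition fund_weight (i : 'I_n) : 'rV[R]_n :=
  (F i i / 2%:R) *: row i (invmx F).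

Lemma gram_unit : F \in unitmx.
Proof.
rewrite -row_free_unit -kermx_eq0; apply/eqP/row_matrixP => i; rewrite row0.
set x := row i (kermx F); apply/eqP; apply: contraT => /(@gram_pos _ _ Phi).
by rewrite /inner /x -row_mul mulmx_ker row0 mul0mx mxE ltxx.
Qed.

Lemma inner_simple x (j : 'I_n) :
  inner F x (simple_vec R j) = (x *m F) 0 j.
Proof. by rewrite /inner /simple_vec trmx_delta -colE mxE. Qed.

Lemma fund_weightE (i j : 'I_n) :
  pairing F (fund_weight i) (simple_vec R j) = (i == j)%:R.
Proof.
have Fjj k : inner F (simple_vec R k) (simple_vec R k) = F k k.
  by rewrite inner_simple /simple_vec -rowE mxE.
have nz k : F k k != 0 by rewrite -Fjj; apply: (inner_root_neq0 (simple k)).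
rewrite /pairing Fjj inner_simple /fund_weight -scalemxAl -row_mul.
rewrite mulVmx ?gram_unit // !mxE; case: eqVneq => [<-|_]; last first.
  by rewrite !mulr0 mul0r.
by rewrite mulr1 mulrCA divff ?pnatr_eq0 // mulr1 divff.
Qed.

Lemma root_coord_neq0 b : exists i, val b 0 i != 0.
Proof.
apply/existsP; apply: contraT => /existsPn b0.
case/negP: (root_vec_neq0 b); apply/eqP/rowP => i; rewrite mxE.
by apply/eqP; move: (b0 i); rewrite negbK.
Qed.

Definition height_index b : 'I_n :=
  [arg min_(i < xchoose (root_coord_neq0 b) | val b 0%R i != 0%R) (i : nat)]%N.

(* The vector x as a linear form in R[alpha_1, ..., alpha_n]. *)
Definition lin x : {mpoly R[n]} := \sum_i x 0 i *: 'X_i.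

Definition Lambda_minus (v : {perm rootT Phi}) : {mpoly R[n]} :=
  \prod_(b | pos b && neg ((v^-1)%g b)) lin (val b).

(* The coefficient ring Q[alpha_1, ..., alpha_n], seen inside R[alpha_1, ...]. *)
Definition ext_scalars (p : {mpoly rat[n]}) : {mpoly R[n]} :=
  map_mpoly (@ratr R) p.

(* tau is (on the Weyl group) the family of restrictions to the fixed points  *)
(* of the equivariant Schubert class of u.                                    *)
Definition schubert_class (u : {perm rootT Phi})
    (tau : {perm rootT Phi} -> {mpoly rat[n]}) : Prop :=
  [/\ forall p b, p \in weyl -> pos b ->
        exists q : {mpoly rat[n]},
          ext_scalars (tau (wmul p (srefl b)) - tau p)
            = lin (val (p b)) * ext_scalars q,
      forall p, p \in weyl -> tau p \is (ell u).-homog,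
      forall p, p \in weyl -> ~~ bruhat u p -> tau p = 0
    & ext_scalars (tau u) = Lambda_minus u].

(* A chain from u is given by the sequence of its edge labels beta_k; all the *)
(* edges raise the length by one, so a chain from u to v has ell v - ell u    *)
(* edges. The vertex u_k is obtained from the first k labels.                 *)
Definition chain_vertex (u : {perm rootT Phi}) (c : seq (rootT Phi)) (k : nat)
    : {perm rootT Phi} :=
  foldl (fun w b => wmul w (srefl b)) u (take k c).

Definition is_chain (u v : {perm rootT Phi}) (m : nat) (c : m.-tuple (rootT Phi))
    : bool :=
  [forall k : 'I_m,
     [&& pos (tnth c k),
         pos (chain_vertex u c k (tnth c k))
       & ell (chain_vertex u c k.+1) == (ell (chain_vertex u c k)).+1]]
  && (chain_vertex u c m == v).

Definition C0 (u v : {perm rootT Phi}) : {set (ell v - ell u).-tuple (rootT Phi)} :=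
  [set c | is_chain u v c & sorted leq [seq val (height_index b) | b <- c]].

Definition E (u v : {perm rootT Phi}) (m : nat) (c : m.-tuple (rootT Phi))
    : {fraction {mpoly R[n]}} :=
  (Lambda_minus v)%:F *
  \prod_(k < m)
    let w := fund_weight (height_index (tnth c k)) in
    ((pairing F w (val (tnth c k)))%:MP)%:F
      / (lin (wact (chain_vertex u c k) w - wact v w))%:F.

Definition reduced_word (w : {perm rootT Phi}) (I : seq 'I_n) : bool :=
  (word_prod I == w) && (size I == ell w).

(* A subword is encoded by the bits epsilon_k. *)
Definition subwords (u : {perm rootT Phi}) (I : seq 'I_n)
    : {set (size I).-tuple bool} :=
  [set eps : (size I).-tuple bool | reduced_word u (mask eps I)].

Definition SC (I : seq 'I_n) (eps : (size I).-tuple bool) : {mpoly R[n]} :=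
  \prod_(j < size I | tnth eps j)
    lin (val (word_prod (take j I) (simple (tnth (in_tuple I) j)))).

(* Number of bonds between two nodes of the Dynkin diagram. *)
Definition bonds (i j : 'I_n) : R :=
  pairing F (simple_vec R i) (simple_vec R j)
  * pairing F (simple_vec R j) (simple_vec R i).

Definition adjacent (i j : 'I_n) : bool := (i.+1 == j) || (j.+1 == i).

Definition type_A : Prop :=
  (0 < n)%N /\ forall i j, i != j -> bonds i j = (adjacent i j)%:R.

(* The common part of types B and C; the last simple root has index n.-1. *)
Definition double_bonded_path : Prop :=
  (1 < n)%N /\ forall i j, i != j ->
    bonds i j = if adjacent i j then (if maxn i j == n.-1 then 2%:R else 1)
                else 0.

Definition type_B : Prop :=
  double_bonded_path /\
  forall i j : 'I_n, i.+1 = j -> j.+1 = n ->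
    inner F (simple_vec R j) (simple_vec R j)
      < inner F (simple_vec R i) (simple_vec R i).

Definition type_C : Prop :=
  double_bonded_path /\
  forall i j : 'I_n, i.+1 = j -> j.+1 = n ->
    inner F (simple_vec R i) (simple_vec R i)
      < inner F (simple_vec R j) (simple_vec R j).

(* f lies in d^-1 Z_{>=0}[alpha_1, ..., alpha_n] *)
Definition nonneg_poly_over (d : nat) (f : {fraction {mpoly R[n]}}) : Prop :=
  exists2 p : {mpoly int[n]}, (forall m : 'X_{1..n}, 0 <= p@_m)
    & f = ((d%:R)^-1 *: map_mpoly intr p)%:F.

End RootSystem.

Arguments SC [R n] Phi I eps.

(* Main.v *)
(* Part I. The classes tau_u are determined by their values at short elements *)
(* (a class whose value at p is divisible by all the roots of Lambda_p^- and  *)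
(* has smaller degree vanishes at p), and they all exist: the divided         *)
(* difference of tau_(u s_i) in direction s_i is tau_u. Comparing values at   *)
(* short elements gives the Chevalley formula                                 *)
(*   (u om_i - p om_i) tau_u(p) = sum_b <om_i, b> tau_(u s_b)(p),             *)
(* the sum being over the covers u -> u s_b. At p = v, with i the first index *)
(* such that u om_i <> v om_i, the edges b of height < i contribute 0 because *)
(* u s_b om_j - v om_j is not a sum of positive roots for j = h(b). Iterating *)
(* the formula produces exactly the chains of C0(u, v).                       *)
(*                                                                            *)
(* Part II. In types A, B and C the stabilizer of om_1, ..., om_(i-1) moves   *)
(* om_i by a multiple of a root. Along a chain the denominators are therefore *)
(* multiples of distinct factors of Lambda_v^-, and E is what remains.        *)
(*                                                                            *)
(* Part III. In type A write v as a product of descending words b-1, ..., i   *)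
(* for i = 1, ..., n. Every subword of the resulting word I, whatever its     *)
(* product, is the set of kept letters of a unique ascending chain with       *)
(* weakly increasing heights which ends at v: its denominators are the roots  *)
(* of the deleted letters. In type C take u = s_(n-1) and                     *)
(* v = s_(n-1) s_n s_(n-1): two subwords, but a single chain.                 *)

Require Import Defs.
From mathcomp Require Import all_boot all_order all_algebra all_fingroup.
From mathcomp Require Import fraction mpoly.
From mathcomp Require Import ring lra zify.

Set Implicit Arguments.
Unset Strict Implicit.
Unset Printing Implicit Defensive.

Import Order.TTheory GRing.Theory Num.Theory.
Local Open Scope ring_scope.

(** * Linear action of the Weyl group *)

(** Part I is an induction on ell v - ell u ([schub_sum]) driven by the equivariant Chevalley
    formula ([chevalley]). A family satisfying the GKM divisibility conditions vanishes at p as soon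
    as it vanishes at every lower neighbour p s_b and its degree is below ell p, since its value is
    then divisible by the ell p roots of Lambda_p^- ([gkm_vanish]). This principle, with the values
    at covers computed in [schub_cover], proves the Chevalley formula and also the support bound
    [schub_support]. The classes on the right-hand side of the formula come from [schub_exists].
    Dividing by u om_i - v om_i, with i the first index where this difference is nonzero, leaves
    exactly the covers of height i: higher edges have coefficient 0, and [schub_support] kills the
    lower ones.

    Part II rests on a property of the stabilizer of the weights before om_i, [small_orbits]: it
    moves om_i by t b with b a positive root of height i and t restricted. Applied to v^-1 u_(k-1),
    it makes each denominator of E a multiple of a root of Lambda_v^-, and different edges give
    different roots ([Eprod_factor]). After cancellation E is a product of positive roots times
    quotients <om_i, beta_k> / t, where both numbers are 1 in types A and C and lie in {1, 2} in
    type B. The orbits are computed with coordinate vectors eps_k, which the Weyl group permutes, up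
    to sign in types B and C.

    Part III in type A: a chain is determined by v and the set of its denominators ([denoms_inj]),
    and the word I is built so that every set of deleted letters is realized by a chain ending at v
    ([block_chains], [word_chains]). Chains thus correspond to subwords, E is the product of the
    roots of the kept letters ([E_eq_SC]), and counting edges matches reduced subwords with maximal
    chains. In type C, v has a single reduced word with at least two subwords for u, while all but
    one of the candidate chains break the length or the height condition. *)

Section Inner.
Variables (R : realFieldType) (n : nat) (F : 'M[R]_n).
Implicit Types (x y z : 'rV[R]_n) (c : R).

Lemma innerDl x y z : inner F (x + y) z = inner F x z + inner F y z.
Proof. by rewrite /inner !mulmxDl mxE. Qed.

Lemma innerDr x y z : inner F z (x + y) = inner F z x + inner F z y.
Proof. by rewrite /inner linearD mulmxDr mxE. Qed.

Lemma innerZl c x y : inner F (c *: x) y = c * inner F x y.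
Proof. by rewrite /inner -!scalemxAl mxE. Qed.

Lemma innerZr c x y : inner F x (c *: y) = c * inner F x y.
Proof. by rewrite /inner linearZ -!scalemxAr mxE. Qed.

Lemma innerNl x y : inner F (- x) y = - inner F x y.
Proof. by rewrite -scaleN1r innerZl mulN1r. Qed.

Lemma innerNr x y : inner F x (- y) = - inner F x y.
Proof. by rewrite -scaleN1r innerZr mulN1r. Qed.

Lemma innerBl x y z : inner F (x - y) z = inner F x z - inner F y z.
Proof. by rewrite innerDl innerNl. Qed.

Lemma innerBr x y z : inner F z (x - y) = inner F z x - inner F z y.
Proof. by rewrite innerDr innerNr. Qed.

Lemma inner0l x : inner F 0 x = 0.
Proof. by rewrite /inner !mul0mx mxE. Qed.

Lemma inner0r x : inner F x 0 = 0.
Proof. by rewrite /inner linear0 mulmx0 mxE. Qed.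

Lemma inner_suml (I : Type) (r : seq I) (P : pred I) (f : I -> 'rV[R]_n) y :
  inner F (\sum_(i <- r | P i) f i) y = \sum_(i <- r | P i) inner F (f i) y.
Proof.
by elim/big_rec2: _ => [|i a b _ <-]; rewrite ?inner0l ?innerDl.
Qed.

Lemma inner_sumr (I : Type) (r : seq I) (P : pred I) (f : I -> 'rV[R]_n) y :
  inner F y (\sum_(i <- r | P i) f i) = \sum_(i <- r | P i) inner F y (f i).
Proof.
by elim/big_rec2: _ => [|i a b _ <-]; rewrite ?inner0r ?innerDr.
Qed.

End Inner.

Lemma row_simple_sum (R : realFieldType) (n : nat) (x : 'rV[R]_n) :
  x = \sum_i x 0 i *: simple_vec R i.
Proof. by rewrite [LHS]row_sum_delta. Qed.

Lemma simple_vecE (R : realFieldType) (n : nat) (i j : 'I_n) :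
  simple_vec R i 0 j = (i == j)%:R.
Proof. by rewrite mxE eqxx eq_sym. Qed.

Section Weyl.
Variables (R : realFieldType) (n : nat) (Phi : root_system R n).
Local Notation F := (gram Phi).
Local Notation T := (rootT Phi).
Local Notation V := 'rV[R]_n.
Local Notation W := (weyl Phi).
Local Notation s_ := (srefl (Phi := Phi)).
Local Notation "p ** q" := (wmul p q) (at level 40, left associativity).
Implicit Types (b c : T) (p q : {perm T}) (x y : V) (i j : 'I_n).

Lemma innerC x y : inner F x y = inner F y x.
Proof.
have tr (M : 'M[R]_1) : M 0 0 = M^T 0 0 by rewrite mxE.
by rewrite /inner [LHS]tr !trmx_mul trmxK gram_sym mulmxA.
Qed.

Lemma inner_gt0 x : x != 0 -> 0 < inner F x x.
Proof. exact: gram_pos. Qed.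

Lemma inner_eq0 x : inner F x x = 0 -> x = 0.
Proof. by move=> e; apply: contraTeq isT => /inner_gt0; rewrite e ltxx. Qed.

Lemma inner_root_gt0 b : 0 < inner F (val b) (val b).
Proof. exact: inner_gt0 (root_vec_neq0 b). Qed.

Lemma wmulE p q b : (p ** q) b = p (q b).
Proof. by rewrite /wmul permM. Qed.

Lemma wmulA p q r : p ** (q ** r) = p ** q ** r.
Proof. by rewrite /wmul mulgA. Qed.

Lemma wmul1p p : 1%g ** p = p.
Proof. by rewrite /wmul mulg1. Qed.

Lemma wmulp1 p : p ** 1%g = p.
Proof. by rewrite /wmul mul1g. Qed.

Lemma wmulVp p : p^-1%g ** p = 1%g.
Proof. by rewrite /wmul mulgV. Qed.

Lemma wmulpV p : p ** p^-1%g = 1%g.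
Proof. by rewrite /wmul mulVg. Qed.

Lemma wmulI p : injective (wmul p).
Proof. exact: mulIg. Qed.

Lemma wmulV p q : ((p ** q)^-1)%g = q^-1%g ** p^-1%g.
Proof. by rewrite /wmul invMg. Qed.

Lemma wmul_weyl p q : p \in W -> q \in W -> p ** q \in W.
Proof. by move=> pW qW; rewrite groupM. Qed.

Lemma srefl_weyl b : s_ b \in W.
Proof. by apply: mem_gen; apply: imset_f. Qed.

Lemma one_weyl : 1%g \in W.
Proof. exact: group1. Qed.

Lemma inv_weyl p : p \in W -> p^-1%g \in W.
Proof. by rewrite groupV. Qed.

Hint Resolve srefl_weyl one_weyl : core.

Definition wmx p : 'M[R]_n := \matrix_i val (p (simple Phi i)).

Lemma wactE p x : wact p x = x *m wmx p.
Proof.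
rewrite /wact mulmx_sum_row; apply: eq_bigr => i _; congr (_ *: _).
by rewrite rowK.
Qed.

Lemma wactD p x y : wact p (x + y) = wact p x + wact p y.
Proof. by rewrite !wactE mulmxDl. Qed.

Lemma wactN p x : wact p (- x) = - wact p x.
Proof. by rewrite !wactE mulNmx. Qed.

Lemma wactB p x y : wact p (x - y) = wact p x - wact p y.
Proof. by rewrite wactD wactN. Qed.

Lemma wactZ p (k : R) x : wact p (k *: x) = k *: wact p x.
Proof. by rewrite !wactE scalemxAl. Qed.

Lemma wact0 p : wact p 0 = 0.
Proof. by rewrite wactE mul0mx. Qed.

Lemma wact_sum p (I : Type) (r : seq I) (P : pred I) (f : I -> V) :
  wact p (\sum_(i <- r | P i) f i) = \sum_(i <- r | P i) wact p (f i).
Proof.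
by elim/big_rec2: _ => [|i a d _ <-]; rewrite ?wact0 ?wactD.
Qed.

Lemma wact_simple p i : wact p (simple_vec R i) = val (p (simple Phi i)).
Proof. by rewrite wactE /simple_vec -rowE rowK. Qed.

Lemma pairingE x b : pairing F x (val b) * inner F (val b) (val b)
  = 2%:R * inner F x (val b).
Proof. by rewrite /pairing divfK // inner_root_neq0. Qed.

Lemma reflect_isom b x y :
  inner F (reflect_vec F (val b) x) (reflect_vec F (val b) y) = inner F x y.
Proof.
rewrite /reflect_vec innerBl !innerBr !innerZl !innerZr (innerC (val b) y).
have := pairingE y b; have := pairingE x b.
set a := pairing F x _; set d := pairing F y _; set e := inner F x _.
set f := inner F y _; set g := inner F x y; set h := inner F _ _ => h1 h2.
have -> : g - d * e - (a * f - a * (d * h)) = g - d * e - a * f + d * (a * h).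
  by ring.
rewrite h1; have -> : a * f = d * e; last by ring.
apply: (mulIf (inner_root_neq0 b)); rewrite -/h mulrAC h1 (mulrAC d) h2; ring.
Qed.

Definition reflect_mx b : 'M[R]_n :=
  1%:M - (2%:R / inner F (val b) (val b)) *: (F *m (val b)^T *m val b).

Lemma reflect_mxE b x : x *m reflect_mx b = reflect_vec F (val b) x.
Proof.
rewrite mulmxBr mulmx1 -scalemxAr !mulmxA [x *m _ *m _]mx11_scalar.
by rewrite mul_scalar_mx scalerA mulrAC.
Qed.

(** The generators are restrictions of linear isometries, hence so are their products. [weyl_wmx]
    then identifies the matrix with [wmx p], so that [wact p] agrees with the permutation on all
    roots and not only on the simple ones. *)
Lemma weyl_linear p : p \in W ->
  exists2 M : 'M[R]_n, (forall b, val (p b) = val b *m M) &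
    forall x y, inner F (x *m M) (y *m M) = inner F x y.
Proof.
case/gen_prodgP=> m [c cP ->]; elim: m c cP => [|m IH] c cP.
  exists 1%:M => [b|x y]; last by rewrite !mulmx1.
  by rewrite big_ord0 perm1 mulmx1.
rewrite big_ord_recr /=.
have [M M1 M2] := IH (fun k => c (widen_ord (leqnSn m) k)) (fun k => cP _).
have /imsetP [r _ ->] := cP ord_max.
exists (M *m reflect_mx r) => [b|x y].
  by rewrite permM permE /= mulmxA -M1 reflect_mxE.
by rewrite !mulmxA !reflect_mxE reflect_isom M2.
Qed.

Lemma weyl_wmx p M : (forall b, val (p b) = val b *m M) -> wmx p = M.
Proof.
by move=> h; apply/row_matrixP => i; rewrite rowK h rowE.
Qed.

Lemma wact_root p b : p \in W -> wact p (val b) = val (p b).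
Proof. by move=> /weyl_linear [M h _]; rewrite wactE (weyl_wmx h) h. Qed.

Lemma inner_wact p x y : p \in W -> inner F (wact p x) (wact p y) = inner F x y.
Proof. by move=> /weyl_linear [M h h']; rewrite !wactE (weyl_wmx h) h'. Qed.

Lemma wactM p q x : p \in W -> wact (p ** q) x = wact p (wact q x).
Proof.
move=> pW; rewrite [wact q x]/wact wact_sum; apply: eq_bigr => i _.
by rewrite wactZ wact_root // wmulE.
Qed.

Lemma wact1 x : wact (1%g : {perm T}) x = x.
Proof.
rewrite [RHS]row_simple_sum; apply: eq_bigr => i _.
by rewrite perm1.
Qed.

Lemma wactK p x : p \in W -> wact p^-1%g (wact p x) = x.
Proof. by move=> pW; rewrite -wactM ?inv_weyl // wmulVp wact1. Qed.

Lemma wactKV p x : p \in W -> wact p (wact p^-1%g x) = x.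
Proof. by move=> pW; rewrite -wactM // wmulpV wact1. Qed.

Lemma wact_inj p : p \in W -> injective (wact p).
Proof. by move=> pW x y e; rewrite -(wactK x pW) e wactK. Qed.

Lemma inner_wactl p x y : p \in W ->
  inner F (wact p x) y = inner F x (wact p^-1%g y).
Proof. by move=> pW; rewrite -(inner_wact _ _ (inv_weyl pW)) wactK. Qed.

Lemma wact_srefl b x : wact (s_ b) x = reflect_vec F (val b) x.
Proof.
rewrite wactE -reflect_mxE; congr (_ *m _); apply: weyl_wmx => c.
by rewrite permE /= reflect_mxE.
Qed.

Lemma srefl_root b c : val (s_ b c) = reflect_vec F (val b) (val c).
Proof. by rewrite permE. Qed.

Lemma pairing_wactl p x b : p \in W ->
  pairing F (wact p x) (val b) = pairing F x (val (p^-1%g b)).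
Proof.
move=> pW; rewrite /pairing inner_wactl // -!wact_root ?inv_weyl //.
by rewrite inner_wact ?inv_weyl.
Qed.

Lemma pairing_wact p x b : p \in W ->
  pairing F (wact p x) (val (p b)) = pairing F x (val b).
Proof. by move=> pW; rewrite pairing_wactl // permK. Qed.

Lemma srefl_conj p b : p \in W -> s_ (p b) ** p = p ** s_ b.
Proof.
move=> pW; apply/permP => c; apply/val_inj.
rewrite !wmulE srefl_root -[in RHS]wact_root // srefl_root /reflect_vec.
by rewrite wactB wactZ !wact_root // -[X in pairing F X _]wact_root //
  pairing_wact.
Qed.

Lemma srefl_sq b : s_ b ** s_ b = 1%g.
Proof.
apply/permP => c; apply/val_inj.
by rewrite !wmulE perm1 !srefl_root reflect_vecK.
Qed.

Lemma sreflV b : (s_ b)^-1%g = s_ b.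
Proof.
by rewrite -[LHS]wmulp1 -(srefl_sq b) wmulA wmulVp wmul1p.
Qed.

Lemma sreflK p b : p ** s_ b ** s_ b = p.
Proof. by rewrite -wmulA srefl_sq wmulp1. Qed.

Lemma srefl_rootK b : involutive (s_ b).
Proof. by move=> c; rewrite -wmulE srefl_sq perm1. Qed.

Lemma reflect_self b : reflect_vec F (val b) (val b) = - val b.
Proof.
rewrite /reflect_vec pairing_root; have -> : 2%:R = 1 + 1 :> R by ring.
by rewrite scalerDl scale1r opprD addrA subrr sub0r.
Qed.

(** The root -b. Writing it as s_b b makes it a member of the root system by construction. *)
Definition oproot b : T := s_ b b.

Lemma val_opp b : val (oproot b) = - val b.
Proof. by rewrite srefl_root reflect_self. Qed.

Lemma oppK : involutive oproot.
Proof. by move=> b; apply/val_inj; rewrite !val_opp opprK. Qed.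

Lemma perm_opp p b : p \in W -> p (oproot b) = oproot (p b).
Proof.
by move=> pW; apply/val_inj;
  rewrite val_opp -(wact_root (oproot b) pW) -(wact_root b pW) val_opp wactN.
Qed.

Lemma srefl_opp b : s_ (oproot b) = s_ b.
Proof.
apply: (can_inj (fun p => sreflK p b)); rewrite srefl_sq.
have := srefl_conj b (srefl_weyl b); rewrite -/(oproot b) => ->;
  exact: srefl_sq.
Qed.

Lemma coord_pos b i : pos b -> 0 <= val b 0 i.
Proof. by case/andP => _ /forallP. Qed.

Lemma pos_neg b : pos b -> neg b -> False.
Proof.
move=> pb /andP [b0 /forallP h]; case/negP: b0; apply/eqP/rowP => i.
rewrite !mxE; apply/eqP; rewrite oppr_eq0 eq_le coord_pos // andbT.
by rewrite -oppr_ge0; have := h i; rewrite mxE.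
Qed.

Lemma neg_opp b : neg b = pos (oproot b).
Proof. by rewrite /neg /vec_neg /pos val_opp. Qed.

Lemma pos_opp b : pos b = neg (oproot b).
Proof. by rewrite neg_opp oppK. Qed.

Lemma pos_or_neg b : pos b || neg b.
Proof.
have bn := root_vec_neq0 b.
case: (roots_base (valP b)) => h; apply/orP; [left|right].
  by rewrite /pos /vec_pos bn; apply/forallP => i; have [k ->] := h i.
rewrite /neg /vec_neg /vec_pos oppr_eq0 bn; apply/forallP => i; rewrite mxE.
by have [k ->] := h i.
Qed.

Lemma negE b : neg b = ~~ pos b.
Proof.
have := pos_or_neg b; case pb: (pos b); case nb: (neg b) => //.
by case: (pos_neg pb nb).
Qed.

Lemma pos_oppE b : pos (oproot b) = ~~ pos b.
Proof. by rewrite -neg_opp negE. Qed.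

Lemma pos_coordP b i : 0 < val b 0 i -> pos b.
Proof.
move=> h; apply: contraT; rewrite -pos_oppE => /(coord_pos i).
by rewrite val_opp mxE oppr_ge0 leNgt h.
Qed.

Lemma pos_nat b i : pos b -> exists k : nat, val b 0 i = k%:R.
Proof.
move=> pb; case: (roots_base (valP b)) => [/(_ i)//|h].
have [k hk] := h i; exists 0%N.
have := coord_pos i pb; rewrite -oppr_le0 hk => kle0.
have k0 : k%:R = 0 :> R by apply/eqP; rewrite eq_le kle0 ler0n.
by apply/eqP; rewrite -oppr_eq0 hk k0.
Qed.

Lemma simple_pos i : pos (simple Phi i).
Proof. by apply: (@pos_coordP _ i); rewrite simple_vecE eqxx ltr01. Qed.

Lemma reflect_reduced b (k : R) c : val c = k *: val b -> k = 1 \/ k = -1.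
Proof. by move=> e; apply: (roots_reduced (valP b)); rewrite -e (valP c). Qed.

Lemma pos_prop b c (k : R) : pos b -> pos c -> val c = k *: val b -> c = b.
Proof.
move=> pb pc e; case: (reflect_reduced e) => k1; apply/val_inj;
  rewrite e k1 ?scale1r //.
case: (pos_neg pc); rewrite neg_opp.
by have -> // : oproot c = b by apply/val_inj;
  rewrite /= val_opp /= e k1 scaleN1r opprK.
Qed.

(* A positive root other than alpha_i involves another simple root, whose     *)
(* coefficient s_i does not change.                                           *)
Lemma srefl_simple_pos i b : pos b -> b != simple Phi i ->
  pos (s_ (simple Phi i) b).
Proof.
move=> pb nb.
have [j ji bj] : exists2 j, j != i & val b 0 j != 0.
  apply/exists_inP; apply: contraT; rewrite negb_exists_in => /forall_inP h.
  case/eqP: nb; apply: (@pos_prop _ _ (val b 0 i)) => //;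
    first exact: simple_pos.
  rewrite [LHS]row_simple_sum (bigD1 i) //= big1 ?addr0 // => j /h.
  by rewrite negbK => /eqP ->; rewrite scale0r.
apply: (@pos_coordP _ j); rewrite srefl_root !mxE (negPf ji) andbF.
by rewrite mulr0 subr0 lt0r bj coord_pos.
Qed.

End Weyl.

(** * Length and reduced words *)

Section Length.
Variables (R : realFieldType) (n : nat) (Phi : root_system R n).
Local Notation F := (gram Phi).
Local Notation T := (rootT Phi).
Local Notation V := 'rV[R]_n.
Local Notation W := (weyl Phi).
Local Notation s_ := (srefl (Phi := Phi)).
Local Notation al := (simple Phi).
Local Notation om := (fund_weight Phi).
Local Notation "p ** q" := (wmul p q) (at level 40, left associativity).
Implicit Types (b c : T) (p q : {perm T}) (x y : V) (i j : 'I_n).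
Hint Resolve srefl_weyl one_weyl : core.

Lemma pos_ex b : pos b -> exists j, 0 < val b 0 j.
Proof.
move=> pb; have [j bj] := root_coord_neq0 b.
by exists j; rewrite lt0r bj coord_pos.
Qed.

Lemma word_prod_weyl I : word_prod Phi I \in W.
Proof. by elim: I => [|i I IH] //=; rewrite wmul_weyl. Qed.
Hint Resolve word_prod_weyl : core.

Lemma word_prod_cat I J : word_prod Phi (I ++ J) = word_prod Phi I ** word_prod
  Phi J.
Proof. by elim: I => [|i I IH] /=; rewrite ?wmul1p // IH wmulA. Qed.

Lemma word_prod_rcons I i : word_prod Phi (rcons I i) = word_prod Phi I ** s_
  (al i).
Proof. by rewrite -cats1 word_prod_cat /= wmulp1. Qed.

(** Otherwise (b, b), expanded in the simple roots, would not be positive. *)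
Lemma inner_simple_pos b : pos b -> exists i,
  0 < inner F (val b) (simple_vec R i).
Proof.
move=> pb; apply/existsP; apply: contraT => /existsPn h.
have := inner_root_gt0 b; rewrite {2}[val b]row_simple_sum inner_sumr ltNge.
case/negP; apply: sumr_le0 => i _; rewrite innerZr.
by apply: mulr_ge0_le0; rewrite ?coord_pos // leNgt.
Qed.

Definition wordable p := exists I, p = word_prod Phi I.

Lemma wordable_mul p q : wordable p -> wordable q -> wordable (p ** q).
Proof. by move=> [I ->] [J ->]; exists (I ++ J); rewrite word_prod_cat. Qed.

Lemma wordable_simple i : wordable (s_ (al i)).
Proof. by exists [:: i]; rewrite /= wmulp1. Qed.

(** Induction on the sum of the coordinates of b, a natural number. A simple root alpha_i with (b,
    alpha_i) > 0 gives c = s_i b with a smaller sum, and s_b = s_i s_c s_i. *)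
Lemma wordable_pos b : pos b -> wordable (s_ b).
Proof.
have nat_sum b' : pos b' -> exists k : nat, \sum_i val b' 0 i = k%:R.
  move=> pb; have h i := pos_nat i pb.
  elim/big_ind: _ => [|x y [k ->] [l ->]|i _]; first by exists 0%N.
    by exists (k + l)%N; rewrite natrD.
  exact: h.
move=> pb; have [k] := nat_sum b pb; elim/ltn_ind: k b pb => k IH b pb hk.
have [->|nb] := eqVneq b (al (xchoose (inner_simple_pos pb))).
  exact: wordable_simple.
have := xchooseP (inner_simple_pos pb); move: nb; set i := xchoose _ => nb ib.
have pc := srefl_simple_pos pb nb; set c := s_ (al i) b in pc.
have [l hl] := nat_sum c pc.
have lk : (l < k)%N.
  rewrite -(ltr_nat R) -hl -hk -subr_gt0 -sumrB (bigD1 i) //= big1 ?addr0.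
    rewrite srefl_root !mxE !eqxx mulr1 opprB addrC subrK /pairing.
    by apply: divr_gt0; [rewrite mulr_gt0 ?ltr0n | exact: (inner_root_gt0 (al
      i))].
  move=> j ji; rewrite srefl_root !mxE (negPf ji) andbF mulr0 subr0;
    exact: subrr.
have -> : s_ b = s_ (al i) ** s_ c ** s_ (al i).
  have e := srefl_conj c (srefl_weyl (al i)).
  rewrite -e sreflK /c; congr s_; apply/val_inj; rewrite !srefl_root.
  by rewrite (reflect_vecK (al i)).
by apply: wordable_mul (wordable_simple i);
  apply: wordable_mul (wordable_simple i) _; apply: IH hl.
Qed.

Lemma weyl_wordable p : p \in W -> wordable p.
Proof.
case/gen_prodgP=> m [c cP ->].
elim/big_ind: _ => [|x y hx hy|i _]; first by exists [::].
  exact: wordable_mul hy hx.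
have /imsetP [b _ ->] := cP i.
by case/orP: (pos_or_neg b); rewrite ?neg_opp => /wordable_pos;
  rewrite ?srefl_opp.
Qed.

(** Exchange condition: the letters act on b from the right, and a letter that makes the root
    negative must meet it as its own simple root, the only positive root that a simple reflection
    makes negative. *)
Lemma word_inv I b : pos b -> neg (word_prod Phi I b) ->
  exists P l Q, I = P ++ l :: Q /\ word_prod Phi Q b = al l.
Proof.
move=> pb; elim: I => [|l I IH] /=; first by rewrite perm1 => /(pos_neg pb).
case/orP: (pos_or_neg (word_prod Phi I b)) => h nb; last first.
  by have [P [k [Q [-> e]]]] := IH h; exists (l :: P), k, Q.
exists [::], l, I; split=> //; apply/eqP; apply: contraT => ne.
by case: (pos_neg (srefl_simple_pos h ne)); rewrite -wmulE.
Qed.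

(** Conjugating s_l through Q gives s_c, so deleting the letter l amounts to a reflection on the
    right. *)
Lemma word_prod_inv_simple P l Q c : word_prod Phi Q c = al l ->
  word_prod Phi (P ++ l :: Q) = word_prod Phi (P ++ Q) ** s_ c.
Proof.
move=> e; rewrite !word_prod_cat /= -wmulA; congr (_ ** _).
by rewrite -srefl_conj // e.
Qed.

Definition invs p : {set T} := [set b | pos b && neg (p b)].

Definition Ninv p := #|invs p|.

(** An injection from the inversions of p to those of p s_b other than b, for an ascending edge p ->
    p s_b. It shows that ascents raise the number of inversions, and in [schub_cover] it matches the
    factors of two products of roots. *)
Definition foldinv b c := if neg (s_ b c) then c else s_ b c.

Lemma pairing_gt0 b c : pos c -> neg (s_ b c) -> pos b ->
  0 < pairing F (val c) (val b).
Proof.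
move=> pc nc pb; rewrite ltNge; apply/negP => le0.
have [j cj] := pos_ex pc; move: nc; rewrite negE => /negP; apply.
apply: (@pos_coordP _ _ _ _ j); rewrite srefl_root !mxE subr_gt0.
by apply: le_lt_trans cj; apply: mulr_le0_ge0; rewrite ?coord_pos.
Qed.

Lemma reflect_perm p b c : p \in W ->
  val ((p ** s_ b) c) = val (p c) - pairing F (val c) (val b) *: val (p b).
Proof.
move=> pW; rewrite wmulE -wact_root // srefl_root /reflect_vec wactB wactZ.
by rewrite !wact_root.
Qed.

Lemma foldinv_invs p b c : p \in W -> pos b -> pos (p b) -> c \in invs p ->
  foldinv b c \in invs (p ** s_ b) :\ b.
Proof.
move=> pW pb ppb; rewrite /foldinv !inE => /andP[pc npc].
have cb : c != b by apply: contraTneq npc => ->; rewrite negE ppb.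
case: ifP => nsc.
  rewrite cb pc /=; have [j] : exists j,
    0 < val (oproot (p c)) 0 j by apply: pos_ex; rewrite -neg_opp.
  rewrite neg_opp val_opp mxE => pj; apply: (@pos_coordP _ _ _ _ j).
  rewrite val_opp mxE reflect_perm // !mxE.
  have h : 0 <= pairing F (val c) (val b) * val (p b) 0 j.
    by rewrite mulr_ge0 ?coord_pos // ltW // pairing_gt0.
  lra.
have psc : pos (s_ b c) by move: nsc; rewrite negE => /negbFE.
rewrite wmulE srefl_rootK psc npc !andbT; apply: contraTneq pc => e.
by rewrite -(srefl_rootK b c) e -negE neg_opp;
  have -> : oproot (s_ b b) = b by exact: oppK.
Qed.

Lemma foldinv_inj p b : {in invs p &, injective (foldinv b)}.
Proof.
move=> c d; rewrite !inE /foldinv => /andP[pc _] /andP[pd _].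
case: ifP => h1; case: ifP => h2 // e.
- by case: (pos_neg pd); rewrite -(srefl_rootK b d) -e.
- by case: (pos_neg pc); rewrite -(srefl_rootK b c) e.
exact: perm_inj e.
Qed.

Lemma invs_up p b : p \in W -> pos b -> pos (p b) -> b \in invs (p ** s_ b).
Proof.
by move=> pW pb ppb; rewrite inE pb wmulE neg_opp -perm_opp //= oppK.
Qed.

Lemma Ninv_up p b : p \in W -> pos b -> pos (p b) ->
  (Ninv p < Ninv (p ** s_ b))%N.
Proof.
move=> pW pb ppb; rewrite /Ninv [X in (_ < X)%N](cardsD1 b) invs_up //= add1n
  ltnS.
rewrite -(card_in_imset (@foldinv_inj p b)); apply: subset_leq_card.
by apply/subsetP => _ /imsetP [c cI ->]; apply: foldinv_invs.
Qed.

Lemma Ninv_down p b : p \in W -> pos b -> neg (p b) ->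
  (Ninv (p ** s_ b) < Ninv p)%N.
Proof.
move=> pW pb npb; rewrite -[X in (_ < Ninv X)%N](sreflK p b);
  apply: Ninv_up => //.
  exact: wmul_weyl.
by rewrite wmulE -/(oproot b) perm_opp // -neg_opp.
Qed.

(** s_i permutes the positive roots other than alpha_i, so it maps the remaining inversions of p s_i
    into those of p. *)
Lemma Ninv_simple p i : p \in W -> pos (p (al i)) ->
  Ninv (p ** s_ (al i)) = (Ninv p).+1.
Proof.
move=> pW ppi; apply/eqP; rewrite eqn_leq Ninv_up ?simple_pos // andbT.
rewrite /Ninv (cardsD1 (al i)) invs_up ?simple_pos //= add1n ltnS.
rewrite -[X in (X <= _)%N](card_imset _ (@perm_inj _ (s_ (al i))));
  apply: subset_leq_card.
apply/subsetP => d /imsetP [c]; rewrite !inE => /and3P[ci pc npc] ->.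
by rewrite srefl_simple_pos //= -wmulE.
Qed.

Lemma Ninv_simple_le p i : p \in W -> (Ninv (p ** s_ (al i)) <= (Ninv p).+1)%N.
Proof.
move=> pW; case/orP: (pos_or_neg (p (al i))) => h; first by rewrite Ninv_simple.
by apply: leq_trans (leqnSn _); apply: ltnW; apply: Ninv_down => //;
  apply: simple_pos.
Qed.

Lemma Ninv_simple_down p i : p \in W -> neg (p (al i)) ->
  Ninv p = (Ninv (p ** s_ (al i))).+1.
Proof.
move=> pW h; have := @Ninv_simple (p ** s_ (al i)) i; rewrite sreflK => -> //.
  exact: wmul_weyl.
by rewrite wmulE -/(oproot (al i)) perm_opp // -neg_opp.
Qed.

Lemma Ninv1 : Ninv 1%g = 0%N.
Proof.
apply/eqP; rewrite cards_eq0; apply/eqP/setP => b; rewrite !inE perm1.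
by apply/negP => /andP[h /(pos_neg h)].
Qed.

Lemma Ninv_word I : (Ninv (word_prod Phi I) <= size I)%N.
Proof.
elim/last_ind: I => [|I i IH]; first by rewrite Ninv1.
rewrite word_prod_rcons size_rcons;
  apply: leq_trans (Ninv_simple_le _ _) _ => //.
Qed.

(* Exchange: the word of an element without inversions can be shortened. *)
Lemma Ninv_eq0 p : p \in W -> Ninv p = 0%N -> p = 1%g.
Proof.
case/weyl_wordable=> I ->.
have [m] := ubnP (size I); elim: m I => // m IH I.
case/lastP: I => [//|I i]; rewrite size_rcons ltnS => sm N0.
have npos : neg (word_prod Phi I (al i)).
  rewrite negE; apply/negP => /Ninv_simple; rewrite -word_prod_rcons N0 //.
  by move=> /(_ (word_prod_weyl I)).
have [P [l [Q [eI eQ]]]] := word_inv (simple_pos Phi i) npos.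
have e : word_prod Phi (rcons I i) = word_prod Phi (P ++ Q).
  by rewrite word_prod_rcons eI (word_prod_inv_simple _ eQ) sreflK.
rewrite e; apply: IH; last by rewrite -e.
by apply: leq_trans sm; rewrite eI !size_cat /= addnS ltnS; lia.
Qed.

Lemma exists_neg p : p \in W -> (0 < Ninv p)%N -> exists i, neg (p (al i)).
Proof.
move=> pW; rewrite /Ninv card_gt0 => /set0Pn [b]; rewrite inE => /andP[pb nb].
apply/existsP; apply: contraT => /existsPn h.
have {}h i : pos (p (al i)) by have := h i; rewrite negE negbK.
have [j] : exists j, 0 < val (oproot (p b)) 0 j by apply: pos_ex;
  rewrite -neg_opp.
rewrite val_opp -wact_root // [val b]row_simple_sum wact_sum mxE summxE
  oppr_gt0 ltNge.
case/negP; apply: sumr_ge0 => k _; rewrite wactZ wact_simple mxE.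
by rewrite mulr_ge0 ?coord_pos.
Qed.

Lemma Ninv_wordP p : p \in W -> exists I,
  p = word_prod Phi I /\ size I = Ninv p.
Proof.
move: {2}(Ninv p) (erefl (Ninv p)) => k; elim: k p => [|k IH] p hk pW.
  by exists [::]; rewrite hk /=; split=> //; apply: Ninv_eq0.
have [i ni] : exists i, neg (p (al i)) by apply: exists_neg; rewrite ?hk.
have e := Ninv_simple_down pW ni.
have [I [eI sI]] := IH (p ** s_ (al i)) (eq_add_S _ _ (etrans (esym e) hk))
  (wmul_weyl pW (srefl_weyl _)).
by exists (rcons I i); rewrite word_prod_rcons -eI sreflK size_rcons sI -e.
Qed.

Lemma Ninv_range p k : p \in W -> (k <= Ninv p)%N -> exists2 q,
  q \in W & Ninv q = k.
Proof.
elim: {p}(Ninv p) {-2}p (leqnn (Ninv p)) => [|m IH] p.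
  by rewrite leqn0 => /eqP h pW; rewrite h leqn0 => /eqP ->; exists p.
move=> hp pW; rewrite leq_eqVlt => /orP [/eqP -> |kp]; first by exists p.
have [i ni] : exists i, neg (p (al i)) by apply: exists_neg => //;
  apply: leq_trans kp.
have e := Ninv_simple_down pW ni; apply: (IH (p ** s_ (al i))).
- by rewrite -ltnS -e.
- exact: wmul_weyl.
- by rewrite -ltnS -e.
Qed.

(** The search in [ell] stays below #|W|, so the inversion number has to be strictly smaller.
    Descending from p by simple reflections meets every inversion number from 0 to that of p, which
    takes Ninv p + 1 distinct elements. *)
Lemma Ninv_weyl p : p \in W -> (Ninv p < #|W|)%N.
Proof.
move=> pW.
have /(uniq_leq_size (iota_uniq 0 (Ninv p).+1)) :
    {subset iota 0 (Ninv p).+1 <= [seq Ninv q | q <- enum W]}.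
  move=> k; rewrite mem_iota add0n ltnS => /andP[_ /(Ninv_range pW) [q qW <-]].
  by apply: map_f; rewrite mem_enum.
by rewrite size_iota size_map -cardE.
Qed.

Lemma bigminn_le (I : eqType) (r : seq I) (P : pred I) (f : I ->
  nat) (k : nat) (x : I) :
  x \in r -> P x -> (\big[minn/k]_(i <- r | P i) f i <= f x)%N.
Proof.
elim: r => // a r IH; rewrite inE big_cons => /orP[/eqP <- -> | xr Px].
  exact: geq_minl.
by case: ifP => _; [apply: leq_trans (geq_minr _ _) _|]; apply: IH.
Qed.

Lemma ell_Ninv p : p \in W -> ell p = Ninv p.
Proof.
move=> pW; apply/eqP; rewrite eqn_leq; apply/andP; split.
  have [I [eI sI]] := Ninv_wordP pW.
  have := @bigminn_le _ (index_enum 'I_#|W|)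
    (fun m : 'I_#|W| => [exists I : m.-tuple 'I_n, word_prod Phi I == p])
    (@nat_of_ord _) #|W| (Ordinal (Ninv_weyl pW)) (mem_index_enum _).
  apply; apply/existsP; rewrite /= -sI; exists (in_tuple I).
  by rewrite -eI.
rewrite /ell; elim/big_ind: _ => [|x y hx hy|m /existsP [I /eqP <-]].
- exact: ltnW (Ninv_weyl pW).
- by rewrite leq_min hx hy.
- by rewrite -[X in (_ <= X)%N](size_tuple I) Ninv_word.
Qed.

Lemma ell_up p b : p \in W -> pos b -> pos (p b) -> (ell p < ell (p ** s_ b))%N.
Proof. by move=> pW pb h; rewrite !ell_Ninv ?wmul_weyl // Ninv_up. Qed.

Lemma ell_down p b : p \in W -> pos b -> neg (p b) ->
  (ell (p ** s_ b) < ell p)%N.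
Proof. by move=> pW pb h; rewrite !ell_Ninv ?wmul_weyl // Ninv_down. Qed.

Lemma ell_simple p i : p \in W -> pos (p (al i)) ->
  ell (p ** s_ (al i)) = (ell p).+1.
Proof. by move=> pW h; rewrite !ell_Ninv ?wmul_weyl // Ninv_simple. Qed.

Lemma bruhat_ell p q : p \in W -> bruhat p q ->
  q \in W /\ (p = q \/ (ell p < ell q)%N).
Proof.
move=> pW /connectP [c]; elim: c p pW => [|r c IH] p pW /=.
  by move=> _ ->; split=> //; left.
case/andP=> /existsP [b /and3P[pb ppb /eqP ->]] /(IH _ (wmul_weyl pW
  (srefl_weyl b))) h /h [qW e].
split=> //; right; have lt := ell_up pW pb ppb.
by case: e => [<- //|]; apply: ltn_trans.
Qed.

(** The roots s_(i_1) ... s_(i_(j-1)) alpha_(i_j) occurring in [SC]. If they are all positive, the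
    word is reduced and they are the roots of Lambda_v^- for its product v. *)
Fixpoint word_roots (I : seq 'I_n) : seq T :=
  if I is i :: J then al i :: map (s_ (al i)) (word_roots J) else [::].

Lemma word_roots_cat I J : word_roots (I ++ J) = word_roots I ++ map (word_prod
  Phi I) (word_roots J).
Proof.
elim: I => [|i I IH] /=.
  by rewrite (eq_map (g := id)) ?map_id // => b; rewrite perm1.
rewrite IH map_cat -map_comp; congr (_ :: _ ++ _); apply: eq_map => b /=.
by rewrite wmulE.
Qed.

Lemma size_word_roots I : size (word_roots I) = size I.
Proof. by elim: I => //= i I IH; rewrite size_map IH. Qed.

Lemma nth_word_roots I b0 (j : 'I_(size I)) :
  nth b0 (word_roots I) j = word_prod Phi (take j I) (al (tnth (in_tuple I) j)).
Proof.
rewrite (tnth_nth (tnth (in_tuple I) j)) /=; set i0 := tnth _ _; clearbody i0.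
case: j => j /=; elim: I j => // i I IH [|j] /=; first by rewrite perm1.
by rewrite ltnS => h; rewrite (nth_map b0) ?size_word_roots // IH // wmulE.
Qed.

Lemma Ninv_word_roots I : all (@pos R n Phi) (word_roots I) ->
  Ninv (word_prod Phi I) = size I.
Proof.
elim/last_ind: I => [|I i IH]; first by rewrite Ninv1.
rewrite -cats1 word_roots_cat all_cat /= andbT => /andP[hI hi].
by rewrite cats1 word_prod_rcons size_rcons Ninv_simple // IH.
Qed.

(** s_i changes the sign of no root except alpha_i and -alpha_i, so replacing p by p s_i adds the
    single root p alpha_i to those of Lambda_p^-. *)
Lemma neg_simple_step p i b : p \in W -> pos (p (al i)) -> pos b ->
  neg (s_ (al i) (p^-1%g b)) = (b == p (al i)) || neg (p^-1%g b).
Proof.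
move=> pW hi pb; have [e|ne] := eqVneq b (p (al i)).
  by rewrite e permK neg_opp [oproot _]oppK simple_pos.
have ne' : p^-1%g b != al i by apply: contraNneq ne => <-; rewrite permKV.
case/orP: (pos_or_neg (p^-1%g b)) => h.
  by rewrite !negE h srefl_simple_pos.
rewrite h neg_opp -perm_opp // srefl_simple_pos -?neg_opp //.
apply: contraTneq pb => e.
have -> : b = oproot (p (al i)) by rewrite -e (perm_opp _ pW) [RHS]oppK permKV.
by rewrite pos_oppE hi.
Qed.

Lemma mem_word_roots I b : all (@pos R n Phi) (word_roots I) ->
  (b \in word_roots I) = pos b && neg ((word_prod Phi I)^-1%g b).
Proof.
elim/last_ind: I b => [|I i IH] b.
  rewrite /= invg1 perm1 in_nil.
  by move=> _; apply/esym/negP => /andP[h /(pos_neg h)].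
rewrite -cats1 word_roots_cat all_cat /= andbT => /andP[hI hi].
rewrite cats1 word_prod_rcons.
rewrite mem_cat inE (IH b hI) wmulV sreflV wmulE.
case pb: (pos b) => /=; first by rewrite neg_simple_step // orbC.
by apply: contraFF pb => /eqP ->.
Qed.

Lemma word_roots_uniq I : all (@pos R n Phi) (word_roots I) ->
  uniq (word_roots I).
Proof.
elim/last_ind: I => [|I i IH] //.
rewrite -cats1 word_roots_cat all_cat /= andbT => /andP[hI hi].
rewrite cats1 rcons_uniq IH // andbT mem_word_roots // permK negE.
by rewrite simple_pos andbF.
Qed.

Lemma reduced_word_roots I : all (@pos R n Phi) (word_roots I) ->
  reduced_word (word_prod Phi I) I.
Proof.
by move=> h; rewrite /reduced_word eqxx ell_Ninv // Ninv_word_roots // eqxx.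
Qed.
End Length.

(** * Divisibility by linear forms *)

Section LinearForms.
Variables (R : realFieldType) (n : nat).
Implicit Types (x y : 'rV[R]_n) (f g p q : {mpoly R[n]}).

Lemma linD x y : lin (x + y) = lin x + lin y.
Proof. by rewrite /lin -big_split; apply: eq_bigr => i _;
  rewrite mxE scalerDl. Qed.

Lemma linZ (c : R) x : lin (c *: x) = c *: lin x.
Proof. by rewrite /lin scaler_sumr; apply: eq_bigr => i _;
  rewrite mxE scalerA. Qed.

Lemma linN x : lin (- x) = - lin x.
Proof. by rewrite -scaleN1r linZ scaleN1r. Qed.

Lemma linB x y : lin (x - y) = lin x - lin y.
Proof. by rewrite linD linN. Qed.

Lemma lin_coef x i : (lin x)@_(U_(i)) = x 0 i.
Proof.
rewrite /lin raddf_sum /= (bigD1 i) //= mcoeffZ mcoeffXU eqxx mulr1 big1 ?addr0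
  //.
by move=> j ji; rewrite mcoeffZ mcoeffXU (negPf ji) mulr0.
Qed.

Lemma lin_inj : injective (@lin R n).
Proof. by move=> x y e; apply/rowP => i; rewrite -!lin_coef e. Qed.

Lemma lin0 : lin (0 : 'rV[R]_n) = 0.
Proof. by rewrite -(subrr 0) linB subrr. Qed.

Lemma lin_eq0 x : (lin x == 0) = (x == 0).
Proof. by rewrite -lin0 (inj_eq lin_inj). Qed.

Lemma msize_lin_le x : (msize (lin x) <= 2)%N.
Proof.
rewrite /lin; elim/big_rec: _ => [|i p _ h]; first by rewrite msize0.
apply: leq_trans (msizeD_le _ _) _; rewrite geq_max h andbT.
by apply: leq_trans (msizeZ_le _ _) _; rewrite msizeX mdeg1.
Qed.

Lemma msize_lin x : x != 0 -> msize (lin x) = 2.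
Proof.
move=> x0; apply/eqP; rewrite eqn_leq msize_lin_le /=.
have [i xi] : exists i, x 0 i != 0.
  apply/existsP; apply: contraT => /existsPn h; case/eqP: x0; apply/rowP => i.
  by rewrite mxE; apply/eqP; move: (h i); rewrite negbK.
have /msize_mdeg_lt : U_(i)%MM \in msupp (lin x) by rewrite mcoeff_msupp
  lin_coef.
by rewrite mdeg1.
Qed.

Definition mdvd f g := exists q, g = f * q.

Lemma mdvd0 f : mdvd f 0.
Proof. by exists 0; rewrite mulr0. Qed.

Lemma mdvdB f g g' : mdvd f g -> mdvd f g' -> mdvd f (g - g').
Proof. by move=> [q ->] [q' ->]; exists (q - q'); rewrite mulrBr. Qed.

Lemma mdvdN f g : mdvd f g -> mdvd f (- g).
Proof. by move=> [q ->]; exists (- q); rewrite mulrN. Qed.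

Lemma mdvdNl f g : mdvd f g -> mdvd (- f) g.
Proof. by move=> [q ->]; exists (- q); rewrite mulrNN. Qed.

Lemma mdvdD f g g' : mdvd f g -> mdvd f g' -> mdvd f (g + g').
Proof. by move=> [q ->] [q' ->]; exists (q + q'); rewrite mulrDr. Qed.

Lemma mdvdMl f g h : mdvd f g -> mdvd f (h * g).
Proof. by move=> [q ->]; exists (h * q); rewrite mulrCA. Qed.

Lemma mdvdMr f g h : mdvd f g -> mdvd f (g * h).
Proof. by rewrite mulrC; apply: mdvdMl. Qed.

Lemma mdvdZ f g (c : R) : mdvd f g -> mdvd f (c *: g).
Proof. by rewrite -mul_mpolyC; apply: mdvdMl. Qed.

Lemma mdvd_refl f : mdvd f f.
Proof. by exists 1; rewrite mulr1. Qed.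

Lemma mdvd_sum (I : Type) (r : seq I) (P : pred I) (F : I -> {mpoly R[n]}) f :
  (forall i, P i -> mdvd f (F i)) -> mdvd f (\sum_(i <- r | P i) F i).
Proof.
by move=> h; elim/big_ind: _ => [|p q|//]; [apply: mdvd0 | apply: mdvdD].
Qed.

Lemma mdvd_mulB f p q p' q' :
  mdvd f (p - p') -> mdvd f (q - q') -> mdvd f (p * q - p' * q').
Proof.
move=> h h'; have -> : p * q - p' * q' = p * (q - q') + (p - p') * q' by ring.
by apply: mdvdD; [apply: mdvdMl | apply: mdvdMr].
Qed.

Lemma mdvd_prodB (I : Type) (r : seq I) (P : pred I) (F G : I ->
  {mpoly R[n]}) f :
  (forall i, P i -> mdvd f (F i - G i)) ->
  mdvd f (\prod_(i <- r | P i) F i - \prod_(i <- r | P i) G i).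
Proof.
move=> h; elim/big_rec2: _ => [|i p q Pi]; first by rewrite subrr; apply: mdvd0.
by apply: mdvd_mulB; apply: h.
Qed.

Lemma comp_congr f p (lq : n.-tuple {mpoly R[n]}) :
  (forall i, mdvd f ('X_i - tnth lq i)) -> mdvd f (p - (p \mPo lq)).
Proof.
move=> h; rewrite comp_mpolyEX {1}[p]mpolyE -sumrB; apply: mdvd_sum => m _.
rewrite -scalerBr; apply: mdvdZ; rewrite comp_mpolyX mpolyXE_id.
apply: mdvd_prodB => i _; elim: (m i) => [|k IH];
  first by rewrite !expr0 subrr; apply: mdvd0.
by rewrite !exprS; apply: mdvd_mulB.
Qed.

(* The substitution alpha_i -> alpha_i - (lin x) / x_i kills lin x, so that   *)
(* its kernel is the ideal of lin x.                                          *)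
Definition kill x (i : 'I_n) : n.-tuple {mpoly R[n]} :=
  [tuple 'X_j - (j == i)%:R *: ((x 0 i)^-1 *: lin x) | j < n].

Lemma kill_lin x i y :
  lin y \mPo kill x i = lin (y - (y 0 i / x 0 i) *: x).
Proof.
rewrite {1}/lin raddf_sum /=.
under eq_bigr => j _ do rewrite comp_mpolyZ comp_mpolyXU -tnth_nth tnth_mktuple
  scalerBr.
rewrite sumrB -/(lin y) linB linZ; congr (_ - _).
rewrite (bigD1 i) //= eqxx scale1r big1 ?addr0 => [|j ji].
  by rewrite scalerA.
by rewrite (negPf ji) scale0r scaler0.
Qed.

Lemma killP x i f : x 0 i != 0 -> mdvd (lin x) f <-> f \mPo kill x i = 0.
Proof.
move=> xi; split=> [[q ->]|h].
  rewrite rmorphM /= kill_lin divff // scale1r subrr.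
  by rewrite lin0 mul0r.
rewrite -[f]subr0 -h; apply: comp_congr => j.
rewrite tnth_mktuple opprB addrC subrK scalerA.
by rewrite -[X in mdvd X]mulr1 -linZ; rewrite mulr1 linZ; apply: mdvdZ;
  apply: mdvd_refl.
Qed.

(** A nonzero linear form is prime: its ideal is the kernel of a substitution with values in a
    domain, and a form not proportional to it has nonzero image. *)
Lemma lin_coprime x y f : x != 0 -> (forall c : R, y != c *: x) ->
  mdvd (lin x) (lin y * f) -> mdvd (lin x) f.
Proof.
move=> x0 ny; have [i xi] : exists i, x 0 i != 0.
  apply/existsP; apply: contraT => /existsPn h; case/eqP: x0; apply/rowP => i.
  by rewrite mxE; apply/eqP; move: (h i); rewrite negbK.
move/(killP _ xi)/eqP; rewrite rmorphM /= mulf_eq0 kill_lin lin_eq0.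
rewrite subr_eq0 (negPf (ny _)) /= => /eqP h.
exact/(killP _ xi).
Qed.

Lemma lin_prod_coprime (I : Type) (r : seq I) (P : pred I) (X : I ->
  'rV[R]_n) x f :
  x != 0 -> (forall i, P i -> forall c : R, X i != c *: x) ->
  mdvd (lin x) (f * \prod_(i <- r | P i) lin (X i)) -> mdvd (lin x) f.
Proof.
move=> x0 h; elim: r => [|i r IH]; first by rewrite big_nil mulr1.
rewrite big_cons; case: ifP => // Pi; rewrite mulrCA => /lin_coprime.
by move=> /(_ x0 (h i Pi)).
Qed.

Lemma prod_lin_dvd (I : eqType) (r : seq I) (X : I -> 'rV[R]_n) f :
  uniq r -> {in r, forall i, X i != 0} ->
  {in r &, forall i j, i != j -> forall c : R, X j != c *: X i} ->
  {in r, forall i, mdvd (lin (X i)) f} ->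
  mdvd (\prod_(i <- r) lin (X i)) f.
Proof.
elim: r => [|i r IH] /=.
  by move=> _ _ _ _; rewrite big_nil; exists f; rewrite mul1r.
move=> /andP[ir ur] h0 h1 h2; rewrite big_cons.
have sub : {subset r <= i :: r} by move=> j jr; rewrite inE jr orbT.
have [|||q fq] := IH ur; try by [move=> j /sub /h0 | move=> j k /sub jr /sub;
  apply: h1 | move=> j /sub /h2].
have [q' fi] : mdvd (lin (X i)) q.
  apply: (@lin_prod_coprime _ r (fun j => j \in r) X).
  - by apply: h0; rewrite mem_head.
  - move=> j jr c; apply: h1; rewrite ?mem_head ?sub //.
    by apply: contraNneq ir => ->.
  - by rewrite -big_seq mulrC -fq; apply: h2; rewrite mem_head.
by exists q'; rewrite fq fi; ring.
Qed.

Lemma msize_prod_lin (I : Type) (r : seq I) (X : I -> 'rV[R]_n) :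
  (forall i, X i != 0) ->
  \prod_(i <- r) lin (X i) != 0 /\ msize (\prod_(i <- r) lin (X i)) = (size
    r).+1.
Proof.
move=> h0; elim: r => [|i r [IH1 IH2]] /=.
  by rewrite big_nil msize1; split=> //; apply: oner_neq0.
have l0 : lin (X i) != 0 by rewrite lin_eq0.
by rewrite big_cons mulf_neq0 // msizeM // IH2 msize_lin.
Qed.

(** [msize] is the total degree plus one, and 0 for the zero polynomial. *)
Lemma msize_dvd f g : mdvd f g -> f != 0 -> (msize g < msize f)%N -> g = 0.
Proof.
move=> [q ->] f0; have [->|q0] := eqVneq q 0; first by rewrite mulr0.
rewrite msizeM //.
have : (0 < msize q)%N by rewrite lt0n msize_poly_eq0.
have : (0 < msize f)%N by rewrite lt0n msize_poly_eq0.
by case: (msize f) => // a; case: (msize q) => // b _ _; lia.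
Qed.

Lemma msize_dvd_const f g : mdvd f g -> f != 0 -> (msize g <= msize f)%N ->
  exists c : R, g = c *: f.
Proof.
move=> [q ->] f0; have [->|q0] := eqVneq q 0.
  by exists 0; rewrite mulr0 scale0r.
rewrite msizeM // => h.
have /msize1_polyC -> : (msize q <= 1)%N.
  have : (0 < msize f)%N by rewrite lt0n msize_poly_eq0.
  by move: h; case: (msize f) => // a; case: (msize q) => // b; lia.
by exists q@_0%MM; rewrite mulrC mul_mpolyC.
Qed.

End LinearForms.

(** * Fundamental weights *)

Section Weights.
Variables (R : realFieldType) (n : nat) (Phi : root_system R n).
Local Notation F := (gram Phi).
Local Notation T := (rootT Phi).
Local Notation V := 'rV[R]_n.
Local Notation W := (weyl Phi).
Local Notation s_ := (srefl (Phi := Phi)).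
Local Notation al := (simple Phi).
Local Notation om := (fund_weight Phi).
Local Notation "p ** q" := (wmul p q) (at level 40, left associativity).
Implicit Types (b c : T) (p q : {perm T}) (x y : V) (i j : 'I_n).
Hint Resolve srefl_weyl one_weyl : core.

Definition nnv x := [forall i, 0 <= x 0 i].

Lemma nnvP x : reflect (forall i, 0 <= x 0 i) (nnv x).
Proof. exact: forallP. Qed.

Lemma nnv0 : nnv 0.
Proof. by apply/nnvP => i; rewrite mxE. Qed.

Lemma nnvD x y : nnv x -> nnv y -> nnv (x + y).
Proof. by move=> /nnvP hx /nnvP hy; apply/nnvP => i; rewrite mxE addr_ge0. Qed.

Lemma nnvZ (k : R) x : 0 <= k -> nnv x -> nnv (k *: x).
Proof. by move=> k0 /nnvP hx; apply/nnvP => i; rewrite mxE mulr_ge0. Qed.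

Lemma nnv_pos b : pos b -> nnv (val b).
Proof. by move=> pb; apply/nnvP => i; apply: coord_pos. Qed.

Lemma nnv_opp_pos b (k : R) : 0 < k -> pos b -> nnv (- (k *: val b)) = false.
Proof.
move=> k0 /pos_ex [j bj]; apply/negP => /nnvP /(_ j).
by rewrite !mxE oppr_ge0 leNgt mulr_gt0.
Qed.

Lemma nnv_antisym x : nnv x -> nnv (- x) -> x = 0.
Proof.
move=> /nnvP h /nnvP h'; apply/rowP => i; rewrite mxE; apply/eqP.
by rewrite eq_le h andbT; have := h' i; rewrite mxE oppr_ge0.
Qed.

Lemma nnv_antisymB x y : nnv (x - y) -> nnv (y - x) -> x = y.
Proof.
move=> h h'; apply/eqP; rewrite -subr_eq0; apply/eqP; apply: nnv_antisym => //.
by rewrite opprB.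
Qed.

Lemma gram_diag_gt0 i : 0 < F i i.
Proof.
by have := inner_root_gt0 (al i); rewrite inner_simple /simple_vec -rowE mxE.
Qed.

(** The fundamental weights are dual to the simple roots up to positive factors. This translates the
    vanishing of coordinates, and hence [height_index], into statements about fundamental
    weights. *)
Lemma inner_om i x : inner F (om i) x = F i i / 2%:R * x 0 i.
Proof.
rewrite /inner /fund_weight -!scalemxAl -row_mul mulVmx ?gram_unit // mxE.
congr (_ * _); rewrite !mxE (bigD1 i) //= big1 ?addr0.
  by rewrite !mxE eqxx mul1r.
by move=> j ji; rewrite !mxE eq_sym (negPf ji) mul0r.
Qed.

Lemma pairing_om i b :
  pairing F (om i) (val b) = F i i / inner F (val b) (val b) * val b 0 i.
Proof. by rewrite /pairing inner_om; field; rewrite inner_root_neq0. Qed.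

Lemma pairing_om_ge0 i b : pos b -> 0 <= pairing F (om i) (val b).
Proof.
move=> pb; rewrite pairing_om mulr_ge0 ?coord_pos // ltW // divr_gt0 //.
  exact: gram_diag_gt0.
exact: inner_root_gt0.
Qed.

Lemma pairing_om_eq0 i b : (pairing F (om i) (val b) == 0) = (val b 0 i == 0).
Proof.
rewrite pairing_om mulf_eq0 gt_eqF // divr_gt0 ?gram_diag_gt0 //.
exact: inner_root_gt0.
Qed.

Lemma pairing_om_gt0 i b : pos b -> val b 0 i != 0 ->
  0 < pairing F (om i) (val b).
Proof. by move=> pb bi; rewrite lt0r pairing_om_eq0 bi pairing_om_ge0. Qed.

Lemma inner_simple_eq0 x : (forall k, inner F x (simple_vec R k) = 0) -> x = 0.
Proof.
move=> h; have e : x *m F = 0 by apply/rowP => k; rewrite -inner_simple h mxE.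
by rewrite -[x]mulmx1 -(mulmxV (gram_unit Phi)) mulmxA e mul0mx.
Qed.

Lemma inner_om_eq0 x : (forall k, inner F (om k) x = 0) -> x = 0.
Proof.
move=> h; apply/rowP => k; rewrite mxE; have /eqP := h k.
rewrite inner_om mulf_eq0 gt_eqF ?divr_gt0 ?gram_diag_gt0 ?ltr0n //=.
by move/eqP.
Qed.

Lemma om_fix p : p \in W -> (forall i, wact p (om i) = om i) -> p = 1%g.
Proof.
move=> pW h; apply/permP => b; rewrite perm1; apply/val_inj.
apply/eqP; rewrite -subr_eq0; apply/eqP/inner_om_eq0 => k.
rewrite innerBr -{1}(h k) -wact_root // inner_wact // subrr //.
Qed.

Lemma om_separate p q : p \in W -> q \in W ->
  (forall i, wact p (om i) = wact q (om i)) -> p = q.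
Proof.
move=> pW qW h; have : q^-1%g ** p = 1%g.
  apply: om_fix; first by rewrite wmul_weyl ?inv_weyl.
  by move=> i; rewrite wactM ?inv_weyl // h wactK.
by move=> e; rewrite -[p]wmul1p -(wmulpV q) -wmulA e wmulp1.
Qed.

Lemma wact_up p b x : p \in W ->
  wact (p ** s_ b) x = wact p x - pairing F x (val b) *: val (p b).
Proof.
by move=> pW; rewrite wactM // wact_srefl /reflect_vec wactB wactZ wact_root.
Qed.

Lemma height_neq0 b : val b 0 (height_index b) != 0.
Proof.
rewrite /height_index; case: arg_minnP => //.
exact: xchooseP (root_coord_neq0 b).
Qed.

Lemma height_min b j : (j < height_index b)%N -> val b 0 j = 0.
Proof.
move=> h; apply/eqP; move: h; apply: contraTT => bj; rewrite -leqNgt.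
rewrite /height_index; case: arg_minnP => //;
  first exact: xchooseP (root_coord_neq0 b).
by move=> i _; apply.
Qed.

Lemma height_uniq b i : (forall j : 'I_n,
  (j < i)%N -> val b 0 j = 0) -> val b 0 i != 0 ->
  height_index b = i.
Proof.
move=> h bi; apply/val_inj/eqP; rewrite /= eqn_leq; apply/andP; split.
  by rewrite leqNgt; apply: contra bi => /height_min ->.
by rewrite leqNgt; apply: contraNN (height_neq0 b) => /h ->.
Qed.

(** Evaluating both reflections at b gives -b = b - <b, c> c, so b and c are proportional. *)
Lemma srefl_inj b c : pos b -> pos c -> s_ b = s_ c -> b = c.
Proof.
move=> pb pc e; have := congr1 (fun w : {perm T} => val (w b)) e.
rewrite /= !srefl_root reflect_self /reflect_vec => h.
have b0 : inner F (val b) (val b) != 0 by exact: inner_root_neq0.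
have h2 : pairing F (val b) (val c) *: val c = 2%:R *: val b.
  have -> : 2%:R *: val b = val b - - val b by rewrite opprK scaler_nat mulr2n.
  by rewrite h opprB addrC subrK.
apply/esym/(@pos_prop _ _ _ _ _ (pairing F (val b) (val c) / 2%:R)^-1) => //.
have k0 : pairing F (val b) (val c) / 2%:R != 0.
  apply: contra (root_vec_neq0 b);
    rewrite mulf_eq0 invr_eq0 (pnatr_eq0 _ 2) orbF => /eqP k0.
  by move: h2; rewrite k0 scale0r => /esym/eqP;
    rewrite scaler_eq0 (pnatr_eq0 _ 2).
apply: (scalerI k0); rewrite scalerA divff // scale1r mulrC -scalerA h2.
by rewrite scalerA mulVf ?(pnatr_eq0 _ 2) // scale1r.
Qed.

End Weights.

(** * Schubert classes and the Chevalley formula *)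

Section GKM.
Variables (R : realFieldType) (n : nat) (Phi : root_system R n).
Local Notation F := (gram Phi).
Local Notation T := (rootT Phi).
Local Notation V := 'rV[R]_n.
Local Notation W := (weyl Phi).
Local Notation s_ := (srefl (Phi := Phi)).
Local Notation al := (simple Phi).
Local Notation om := (fund_weight Phi).
Local Notation "p ** q" := (wmul p q) (at level 40, left associativity).
Implicit Types (b c : T) (p q : {perm T}) (x y : V) (i j : 'I_n).
Hint Resolve srefl_weyl one_weyl : core.
Local Notation P := {mpoly R[n]}.
Implicit Types (f g : {perm T} -> P).

(* The divisibility conditions of Goresky, Kottwitz and MacPherson. *)
Definition gkm f := forall p b, p \in W -> pos b ->
  mdvd (lin (val (p b))) (f (p ** s_ b) - f p).

(* The conditions on the degree and on the support are weaker than those of a *)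
(* Schubert class, but still determine it.                                    *)
Definition schub u f := [/\ gkm f,
  forall p, p \in W -> (msize (f p) <= (ell u).+1)%N,
  forall p, p \in W -> (ell p <= ell u)%N -> p != u -> f p = 0
  & f u = Lambda_minus u].

Lemma Lambda_invs u : u \in W ->
  Lambda_minus u = \prod_(b in invs u) lin (val (oproot (u b))).
Proof.
move=> uW; rewrite /Lambda_minus.
rewrite (reindex_inj (h := fun b => oproot (u b))) /=; last first.
  by move=> b c /(can_inj (@oppK _ _ _)) /perm_inj.
apply: eq_bigl => b; rewrite inE -neg_opp -perm_opp // permK andbC.
by rewrite -pos_opp.
Qed.

Lemma invs_prod_dvd u (A : {set T}) (g : P) : u \in W -> A \subset invs u ->
  (forall b, b \in A -> mdvd (lin (val (u b))) g) ->
  mdvd (\prod_(b in A) lin (val (@oproot _ _ Phi (u b)))) g.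
Proof.
move=> uW sA h; rewrite -big_enum /=; apply: prod_lin_dvd.
- exact: enum_uniq.
- by move=> b _; apply: root_vec_neq0.
- move=> b c; rewrite !mem_enum => bA cA bc k; apply: contraNneq bc => e.
  have := subsetP sA _ bA; have := subsetP sA _ cA.
  rewrite !inE => /andP[pc _] /andP[pb _].
  apply/eqP/esym/(@pos_prop _ _ _ _ _ k) => //; apply: (wact_inj uW).
  by apply: oppr_inj; rewrite wactZ -scalerN !wact_root // -!(val_opp (Phi :=
    Phi)).
- move=> b; rewrite mem_enum => bA /=; rewrite (val_opp (u b)) linN;
    apply: mdvdNl; exact: h.
Qed.

Lemma msize_invs_prod (u : {perm T}) (A : {set T}) :
  let L := \prod_(b in A) lin (val (oproot (u b))) in
  L != 0 /\ msize L = #|A|.+1.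
Proof.
rewrite /= cardE -!big_enum /=.
by apply: msize_prod_lin => b; apply: root_vec_neq0.
Qed.

(** Each inversion b of p makes f p divisible by the root p b. These are ell p pairwise
    nonproportional forms, too many for a nonzero polynomial of degree below ell p. *)
Lemma gkm_vanish f p : gkm f -> p \in W ->
  (forall b, b \in invs p -> f (p ** s_ b) = 0) ->
  (msize (f p) <= ell p)%N -> f p = 0.
Proof.
move=> hf pW h sz.
have [L0 Ls] := msize_invs_prod p (invs p).
apply: msize_dvd (L0) _; last by rewrite Ls ltnS -/(Ninv p) -ell_Ninv.
apply: invs_prod_dvd => // b bi.
rewrite -[f p]opprK -[- f p]add0r -(h b bi); apply: mdvdN; apply: hf => //.
by move: bi; rewrite inE => /andP[].
Qed.

Lemma Lambda_simple u i : u \in W -> pos (u (al i)) ->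
  Lambda_minus (u ** s_ (al i)) = lin (val (u (al i))) * Lambda_minus u.
Proof.
move=> uW pi; rewrite /Lambda_minus (bigD1 (u (al i))) /=; last first.
  by rewrite pi wmulV sreflV wmulE neg_simple_step // eqxx.
congr (_ * _); apply: eq_bigl => b; rewrite wmulV sreflV wmulE.
case pb: (pos b) => //=; rewrite neg_simple_step //.
by case: eqVneq => [->|_] /=; rewrite ?andbT // permK negE simple_pos.
Qed.

Lemma pos_not_prop p b c : p \in W -> pos b -> pos c -> b != c ->
  forall k : R, val (p c) != k *: val (p b).
Proof.
move=> pW pb pc bc k; apply: contraNneq bc => e.
apply/eqP/esym/(@pos_prop _ _ _ _ _ k) => //; apply: (wact_inj pW).
by rewrite wactZ !wact_root.
Qed.

(* A divided difference in direction s_i lowers the class of u s_i to that    *)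
(* of u.                                                                      *)
Lemma schub_lower u i f : u \in W -> pos (u (al i)) ->
  schub (u ** s_ (al i)) f ->
  exists g, schub u g.
Proof.
move=> uW pi; set u' := u ** s_ (al i); move=> [hf fs f0 fu].
have lu : ell u' = (ell u).+1 by apply: ell_simple.
have /fin_all_exists [g hg] (p : {perm T}) : exists q : P, p \in W ->
    f (p ** s_ (al i)) - f p = lin (val (p (al i))) * q.
  case pW : (p \in W); last by exists 0.
  by have [q hq] := hf p _ pW (simple_pos Phi i); exists q.
have linn0 p : lin (val (p (al i))) != 0 by rewrite lin_eq0 root_vec_neq0.
exists g; split.
- move=> p b pW pb; have [->|nb] := eqVneq b (al i).
    suff -> : g (p ** s_ (al i)) = g p by rewrite subrr; apply: mdvd0.
    apply: (mulfI (linn0 p)); rewrite -hg //; apply: oppr_inj.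
    rewrite -mulNr -linN -val_opp -perm_opp // -wmulE.
    have := hg (p ** s_ (al i)) (wmul_weyl pW (srefl_weyl _)).
    by rewrite sreflK => <-; rewrite opprB.
  (* It suffices to divide the product with p alpha_i, which is expressed by values of f; p alpha_i
     is not proportional to p b. *)
  apply: (@lin_coprime _ _ _ (val (p (al i)))).
  + exact: root_vec_neq0.
  + by apply: pos_not_prop; rewrite ?simple_pos.
  have /hg hA : p ** s_ b \in W by rewrite wmul_weyl.
  rewrite reflect_perm // in hA.
  have e1 := hg p pW; set k := pairing F _ _ in hA.
  have -> : lin (val (p (al i))) * (g (p ** s_ b) - g p) =
     (f (p ** s_ b ** s_ (al i)) - f (p ** s_ (al i))) - (f (p ** s_ b) - f p)
      + k *: (lin (val (p b)) * g (p ** s_ b)).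
    rewrite mulrBr -e1; clearbody k; move: hA;
      rewrite linB linZ mulrBl -scalerAl => hA.
    set x := k *: _ in hA *; set y := lin _ * _ in hA *.
    have -> : y = y - x + x by rewrite subrK.
    by rewrite -hA; ring.
  apply: mdvdD; last by apply: mdvdZ; apply: mdvdMr; apply: mdvd_refl.
  apply: mdvdB; last exact: hf.
  (* The edge from p s_i to p s_b s_i carries the label s_i b, and its root (p s_i)(s_i b) is again
     p b. *)
  have -> : p ** s_ b ** s_ (al i) = p ** s_ (al i) ** s_ (s_ (al i) b).
    rewrite -!wmulA; congr (_ ** _);
      have := srefl_conj (s_ (al i) b) (srefl_weyl (al i)).
    by rewrite srefl_rootK.
  have := hf (p ** s_ (al i)) _ (wmul_weyl pW (srefl_weyl _)) (srefl_simple_pos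
    pb nb).
  by rewrite wmulE srefl_rootK.
- move=> p pW; have [->|g0] := eqVneq (g p) 0; first by rewrite msize0.
  have : (msize (lin (val (p (al i))) * g p) <= (ell u).+2)%N.
    rewrite -hg //; apply: leq_trans (msizeD_le _ _) _;
      rewrite msizeN geq_max -lu.
    by rewrite !fs ?wmul_weyl.
  by rewrite msizeM // msize_lin ?root_vec_neq0.
- move=> p pW pu np; apply: (mulfI (linn0 p)); rewrite -hg // mulr0.
  rewrite !f0 ?subrr ?wmul_weyl //.
  + by rewrite lu; apply: leq_trans pu _.
  + by apply: contraTneq pu => ->; rewrite lu ltnn.
  + rewrite lu; apply: leq_trans (_ : (ell p).+1 <= _)%N; last by rewrite ltnS.
    by rewrite !ell_Ninv ?wmul_weyl // Ninv_simple_le.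
  + by apply: contraNneq np => e; rewrite -(sreflK p (al i)) e sreflK.
- apply: (mulfI (linn0 u)); rewrite -hg // -Lambda_simple // -fu.
  rewrite (f0 u) ?subr0 ?lu //; by apply: contraTneq (leqnn (ell u)) => e;
    rewrite {1}e lu ltnn.
Qed.

Lemma msize_Lambda u : u \in W -> msize (Lambda_minus u) = (ell u).+1.
Proof.
move=> uW; rewrite Lambda_invs // ell_Ninv //.
by have [_ ->] := msize_invs_prod u (invs u).
Qed.

(** Such a u is the longest element: it makes every positive root negative. The class is
    concentrated at u, and its value there is divisible by all roots. *)
Lemma schub_top u : u \in W -> (forall i, neg (u (al i))) -> exists f,
  schub u f.
Proof.
move=> uW top.
have {}top b : pos b -> neg (u b).
  move=> pb; rewrite neg_opp /pos /vec_pos root_vec_neq0; apply/forallP => j.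
  rewrite val_opp -wact_root // [val b]row_simple_sum wact_sum mxE summxE
    oppr_ge0.
  apply: sumr_le0 => k _; rewrite wactZ wact_simple mxE.
  apply: mulr_ge0_le0; first exact: coord_pos.
  by have := top k; rewrite neg_opp => /(coord_pos j);
    rewrite val_opp mxE oppr_ge0.
have dvd b : pos b -> mdvd (lin (val (u b))) (Lambda_minus u).
  move=> pb; rewrite /Lambda_minus (bigD1 (oproot (u b))) /=.
    by apply: mdvdMr; rewrite val_opp linN; apply: mdvdN; apply: mdvd_refl.
  rewrite -neg_opp top //= -perm_opp // permK neg_opp.
  by have -> : oproot (oproot b) = b by exact: oppK.
exists (fun p => if p == u then Lambda_minus u else 0); split.
- move=> p b pW pb; have [pu|pu] := eqVneq p u.
    rewrite ifN ?sub0r; first by rewrite pu; apply: mdvdN; apply: dvd.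
    apply: contraTneq pb => e;
      have := congr1 (fun w : {perm T} => w b) (etrans e (esym pu)).
    rewrite /= wmulE => /perm_inj eb; have := pos_oppE b.
    by rewrite /oproot eb; case: (pos b).
  rewrite subr0; case: eqP => e; last exact: mdvd0.
  have -> : p = u ** s_ b by rewrite -e sreflK.
  rewrite wmulE -/(oproot b) perm_opp // val_opp linN.
  by apply: mdvdNl; apply: dvd.
- move=> p pW; case: ifP => _; rewrite ?msize0 //.
  by rewrite msize_Lambda.
- by move=> p _ _ /negPf ->.
- by rewrite eqxx.
Qed.

(** Downward induction from the longest element: any other u has a simple ascent u s_i, and
    [schub_lower] comes down from there. *)
Lemma schub_exists u : u \in W -> exists f, schub u f.
Proof.
move: {2}(#|{: T}| - Ninv u)%N (leqnn (#|{: T}| - Ninv u)%N) => k.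
elim: k u => [|k IH] u hk uW.
  (* With k = 0 an ascent u s_i would have more inversions than there are roots. *)
  case: (boolP [forall i, neg (u (al i))]) => [/forallP|];
    first exact: schub_top.
  move/forallPn => [i]; rewrite negE negbK => pi.
  have := Ninv_simple uW pi.
  have : (Ninv (u ** s_ (al i)) <= #|{: T}|)%N by apply: max_card.
  lia.
case: (boolP [forall i, neg (u (al i))]) => [/forallP|]; first exact: schub_top.
move/forallPn => [i]; rewrite negE negbK => pi.
have [f hf] : exists f, schub (u ** s_ (al i)) f.
  by apply: IH; rewrite ?wmul_weyl // Ninv_simple //; lia.
exact: schub_lower hf.
Qed.

Lemma schub_gkm u f : schub u f -> gkm f.
Proof. by case. Qed.

Lemma schub_size u f p : schub u f -> p \in W -> (msize (f p) <= (ell u).+1)%N.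
Proof. by case=> _ h _ _; apply: h. Qed.

Lemma schub_small u f p : schub u f -> p \in W -> (ell p <= ell u)%N ->
  p != u -> f p = 0.
Proof. by case=> _ _ h _; apply: h. Qed.

(* f (u s_b) is divisible by every root of Lambda_(u s_b) other than u b, and *)
(* the constant quotient is 1 because both sides agree modulo u b.            *)
Lemma schub_cover u f b : u \in W -> schub u f -> pos b -> pos (u b) ->
  ell (u ** s_ b) = (ell u).+1 ->
  lin (val (u b)) * f (u ** s_ b) = Lambda_minus (u ** s_ b).
Proof.
move=> uW hf pb pub hl; set v := u ** s_ b in hl *.
have vW : v \in W by rewrite wmul_weyl.
have bv : b \in invs v by apply: invs_up.
set A := invs v :\ b.
have cA : #|A| = Ninv u.
  by apply/eqP; rewrite -eqSS -ell_Ninv // -hl ell_Ninv // /Ninv (cardsD1 b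
    (invs v)) bv.
have AE : A = foldinv b @: invs u.
  apply/esym/eqP; rewrite eqEcard (card_in_imset (@foldinv_inj _ _ _ u b)) cA
    leqnn andbT.
  by apply/subsetP => _ /imsetP [c ci ->]; apply: foldinv_invs.
rewrite Lambda_invs // (bigD1 b) //=.
have -> : oproot (v b) = u b by rewrite /v wmulE -/(oproot b) perm_opp //
  [LHS]oppK.
congr (_ * _); rewrite (eq_bigl (mem A)); last first.
  by move=> c; rewrite inE !inE andbC.
set P0 := \prod_(c in A) _.
have [P0nz P0s] : P0 != 0 /\ msize P0 = #|A|.+1 by apply: msize_invs_prod.
have [k hk] : exists k : R, f v = k *: P0.
  apply: msize_dvd_const P0nz _; last first.
    by rewrite P0s cA -ell_Ninv //; apply: schub_size hf vW.
  apply: invs_prod_dvd => //; first exact: subsetDl.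
  move=> c; rewrite !inE => /and3P[cb pc nc].
  suff fc : f (v ** s_ c) = 0.
    rewrite -[f v]opprK -[- f v]add0r -fc; apply: mdvdN; exact: (schub_gkm hf).
  apply: (schub_small hf); first by rewrite wmul_weyl.
    by rewrite -ltnS -hl; apply: ell_down.
  apply: contraNneq cb => e; apply/eqP/srefl_inj => //.
  by have := congr1 (wmul u^-1%g) e;
    rewrite /v !wmulA wmulVp wmul1p => /(congr1 (fun w => w ** s_ c));
      rewrite sreflK wmul1p.
have d1 : mdvd (lin (val (u b))) (f v - f u) by apply: (schub_gkm hf).
(* [foldinv] matches the factors of the two products: matched factors are equal or differ by a
   multiple of u b. *)
have d2 : mdvd (lin (val (u b))) (P0 - Lambda_minus u).
  rewrite /P0 AE (big_imset _ (@foldinv_inj _ _ _ u b)) /= Lambda_invs //.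
  apply: mdvd_prodB => c ci; rewrite /foldinv -linB !val_opp; case: ifP => _.
    rewrite reflect_perm // opprB opprK subrK linZ; apply: mdvdZ;
      exact: mdvd_refl.
  by rewrite /v wmulE srefl_rootK subrr lin0; apply: mdvd0.
have fu : f u = Lambda_minus u by case: hf.
have d3 : mdvd (lin (val (u b))) ((k - 1) *: Lambda_minus u).
  have -> : (k - 1) *: Lambda_minus u = (f v - f u) - k *: (P0 - Lambda_minus
    u).
    by rewrite hk fu scalerBl scale1r scalerBr; ring.
  by apply: mdvdB => //; apply: mdvdZ.
have [k1|k1] := eqVneq k 1; first by rewrite hk k1 scale1r.
have /msize_dvd : mdvd (lin (val (u b))) (k - 1)%:MP.
  apply: (@lin_prod_coprime _ _ _ (index_enum _) (fun c => c \in invs u)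
            (fun c => val (oproot (u c)))).
  - exact: root_vec_neq0.
  - move=> c; rewrite inE => /andP[pc nc] k'; apply/eqP => e.
    have := pos_prop pub _ e; rewrite -neg_opp => /(_ nc).
    rewrite -perm_opp // => /perm_inj eb.
    by move: pb; rewrite -eb pos_oppE pc.
  by rewrite -Lambda_invs // mul_mpolyC.
rewrite lin_eq0 root_vec_neq0 msize_lin ?root_vec_neq0 // => /(_ isT).
rewrite ltnS msizeC leq_b1 => /(_ isT)/eqP; rewrite mpolyC_eq0 subr_eq0.
by rewrite (negPf k1).
Qed.

(** The difference h of the two sides satisfies the GKM conditions and has degree at most ell u + 1,
    so [gkm_vanish] carries its vanishing to all q longer than that. Among the shorter q, both sides
    are 0 unless q is a cover u s_b, where they agree by [schub_cover]. *)
Lemma chevalley u f (G : T -> {perm T} -> P) i p : u \in W -> schub u f ->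
  (forall b, schub (u ** s_ b) (G b)) -> p \in W ->
  lin (wact u (om i) - wact p (om i)) * f p =
  \sum_(b | [&& pos b, pos (u b) & ell (u ** s_ b) == (ell u).+1])
    pairing F (om i) (val b) *: G b p.
Proof.
move=> uW hf hG.
set h := fun p => lin (wact u (om i) - wact p (om i)) * f p -
  \sum_(b | [&& pos b, pos (u b) & ell (u ** s_ b) == (ell u).+1])
    pairing F (om i) (val b) *: G b p.
suff hp : forall q, q \in W -> h q = 0 by move=> /hp /eqP;
  rewrite subr_eq0 => /eqP.
have ubW b : u ** s_ b \in W by rewrite wmul_weyl.
have gkmh : gkm h.
  move=> q b qW pb; rewrite /h.
  have -> : forall x y z t : P, x - y - (z - t) = (x - z) - (y - t).
    by move=> x y z t; ring.
  apply: mdvdB.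
    apply: mdvd_mulB; last exact: (schub_gkm hf).
    rewrite -linB wact_up // !opprB (addrC (wact u _)) -addrA (addrCA (wact u
      _)).
    rewrite subrr addr0 subrK linZ; apply: mdvdZ; exact: mdvd_refl.
  rewrite -sumrB; apply: mdvd_sum => c _; rewrite -scalerBr; apply: mdvdZ.
  exact: (schub_gkm (hG c)).
have sizeh q : q \in W -> (msize (h q) <= (ell u).+2)%N.
  move=> qW; apply: leq_trans (msizeD_le _ _) _; rewrite msizeN geq_max;
    apply/andP; split.
    have [->|f0] := eqVneq (f q) 0; first by rewrite mulr0 msize0.
    have [->|l0] := eqVneq (wact u (om i) - wact q (om i)) 0;
      first by rewrite lin0 mul0r msize0.
    by rewrite msizeM ?lin_eq0 // msize_lin // ltnS; apply: schub_size hf qW.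
  elim/big_ind: _ => [|x y hx hy|b]; first by rewrite msize0.
    by apply: leq_trans (msizeD_le _ _) _; rewrite geq_max hx.
  case/and3P=> _ _ /eqP e; apply: leq_trans (msizeZ_le _ _) _.
  by rewrite -e; apply: schub_size (hG b) qW.
move=> q; have [m] := ubnP (ell q); elim: m q => // m IH q;
  rewrite ltnS => qm qW.
have [lq|lq] := ltnP (ell u).+1 (ell q).
  apply: gkm_vanish => // [b|]; last by apply: leq_trans (sizeh q qW) lq.
  rewrite inE => /andP[pb nb]; apply: IH; last by rewrite wmul_weyl.
  by apply: leq_trans qm; apply: ell_down.
have G0 b : ell (u ** s_ b) = (ell u).+1 -> q != u ** s_ b -> G b q = 0.
  by move=> e ne; apply: (schub_small (hG b)) => //; rewrite e.
case: (boolP [exists b, [&& pos b, pos (u b) & q == u ** s_ b]]).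
  case/existsP=> b /and3P[pb pub /eqP e].
  have lb : ell (u ** s_ b) = (ell u).+1.
    by apply/eqP; rewrite eqn_leq -{1}e lq ell_up.
  rewrite /h (bigD1 b) /=; last by rewrite pb pub lb eqxx.
  rewrite big1 ?addr0; last first.
    move=> c /andP[/and3P[pc puc /eqP lc] cb]; rewrite G0 ?scaler0 //.
    apply: contraNneq cb => e'; apply/eqP/srefl_inj => //.
    have := congr1 (wmul u^-1%g) (etrans (esym e') e).
    by rewrite !wmulA wmulVp !wmul1p.
  have -> : G b q = Lambda_minus q by rewrite e; case: (hG b).
  rewrite e -(schub_cover uW hf pb pub lb) wact_up // opprB (addrC (wact u _))
    subrK linZ.
  by rewrite -scalerAl subrr.
move=> /existsPn ne; rewrite /h.
have -> : lin (wact u (om i) - wact q (om i)) * f q = 0.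
  have [->|qu] := eqVneq q u; first by rewrite subrr lin0 mul0r.
  move: lq; rewrite leq_eqVlt ltnS => /orP[/eqP lq|lq]; last first.
    by rewrite (schub_small hf) ?mulr0.
  (* Here ell q = ell u + 1 and no ascending edge leads from u to q. The lower neighbours of q have
     length at most ell u and differ from u, so f vanishes there, and f q has degree at most ell
     u. *)
  suff -> : f q = 0 by rewrite mulr0.
  apply: gkm_vanish => //; first exact: schub_gkm hf.
    move=> b; rewrite inE => /andP[pb nb]; apply: (schub_small hf).
    - by rewrite wmul_weyl.
    - by rewrite -ltnS -lq; apply: ell_down.
    - apply: contraNneq (ne b) => e;
        rewrite pb -e sreflK eqxx wmulE -/(oproot b).
      by rewrite perm_opp // -neg_opp nb.
  by rewrite lq; apply: schub_size hf qW.
rewrite big1 ?subrr // => b /and3P[pb pub /eqP lb]; rewrite G0 ?scaler0 //.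
by have := ne b; rewrite pb pub.
Qed.

(** If the condition on weights fails at p, it fails at every lower neighbour: p s_b om_j is p om_j
    plus a nonnegative multiple of the positive root -p b. Induction and [gkm_vanish] conclude. *)
Lemma schub_support u f j p : u \in W -> schub u f -> p \in W ->
  ~~ nnv (wact u (om j) - wact p (om j)) -> f p = 0.
Proof.
move=> uW hf; have [m] := ubnP (ell p); elim: m p => // m IH p;
  rewrite ltnS => pm pW hn.
have [lp|lp] := ltnP (ell u) (ell p); last first.
  apply: (schub_small hf) => //; apply: contraNneq hn => ->.
  by rewrite subrr nnv0.
apply: gkm_vanish => //; first exact: schub_gkm hf.
  move=> b; rewrite inE => /andP[pb nb]; apply: IH.
  - by apply: leq_trans pm; apply: ell_down.
  - by rewrite wmul_weyl.
  apply: contra hn => h; rewrite wact_up // in h.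
  have -> : wact u (om j) - wact p (om j) =
    wact u (om j) - (wact p (om j) - pairing F (om j) (val b) *: val (p b))
      + pairing F (om j) (val b) *: val (oproot (p b)).
    by rewrite val_opp scalerN opprB -[in RHS]addrA [X in _ = _ + X]addrAC
      subrr add0r.
  by apply: nnvD h _; apply: nnvZ;
    rewrite ?pairing_om_ge0 // nnv_pos // -neg_opp.
by apply: leq_trans (schub_size hf pW) lp.
Qed.

End GKM.

Local Arguments pos : simpl never.
Local Arguments neg : simpl never.

(** * The chain formula *)

Section Chains.
Variables (R : realFieldType) (n : nat) (Phi : root_system R n).
Local Notation F := (gram Phi).
Local Notation T := (rootT Phi).
Local Notation V := 'rV[R]_n.
Local Notation W := (weyl Phi).
Local Notation s_ := (srefl (Phi := Phi)).
Local Notation al := (simple Phi).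
Local Notation om := (fund_weight Phi).
Local Notation "p ** q" := (wmul p q) (at level 40, left associativity).
Implicit Types (b : T) (c : seq T) (p q u v : {perm T}) (x y : V) (i j : 'I_n).
Hint Resolve srefl_weyl one_weyl : core.
Local Notation P := {mpoly R[n]}.
Local Notation h_ := (@height_index R n Phi).
Local Notation heights := (map (fun b => val (h_ b))).

(** [is_chain] is split into ascents ([asc]) and length conditions ([covers]). For an ascending
    chain the latter only say that the number of edges is the difference of the lengths
    ([asc_coversE]). *)
Fixpoint asc (u v : {perm T}) (c : seq T) : bool :=
  if c is b :: c' then [&& pos b, pos (u b) & asc (u ** s_ b) v c'] else u == v.

Fixpoint covers (u : {perm T}) (c : seq T) : bool :=
  if c is b :: c' then (ell (u ** s_ b) == (ell u).+1) && covers (u ** s_ b) c'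
  else true.

Fixpoint Eprod (u v : {perm T}) (c : seq T) : {fraction P} :=
  if c is b :: c' then
    let w := om (h_ b) in
    ((pairing F w (val b))%:MP)%:F / (lin (wact u w - wact v w))%:F *
      Eprod (u ** s_ b) v c'
  else 1.

Lemma forall_ordS m (p : pred 'I_m.+1) :
  [forall k, p k] = p ord0 && [forall k, p (lift ord0 k)].
Proof.
apply/forallP/andP => [h|[h0 /forallP h] k]; first by split=> //; apply/forallP.
by have [j ->|->] := unliftP ord0 k.
Qed.

Lemma is_chainE m u v (c : m.-tuple T) : is_chain u v c = asc u v c && covers u
  c.
Proof.
elim: m u c => [|m IH] u c.
  rewrite (tuple0 c) /is_chain andbC /chain_vertex /= andbT.
  by case: eqP => //= _; apply/forallP => -[].
case/tupleP: c => b c.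
have e k : chain_vertex u [tuple of b :: c] k.+1 = chain_vertex (u ** s_ b) c k
  by [].
have e0 : chain_vertex u [tuple of b :: c] 0 = u by [].
have e1 : chain_vertex (u ** s_ b) c 0 = u ** s_ b.
  by rewrite /chain_vertex take0.
have -> : asc u v [tuple of b :: c] = [&& pos b,
  pos (u b) & asc (u ** s_ b) v c] by [].
have -> : covers u [tuple of b :: c] = (ell (u ** s_ b) == (ell u).+1) &&
  covers (u ** s_ b) c by [].
rewrite /is_chain forall_ordS e tnth0 [nat_of_ord ord0]/= e0 e e1.
case: (pos b) => //; case: (pos (u b)) => //; rewrite !andTb.
rewrite [in RHS]andbCA -(IH _ c) /is_chain -andbA; congr (_ && (_ && _)).
by apply: eq_forallb => k; rewrite tnthS.
Qed.

Lemma E_Eprod m u v (c : m.-tuple T) : E u v c = (Lambda_minus v)%:F * Eprod u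
  v c.
Proof.
rewrite /E; congr (_ * _); elim: m u c => [|m IH] u c.
  by rewrite big_ord0 (tuple0 c).
case/tupleP: c => b c;
  rewrite big_ord_recl tnth0 -[RHS]/(_ * Eprod (u ** s_ b) v c).
congr (_ * _); rewrite -IH; apply: eq_bigr => k _.
by rewrite tnthS.
Qed.

Lemma C0E (u v : {perm T}) (c : (ell v - ell u).-tuple T) : (c \in C0 u v) =
  [&& asc u v c, covers u c & sorted leq (heights c)].
Proof. by rewrite inE is_chainE andbA. Qed.

Lemma asc_weyl u v c : u \in W -> asc u v c -> v \in W.
Proof.
elim: c u => [|b c IH] u uW /=; first by move/eqP <-.
by case/and3P=> _ _; apply: IH; rewrite wmul_weyl.
Qed.

(** Each edge b subtracts from u om_j the nonnegative multiple <om_j, b> of the positive root u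
    b. *)
Lemma asc_nnv u v c j : u \in W -> asc u v c ->
  nnv (wact u (om j) - wact v (om j)).
Proof.
elim: c u => [|b c IH] u uW /=; first by move/eqP ->; rewrite subrr nnv0.
case/and3P=> pb pub /IH; rewrite wmul_weyl // => /(_ isT).
rewrite wact_up // => h.
have -> : wact u (om j) - wact v (om j) = pairing F (om j) (val b) *: val (u b)
  +
    (wact u (om j) - pairing F (om j) (val b) *: val (u b) - wact v (om j)).
  by rewrite addrA (addrC (_ *: _)) subrK.
by apply: nnvD h; apply: nnvZ; rewrite ?pairing_om_ge0 // nnv_pos.
Qed.

Lemma asc_fix u v c j : u \in W -> asc u v c ->
  all (fun b => (j < h_ b)%N) c -> wact u (om j) = wact v (om j).
Proof.
elim: c u => [|b c IH] u uW /=; first by move/eqP ->.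
case/and3P=> pb pub a /andP[jb hc]; rewrite -(IH _ _ a hc) ?wmul_weyl //.
rewrite wact_up // (_ : pairing _ _ _ = 0) ?scale0r ?subr0 //.
by apply/eqP; rewrite pairing_om_eq0 height_min.
Qed.

Lemma asc_head_neq u v b c : u \in W -> asc u v (b :: c) ->
  wact u (om (h_ b)) != wact v (om (h_ b)).
Proof.
move=> uW /= /and3P[pb pub /asc_nnv]; rewrite wmul_weyl // => /(_ (h_ b) isT).
rewrite wact_up // => h; apply: contraTneq h => ->.
by rewrite addrAC subrr add0r nnv_opp_pos // pairing_om_gt0 // height_neq0.
Qed.

Lemma asc_ell u v c : u \in W -> asc u v c -> (ell u + size c <= ell v)%N.
Proof.
elim: c u => [|b c IH] u uW /=; first by move/eqP ->; rewrite addn0.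
case/and3P=> pb pub /IH; rewrite wmul_weyl // => /(_ isT).
by apply: leq_trans; rewrite addnS -addSn leq_add2r ell_up.
Qed.

Lemma asc_coversE u v c : u \in W -> asc u v c ->
  covers u c = (ell u + size c == ell v)%N.
Proof.
elim: c u => [|b c IH] u uW /=; first by move/eqP ->; rewrite addn0 eqxx.
case/and3P=> pb pub a; rewrite IH ?wmul_weyl //.
have := ell_up uW pb pub; have := asc_ell (wmul_weyl uW (srefl_weyl b)) a.
rewrite addnS => h1 h2; apply/andP/eqP => [[/eqP e /eqP]|e];
  first by rewrite e addSn.
have e1 : ell (u ** s_ b) = (ell u).+1 by lia.
by rewrite e1 eqxx; split=> //; rewrite -e addSn.
Qed.

(* The height of the first edge of a chain of C0(u, v) is the first i such    *)
(* that the fundamental weight om_i separates u and v.                        *)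
Definition first_sep u v i := wact u (om i) != wact v (om i) /\
  forall j, (j < i)%N -> wact u (om j) = wact v (om j).

Lemma first_sep_exists u v : u \in W -> v \in W -> u != v -> exists i,
  first_sep u v i.
Proof.
move=> uW vW uv.
have : exists i, wact u (om i) != wact v (om i).
  apply/existsP; apply: contraNT uv => /existsPn h;
    apply/eqP/om_separate => // i.
  by apply/eqP; have := h i; rewrite negbK.
case=> i0 hi0; exists [arg min_(i < i0 | wact u (om i) != wact v (om i)) (i :
  nat)]%N.
case: arg_minnP => // i hi hm; split=> // j ji; apply/eqP.
by apply: contraTT ji => /hm; rewrite -leqNgt.
Qed.

Lemma sorted_all b c : sorted leq (heights (b :: c)) -> all (fun d =>
  (h_ b <= h_ d)%N) c.
Proof. by rewrite /= path_sortedE;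
  [rewrite all_map => /andP[] | exact: leq_trans]. Qed.

Lemma asc_sorted_fix u v b c j : u \in W -> asc u v (b :: c) ->
  sorted leq (heights (b :: c)) -> (j < h_ b)%N ->
    wact u (om j) = wact v (om j).
Proof.
move=> uW a s jb; apply: (asc_fix uW a); rewrite /= jb /=.
by apply: sub_all (sorted_all s) => d; apply: leq_trans.
Qed.

(** Suppose the head has height i and the next edge d has height k < i. Then om_k is not moved by
    the head, so it does not separate u s_b from v, which contradicts [asc_head_neq] for the chain
    starting with d. Sortedness of the tail therefore suffices. *)
Lemma asc_cons_sorted u v i b c : u \in W -> first_sep u v i ->
  asc u v (b :: c) ->
  sorted leq (heights (b :: c)) = (h_ b == i) && sorted leq (heights c).
Proof.
move=> uW [ne eqj] a; apply/idP/andP => [s|[/eqP hb s]].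
  split; last by move: s => /= /path_sorted.
  apply/eqP/val_inj/eqP; rewrite eqn_leq; apply/andP; split; rewrite leqNgt.
    by apply/negP => /(asc_sorted_fix uW a s)/eqP; rewrite (negPf ne).
  by apply: contra (asc_head_neq uW a) => /eqj ->.
rewrite /= path_sortedE ?s; last exact: leq_trans.
rewrite andbT all_map; case: c a s => // d c a s.
have dh : (h_ b <= h_ d)%N.
  move: a => /= /and3P[pb pub a]; rewrite leqNgt hb; apply/negP => di.
  have := @asc_head_neq (u ** s_ b) v d c (wmul_weyl uW (srefl_weyl b)) a.
  rewrite -(eqj _ di) wact_up // (_ : pairing _ _ _ = 0) ?scale0r ?subr0 ?eqxx
    //.
  by apply/eqP; rewrite pairing_om_eq0 height_min // hb.
rewrite /= dh /=; apply: sub_all (sorted_all s) => x; exact: leq_trans.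
Qed.

Lemma big_tuple_cons (A : finType) (S : nmodType) m (p : pred (m.+1.-tuple A))
    (f : m.+1.-tuple A -> S) :
  \sum_(c | p c) f c =
  \sum_a \sum_(c : m.-tuple A | p [tuple of a :: c]) f [tuple of a :: c].
Proof.
rewrite pair_big_dep /= (reindex (fun ac : A * m.-tuple A =>
  [tuple of ac.1 :: ac.2])) //=.
exists (fun t : m.+1.-tuple A => (thead t,
  [tuple of behead t])) => [[a t] _|t _] /=.
  by rewrite theadE; congr (_, _); apply/val_inj.
by rewrite -tuple_eta.
Qed.

(** Induction on the number of edges. The Chevalley formula for the first separating weight om_i
    expands f v over the first edge of the chain, and L is the denominator of that edge. *)
Lemma schub_sum m u v f : u \in W -> v \in W -> schub u f ->
  m = (ell v - ell u)%N ->
  (f v)%:F =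
  \sum_(c : m.-tuple T | [&& asc u v c,
    covers u c & sorted leq (heights c)]) E u v c.
Proof.
elim: m u f => [|m IH] u f uW vW hf hm.
  (* The subtraction is truncated, so m = 0 means ell v <= ell u: either v = u and the empty chain
     contributes Lambda_v^-, or both sides are 0. *)
  have e (c : 0.-tuple T) : [&& asc u v c,
    covers u c & sorted leq (heights c)] = (u == v).
    by rewrite (tuple0 c) /= andbT.
  rewrite (eq_bigl _ _ e); have [uv|uv] := eqVneq u v.
    rewrite (big_pred1 [tuple]) => [|c]; last by rewrite (tuple0 c);
      apply/esym/eqP.
    by rewrite E_Eprod /= mulr1 -uv; case: hf => _ _ _ ->.
  rewrite big_pred0_eq (schub_small hf) ?tofrac0 //; last by rewrite eq_sym.
  by rewrite -subn_eq0 -hm.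
have luv : (ell u < ell v)%N by rewrite -subn_gt0 -hm.
have uv : u != v by apply: contraTneq luv => ->; rewrite ltnn.
have [i hi] := first_sep_exists uW vW uv; have [ne eqj] := hi.
have /fin_all_exists [G hG] (b : T) : exists g, schub (u ** s_ b) g.
  by apply: schub_exists; rewrite wmul_weyl.
have := chevalley i uW hf hG vW.
set L := lin _ => hC.
have L0 : L%:F != 0 by rewrite tofrac_eq0 lin_eq0 subr_eq0.
apply: (mulfI L0); rewrite -tofracM hC big_tuple_cons rmorph_sum /= mulr_sumr.
rewrite big_mkcond /=; apply: eq_bigr => b _.
case: (boolP [&& _, _ & _]) => [/and3P[pb pub lb]|nb]; last first.
  rewrite big_pred0 ?mulr0 // => c /=; apply: contraNF nb.
  by case/and3P=> /and3P[-> -> _] /andP[-> _].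
have [hb|hb] := eqVneq (h_ b) i; last first.
  rewrite big_pred0 ?mulr0 => [|t]; last first.
    apply/negP => /and3P[a _ s];
      have := asc_cons_sorted uW hi (a : asc u v (b :: t)).
    by rewrite (negPf hb) (s : sorted leq (heights (b :: t))).
  (* An edge of height above i has coefficient <om_i, b> = 0. For height k < i, u om_k = v om_k, so
     u s_b om_k - v om_k is a negative multiple of u b and the class of u s_b vanishes at v. *)
  apply/eqP; rewrite tofrac_eq0 scaler_eq0 pairing_om_eq0; apply/orP.
  case: (ltngtP i (h_ b)) => [lt|lt|e]; last by case/eqP: hb; apply/val_inj.
    by left; rewrite height_min.
  right; apply/eqP; apply: (@schub_support _ _ _ _ _ (h_ b) v _ (hG b)) => //.
    by rewrite wmul_weyl.
  rewrite wact_up // (eqj _ lt) addrAC subrr add0r nnv_opp_pos //.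
  by rewrite pairing_om_gt0 // height_neq0.
rewrite -mul_mpolyC tofracM (IH (u ** s_ b)) ?wmul_weyl //; last first.
  by rewrite (eqP lb) subnS -hm.
rewrite !mulr_sumr; apply: eq_big => t; last first.
  move=> _; rewrite !E_Eprod -[Eprod u v _]/(_ / _ * Eprod (u ** s_ b) v t) hb
    -/L.
  rewrite mulrCA [RHS]mulrCA; congr (_ * _).
  by rewrite [RHS]mulrA [in RHS]mulrCA divff // mulr1.
apply/and3P/and3P => [[a c s]|[a c s]].
  have a' : asc u v (b :: t) by rewrite /= pb pub.
  split=> //; first by rewrite /= lb.
  suff : sorted leq (heights (b :: t)) by [].
  by rewrite (asc_cons_sorted uW hi a') hb eqxx.
have st : sorted leq (heights t).
  have := asc_cons_sorted uW hi (a : asc u v (b :: t)).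
  by rewrite (s : sorted leq (heights (b :: t))) => /esym/andP[].
rewrite st; by move: a c => /= /and3P[_ _ ->] /andP[_ ->].
Qed.

Lemma schub_of_class u (tau : {perm T} -> {mpoly rat[n]}) : u \in W ->
  schubert_class u tau -> schub u (fun p => ext_scalars R (tau p)).
Proof.
move=> uW [t1 t2 t3 t4]; split=> //.
- move=> p b pW pb; have [q hq] := t1 p b pW pb; exists (ext_scalars R q).
  by rewrite -hq /ext_scalars rmorphB.
- move=> p pW; rewrite /ext_scalars;
    apply: leq_trans (_ : (msize (tau p) <= _)%N).
    rewrite !msizeE; apply/bigmax_leqP_seq => m hm _.
    apply: (leq_bigmax_seq (F := fun m => (mdeg m).+1)) => //.
    by move: hm; rewrite !mcoeff_msupp mcoeff_map_mpoly;
      apply: contraNneq => e; apply/eqP; rewrite e; exact: (rmorph0 (@ratr R)).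
  rewrite msizeE; apply/bigmax_leqP_seq => m hm _.
  by rewrite ltnS (dhomog_mf (t2 p pW) hm).
- move=> p pW lp pu; rewrite t3 ?rmorph0 //;
    first by rewrite /ext_scalars rmorph0.
  apply/negP => /(bruhat_ell uW) [_ [e|]]; last by rewrite ltnNge lp.
  by rewrite e eqxx in pu.
Qed.

Lemma chain_formula u v tau : u \in W -> v \in W -> schubert_class u tau ->
  (ext_scalars R (tau v))%:F = \sum_(c in C0 u v) E u v c.
Proof.
move=> uW vW ht; rewrite (schub_sum uW vW (schub_of_class uW ht) erefl).
by apply: eq_bigl => c; rewrite C0E.
Qed.

End Chains.

(** * Positivity of the contribution of a chain *)

Section Positivity.
Variables (R : realFieldType) (n : nat) (Phi : root_system R n).
Local Notation F := (gram Phi).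
Local Notation T := (rootT Phi).
Local Notation V := 'rV[R]_n.
Local Notation W := (weyl Phi).
Local Notation s_ := (srefl (Phi := Phi)).
Local Notation al := (simple Phi).
Local Notation om := (fund_weight Phi).
Local Notation "p ** q" := (wmul p q) (at level 40, left associativity).
Implicit Types (b : T) (c : seq T) (u v : {perm T}) (p q : {perm T}) (x y : V)
  (i j : 'I_n).
Hint Resolve srefl_weyl one_weyl : core.
Local Notation P := {mpoly R[n]}.
Local Notation h_ := (@height_index R n Phi).
Local Notation heights := (map (fun b => val (h_ b))).

(* The stabilizer of the preceding weights moves om_i by a multiple k of a    *)
(* positive root; Cf restricts k, and then also <om_i, b> for every root b of *)
(* height i. Hence every denominator of E is such a multiple of a root.       *)
Definition small_orbits (Cf : R -> Prop) := forall i p, p \in W ->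
  (forall j : 'I_n, (j < i)%N -> wact p (om j) = om j) ->
    wact p (om i) != om i ->
  exists k b, [/\ Cf k, 0 < k, pos b,
    h_ b = i & om i - wact p (om i) = k *: val b].

(* Both om_i and om_i - k b have the same norm. *)
Lemma orbit_diff_coef i p k b : p \in W -> k != 0 ->
  om i - wact p (om i) = k *: val b ->
  k = pairing F (om i) (val b).
Proof.
move=> pW k0 e; have e' : wact p (om i) = om i - k *: val b by rewrite -e opprB
  addrC subrK.
have := inner_wact (om i) (om i) pW;
  rewrite e' innerBl !innerBr !(innerZl F k) !(innerZr F k).
rewrite (innerC Phi (val b) (om i)) => h; apply: (mulIf (inner_root_neq0 b)).
rewrite pairingE; apply: (mulfI k0); move: h.
set x := inner F (om i) (om i); set y := inner F (om i) (val b).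
set z := inner F (val b) (val b); clearbody x y z => h.
lra.
Qed.

(** The hypothesis is applied to s_b, which fixes the weights before om_i for i = h(b). The root it
    provides is proportional to b, hence equal to b. *)
Lemma small_orbits_pairing Cf b : small_orbits Cf -> pos b ->
  Cf (pairing F (om (h_ b)) (val b)).
Proof.
move=> so pb; set i := h_ b.
have p0 : 0 < pairing F (om i) (val b) by rewrite pairing_om_gt0 // height_neq0.
have e : om i - wact (s_ b) (om i) = pairing F (om i) (val b) *: val b.
  by rewrite wact_srefl /reflect_vec opprB addrC subrK.
have [|||k [d [ck k0 pd hd e']]] := so i (s_ b) => //.
- move=> j ji; rewrite wact_srefl /reflect_vec (_ : pairing _ _ _ = 0) ?scale0r
    ?subr0 //.
  by apply/eqP; rewrite pairing_om_eq0 height_min.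
- rewrite -subr_eq0 -opprB e oppr_eq0 scaler_eq0 gt_eqF //=.
  exact: root_vec_neq0.
suff db : d = b by rewrite -db -(orbit_diff_coef _ (lt0r_neq0 k0) e').
apply: (@pos_prop _ _ _ _ _ (k^-1 * pairing F (om i) (val b))) => //.
by rewrite -scalerA -e e' scalerA mulVf ?gt_eqF // scale1r.
Qed.

Fixpoint denoms u v c : seq V :=
  if c is b :: c' then (wact u (om (h_ b)) - wact v (om (h_ b))) :: denoms (u
    ** s_ b) v c'
  else [::].

(** The form of a denominator: a positive multiple of -v b, which for an inversion b of v is a root
    of Lambda_v^-. *)
Definition scaled_root v b : V := pairing F (om (h_ b)) (val b) *: val (oproot
  (v b)).

Lemma tofrac_constV (k : R) : k != 0 -> ((k%:MP_[n])%:F)^-1 = (k^-1%:MP)%:F.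
Proof.
move=> k0; have k1 : (k%:MP_[n])%:F != 0 :> {fraction P} by rewrite tofrac_eq0
  mpolyC_eq0.
by apply: (mulIf k1); rewrite mulVf // -tofracM -mpolyCM mulVf // tofrac1.
Qed.

(** [K m z] records what is known of the coefficient z after m edges, so that one induction serves
    positivity, powers of 2 and coefficient 1. The root of the first denominator comes from
    [small_orbits] for v^-1 u. The fourth clause keeps the roots distinct: a root of the tail is
    bounded by u s_b om_i - v om_i, which the first edge has pushed below its own denominator. *)
Lemma Eprod_factor Cf (K : nat -> R -> Prop) u v c : small_orbits Cf ->
  K 0%N 1 -> (forall m (z x y : R),
    Cf x -> Cf y -> K m z -> K m.+1 (x / y * z)) ->
  u \in W -> asc u v c -> sorted leq (heights c) ->
  exists ds : seq T, [/\ uniq ds, {subset ds <= invs v},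
    map (scaled_root v) ds = denoms u v c,
    {in ds, forall d, nnv (wact u (om (h_ d)) - wact v (om (h_ d)) -
      scaled_root v d)} &
    exists2 z, K (size c) z & Eprod u v c * (\prod_(d <- ds) lin (val (oproot
      (v d))))%:F =
       (z%:MP)%:F].
Proof.
move=> so K0 KS; elim: c u => [|b c IH] u uW a s.
  exists [::]; split=> //; exists 1 => //.
  by rewrite big_nil mul1r mpolyC1.
have vW := asc_weyl uW a; have a0 := a; move: a0 => /= /and3P[pb pub a'].
have s' : sorted leq (heights c) by move: s => /= /path_sorted.
have u'W : u ** s_ b \in W by rewrite wmul_weyl.
have [ds [uds sds eds nds [z Kz hz]]] := IH _ u'W a' s'.
have vuW : v^-1%g ** u \in W by rewrite wmul_weyl ?inv_weyl.
have wE x : wact (v^-1%g ** u) x = wact v^-1%g (wact u x) by rewrite wactM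
  ?inv_weyl.
set i := h_ b.
have [j ji||k [d [ck k0 pd hd e]]] := so i (v^-1%g ** u) vuW.
- by rewrite wE (asc_sorted_fix uW a s ji) wactK.
- rewrite wE; apply: contra (asc_head_neq uW a) => /eqP e.
  by rewrite -[in X in X == _](wactKV (wact u _) vW) e.
have kE := orbit_diff_coef vuW (lt0r_neq0 k0) e.
have dE : wact u (om i) - wact v (om i) = scaled_root v d.
  rewrite /scaled_root hd -kE val_opp scalerN -wact_root // -wactZ -e wE wactB.
  by rewrite wactKV // opprB.
have nd : neg (v d).
  rewrite negE; apply/negP => pvd; have := asc_nnv i uW a.
  by rewrite dE /scaled_root hd -kE val_opp scalerN nnv_opp_pos.
have pk : 0 < pairing F (om i) (val b) by rewrite pairing_om_gt0 // height_neq0.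
exists (d :: ds); split.
- rewrite /= uds andbT; apply/negP => /nds; rewrite hd wact_up // -dE.
  by rewrite opprB addrA subrK addrAC subrr add0r nnv_opp_pos.
- by move=> x; rewrite inE => /orP[/eqP ->|/sds //]; rewrite inE pd nd.
- by rewrite /= eds dE.
- move=> x; rewrite inE => /orP[/eqP ->|/nds];
    first by rewrite hd dE subrr nnv0.
  rewrite wact_up // => hx.
  set w := wact u _; rewrite -/w in hx.
  have -> : w - wact v (om (h_ x)) - scaled_root v x =
     w - pairing F (om (h_ x)) (val b) *: val (u b) - wact v (om (h_ x)) -
       scaled_root v x
       + pairing F (om (h_ x)) (val b) *: val (u b).
    rewrite -[LHS](subrK (pairing F (om (h_ x)) (val b) *: val (u b))).
    by congr (_ + _); rewrite addrAC (addrAC w).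
  by apply: nnvD hx _; apply: nnvZ; rewrite ?pairing_om_ge0 // nnv_pos.
exists (pairing F (om i) (val b) / k * z).
  exact: KS (small_orbits_pairing so pb) ck Kz.
rewrite /= -/i dE big_cons /scaled_root hd -kE linZ -mul_mpolyC.
set l := lin _; have l0 : l%:F != 0 by rewrite tofrac_eq0 lin_eq0 root_vec_neq0.
rewrite !tofracM invfM tofrac_constV ?gt_eqF //.
set x := (_%:MP)%:F; set y := (_%:MP)%:F.
have -> : x * (y / l%:F) * Eprod (u ** s_ b) v c * (l%:F * (\prod_(j <- ds) lin
  (val (oproot (v j))))%:F)
   = x * y * (Eprod (u ** s_ b) v c * (\prod_(j <- ds) lin (val (oproot (v
     j))))%:F) * (l%:F^-1 * l%:F).
  by set z' := l%:F^-1; ring.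
by rewrite mulVf // mulr1 hz /x /y -!tofracM -!mpolyCM.
Qed.

Lemma E_factor Cf (K : nat -> R ->
  Prop) m u v (c : m.-tuple T) : small_orbits Cf ->
  K 0%N 1 -> (forall m (z x y : R),
    Cf x -> Cf y -> K m z -> K m.+1 (x / y * z)) ->
  u \in W -> asc u v c -> sorted leq (heights c) ->
  exists ds : seq T, [/\ uniq ds, {subset ds <= invs v},
    map (scaled_root v) ds = denoms u v c &
    exists2 z, K m z & E u v c =
       (z *: \prod_(d in invs v | d \notin ds) lin (val (oproot (v d))))%:F].
Proof.
move=> so K0 KS uW a s;
  have [ds [uds sds eds _ [z Kz hz]]] := Eprod_factor so K0 KS uW a s.
exists ds; split=> //; exists z; first by move: Kz; rewrite size_tuple.
rewrite E_Eprod Lambda_invs ?(asc_weyl uW a) //.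
rewrite (bigID (mem ds)) /= tofracM mulrAC (mulrC _ (Eprod _ _ _)).
have -> : \prod_(d in invs v | d \in ds) lin (val (oproot (v d)))
    = \prod_(d <- ds) lin (val (oproot (v d))).
  rewrite [RHS]big_uniq //=; apply: eq_bigl => d.
  by case: (boolP (d \in ds)) => [/sds ->|]; rewrite ?andbF.
by rewrite hz -tofracM mul_mpolyC.
Qed.

Definition nonneg_int (f : P) := exists2 q : {mpoly int[n]}, (forall m,
  0 <= q@_m) & f = map_mpoly intr q.

Lemma nonneg_int_mul f g : nonneg_int f -> nonneg_int g -> nonneg_int (f * g).
Proof.
move=> [p hp ->] [q hq ->]; exists (p * q); last by rewrite rmorphM.
by move=> m; rewrite mcoeffM; apply: sumr_ge0 => i _; rewrite mulr_ge0.
Qed.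

Lemma nonneg_int1 : nonneg_int 1.
Proof.
by exists 1; rewrite ?rmorph1 // => m; rewrite mcoeff1 ler0n.
Qed.

Lemma nonneg_int_lin b : pos b -> nonneg_int (lin (val b)).
Proof.
move=> pb; rewrite /lin; elim/big_ind: _ => [|f g [p hp ->] [q hq ->]|i _].
- by exists 0; rewrite ?rmorph0 // => m; rewrite mcoeff0.
- by exists (p + q); rewrite ?rmorphD // => m; rewrite mcoeffD addr_ge0.
have [k ->] := pos_nat i pb; exists (k%:R *: 'X_i).
  by move=> m; rewrite mcoeffZ mcoeffX mulr_ge0 ?ler0n.
by rewrite map_mpolyZ map_mpolyX /= rmorph_nat.
Qed.

Lemma nonneg_part Cf (D : nat) m u v (c : m.-tuple T) : small_orbits Cf ->
  (forall x y : R, Cf x -> Cf y -> exists t : nat, x / y = t%:R / D%:R) ->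
  u \in W -> asc u v c -> sorted leq (heights c) ->
  nonneg_poly_over (D ^ size c) (E u v c).
Proof.
move=> so hD uW a s.
have [|m' z x y cx cy [t ->]|ds [uds sds eds [_ [t ->] ->]]] :=
  E_factor (K := fun m z => exists t : nat, z = t%:R / D%:R ^+ m) so _ _ uW a s.
- by exists 1%N; rewrite expr0 divr1.
- have [t' ->] := hD _ _ cx cy; exists (t' * t)%N.
  by rewrite exprS natrM invfM; ring.
have [q hq ->] : nonneg_int (\prod_(d in invs v | d \notin ds) lin (val (oproot
  (v d)))).
  elim/big_ind: _ => [|f g|d]; [exact: nonneg_int1 | exact: nonneg_int_mul |].
  by rewrite inE -andbA => /and3P[_ nd _]; apply: nonneg_int_lin;
    rewrite -neg_opp.
exists (t%:R *: q); first by move=> mm; rewrite mcoeffZ mulr_ge0 ?ler0n.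
by rewrite map_mpolyZ /= scalerA size_tuple natrX rmorph_nat mulrC.
Qed.

End Positivity.

(** * Coordinates in types A, B and C *)

Section Types.
Variables (R : realFieldType) (n : nat) (Phi : root_system R n).
Local Notation F := (gram Phi).
Local Notation T := (rootT Phi).
Local Notation V := 'rV[R]_n.
Local Notation W := (weyl Phi).
Local Notation s_ := (srefl (Phi := Phi)).
Local Notation al := (simple Phi).
Local Notation om := (fund_weight Phi).
Local Notation "p ** q" := (wmul p q) (at level 40, left associativity).
Implicit Types (b : T) (c : seq T) (u v : {perm T}) (p q : {perm T}) (x y : V)
  (i j : 'I_n).
Hint Resolve srefl_weyl one_weyl : core.
Local Notation h_ := (@height_index R n Phi).
Local Notation sv := (simple_vec R).

Lemma pairing_suml (I : Type) (r : seq I) (Q : pred I) (f : I -> V) x :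
  pairing F (\sum_(i <- r | Q i) f i) x = \sum_(i <- r | Q i) pairing F (f i) x.
Proof. by rewrite /pairing inner_suml mulr_sumr mulr_suml. Qed.

Lemma pairingZl (k : R) x y : pairing F (k *: x) y = k * pairing F x y.
Proof. by rewrite /pairing innerZl (mulrCA 2%:R) !mulrA. Qed.

Lemma pairingBl x y z : pairing F (x - y) z = pairing F x z - pairing F y z.
Proof. by rewrite /pairing innerBl mulrBr mulrBl. Qed.

Lemma pairing_ext x y : (forall l,
  pairing F x (sv l) = pairing F y (sv l)) -> x = y.
Proof.
move=> h; apply/eqP; rewrite -subr_eq0;
  apply/eqP/(@inner_simple_eq0 _ _ Phi) => l.
have l0 : inner F (sv l) (sv l) != 0 := inner_root_neq0 (al l).
have := h l; move/eqP; rewrite -subr_eq0 -pairingBl /pairing !mulf_eq0 invr_eq0.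
by rewrite (negPf l0) orbF (pnatr_eq0 _ 2) /= => /eqP.
Qed.

Lemma cartan_int i j : exists z : int, pairing F (sv i) (sv j) = z%:~R.
Proof. exact: (roots_integral (valP (al i)) (valP (al j))). Qed.

Lemma cartan_le0 i j : i != j -> pairing F (sv i) (sv j) <= 0.
Proof.
move=> ij; have := coord_pos j (_ : pos (s_ (al j) (al i))).
rewrite srefl_root !mxE !eqxx /= eq_sym (negPf ij) sub0r mulr1 oppr_ge0.
apply; apply: srefl_simple_pos (simple_pos Phi i) _.
apply: contra ij => /eqP /(congr1 val) /= /rowP /(_ i); rewrite !mxE !eqxx /=.
by case: eqP => // _ /eqP; rewrite oner_eq0.
Qed.

Lemma cartan_self i : pairing F (sv i) (sv i) = 2%:R.
Proof. exact: (pairing_root (al i)). Qed.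

Lemma cartan_bond0 i j : bonds Phi i j = 0 -> pairing F (sv i) (sv j) = 0.
Proof.
rewrite /bonds => /eqP; rewrite mulf_eq0 => /orP[/eqP //|].
rewrite /pairing !mulf_eq0 (innerC _ (sv j)) => /orP[/orP[|/eqP ->]|].
- by rewrite (pnatr_eq0 _ 2).
- by rewrite mulr0 mul0r.
by rewrite invr_eq0 => h; have := inner_root_gt0 (al i);
  rewrite /= (eqP h) ltxx.
Qed.

Lemma nonpos_mul_eq1 (a b : int) : a <= 0 -> b <= 0 -> a * b = 1 -> a = -1.
Proof.
move=> ha hb e.
have a1 : a <> 0 by move=> h; move: e; rewrite h mul0r.
have b1 : b <> 0 by move=> h; move: e; rewrite h mulr0.
nia.
Qed.

Lemma nonpos_mul_eq2 (a b : int) : a <= 0 -> b <= 0 -> b <= a -> a * b = 2 ->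
  a = -1 /\ b = -2.
Proof.
move=> ha hb hab e.
have a1 : a <> 0 by move=> h; move: e; rewrite h mul0r.
have b1 : b <> 0 by move=> h; move: e; rewrite h mulr0.
have h1 : a = -1 by nia.
by split=> //; move: e; rewrite h1; lia.
Qed.

Lemma cartan_bond1 i j : i != j -> bonds Phi i j = 1 ->
  pairing F (sv i) (sv j) = -1.
Proof.
move=> ij; have := cartan_le0 ij; have := @cartan_le0 j i;
  rewrite eq_sym => /(_ ij).
rewrite /bonds; have [a ->] := cartan_int i j; have [b ->] := cartan_int j i.
rewrite -intrM -[0]/(0%:~R) !ler_int => hb ha /(intr_inj (R := R) (x2 := 1)) e.
by rewrite (nonpos_mul_eq1 ha hb e).
Qed.

Lemma cartan_bond2 i j : i != j -> bonds Phi i j = 2%:R ->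
  inner F (sv i) (sv i) < inner F (sv j) (sv j) ->
  pairing F (sv i) (sv j) = -1 /\ pairing F (sv j) (sv i) = - 2%:R.
Proof.
move=> ij hb lt; have ha := cartan_le0 ij; have := @cartan_le0 j i.
rewrite eq_sym => /(_ ij) hb'; move: hb; rewrite /bonds.
have lt' : pairing F (sv j) (sv i) <= pairing F (sv i) (sv j).
  move: ha; rewrite /pairing (innerC _ (sv j) (sv i)).
  have i0 := inner_root_gt0 (al i); have j0 := inner_root_gt0 (al j).
  rewrite ler_pdivrMr // mul0r => h;
    rewrite ler_pdivlMr // mulrAC ler_pdivrMr //.
  by rewrite ler_wnM2l // ltW.
move: ha hb' lt'.
have [a ->] := cartan_int i j; have [b ->] := cartan_int j i.
rewrite -intrM -[0]/(0%:~R) !ler_int =>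
  ha hb' hab /(intr_inj (R := R) (x2 := 2)) e.
by have [-> ->] := nonpos_mul_eq2 ha hb' hab e.
Qed.

Lemma weyl_stable (S : V -> Prop) :
  (forall j x, S x -> S (reflect_vec F (sv j) x)) ->
  forall p x, p \in W -> S x -> S (wact p x).
Proof.
move=> h p x /weyl_wordable [I ->]; elim: I x => [|j I IH] x Sx /=.
  by rewrite wact1.
by rewrite wactM // wact_srefl; apply: h; apply: IH.
Qed.

(** * Coordinate vectors eps_k and positive roots of given height *)

Section Eps.
Variable q : R.
Hypothesis q_neq0 : q != 0.

Definition eps_wt j : R := if j.+1 == n then q else 1.

Definition eps_coef (k : nat) j : R := (j == k :> nat)%:R * eps_wt j - (j.+1 ==
  k)%:R.

(* The coordinate vectors of the classical types, counted from 0:            *)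
(* eps_k = eps_wt k om_k - om_(k-1) with om_(-1) = om_n = 0. The parameter q  *)
(* is <eps_(n-1), alpha_(n-1)>, which is 1 in types A and C and 2 in type B.  *)
Definition eps (k : nat) : V := \sum_j eps_coef k j *: om j.

Lemma pairing_eps k l : pairing F (eps k) (sv l) = eps_coef k l.
Proof.
rewrite pairing_suml (bigD1 l) //= pairingZl fund_weightE eqxx mulr1 big1
  ?addr0 //.
by move=> j jl; rewrite pairingZl fund_weightE (negPf jl) mulr0.
Qed.

Lemma reflect_eps k j : reflect_vec F (sv j) (eps k) = eps k - eps_coef k j *:
  sv j.
Proof. by rewrite /reflect_vec pairing_eps. Qed.

Lemma reflectZ j (k : R) x : reflect_vec F (sv j) (k *: x) = k *: reflect_vec F
  (sv j) x.
Proof. by rewrite /reflect_vec pairingZl scalerBr scalerA. Qed.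

Lemma reflectB j x y : reflect_vec F (sv j) (x - y) = reflect_vec F (sv j) x -
  reflect_vec F (sv j) y.
Proof. by rewrite /reflect_vec pairingBl scalerBl !opprD !opprK addrACA. Qed.

Lemma reflectD j x y : reflect_vec F (sv j) (x + y) = reflect_vec F (sv j) x +
  reflect_vec F (sv j) y.
Proof.
have -> : x + y = x - (-1) *: y by rewrite scaleN1r opprK.
by rewrite reflectB reflectZ scaleN1r opprK.
Qed.

Lemma eps_coef_lt k (l : 'I_n) : (k < l)%N -> eps_coef k l = 0.
Proof.
move=> kl; rewrite /eps_coef !gtn_eqF ?mul0r ?subrr //; exact: ltnW.
Qed.

Lemma eps_coef_self (l : 'I_n) : eps_coef l l = eps_wt l.
Proof. by rewrite /eps_coef eqxx mul1r gtn_eqF ?subr0. Qed.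

Lemma eps_wt_neq0 l : eps_wt l != 0.
Proof. by rewrite /eps_wt; case: ifP => _; rewrite ?oner_eq0. Qed.

Lemma wact_eps_fix p i : (forall j : 'I_n, (j < i)%N -> wact p (om j) = om j) ->
  forall k, (k < i)%N -> wact p (eps k) = eps k.
Proof.
move=> h k ki; rewrite /eps wact_sum; apply: eq_bigr => j _; rewrite wactZ.
have [ji|ij] := ltnP j i; first by rewrite h.
by rewrite eps_coef_lt ?scale0r //; apply: leq_trans ij.
Qed.

Lemma wact_eps_om p i : (forall j : 'I_n, (j < i)%N -> wact p (om j) = om j) ->
  eps i - wact p (eps i) = eps_wt i *: (om i - wact p (om i)).
Proof.
move=> h; rewrite /eps wact_sum -sumrB (bigD1 i) //= wactZ -scalerBr
  eps_coef_self.
rewrite big1 ?addr0 // => j ji; rewrite wactZ -scalerBr.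
have [lt|ij] := ltnP j i; first by rewrite h // subrr scaler0.
by rewrite eps_coef_lt ?scale0r // ltn_neqAle eq_sym ij andbT.
Qed.

(** For k < i, p fixes eps_k, so eps_i would be a multiple of eps_k; but eps_k is orthogonal to
    alpha_i and eps_i is not. *)
Lemma wact_eps_ge p i k (e : R) : p \in W ->
  (forall j : 'I_n, (j < i)%N -> wact p (om j) = om j) ->
  wact p (eps i) = e *: eps k -> (i <= k)%N.
Proof.
move=> pW h; rewrite leqNgt => epi; apply/negP => ki; move: epi.
rewrite -(wact_eps_fix h ki) -wactZ => /(wact_inj pW) ei.
have := pairing_eps i i; rewrite ei pairingZl pairing_eps eps_coef_lt // mulr0.
by rewrite eps_coef_self => /esym/eqP; rewrite (negPf (eps_wt_neq0 i)).
Qed.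

(** A positive root of height i, stated by coordinates so that it is visibly preserved by s_j for j
    > i. *)
Definition root_from i x := exists b, [/\ val b = x,
  forall k : 'I_n, (k < i)%N -> val b 0 k = 0 & 0 < val b 0 i].

Lemma root_from_refl i j x : (i < j)%N -> root_from i x ->
  root_from i (reflect_vec F (sv j) x).
Proof.
move=> ij [b [<- b0 bi]]; exists (s_ (al j) b).
have e (k : 'I_n) : (k <= i)%N -> val (s_ (al j) b) 0 k = val b 0 k.
  move=> ki; rewrite srefl_root !mxE eqxx /= (_ : (k == j) = false) ?mulr0
    ?subr0 //.
  by apply: negbTE; rewrite neq_ltn; apply/orP; left; apply: leq_ltn_trans ij.
split; first by rewrite srefl_root.
  by move=> k ki; rewrite e ?b0 // ltnW.
by rewrite e.
Qed.

Lemma root_fromP i x : root_from i x -> exists b, [/\ val b = x,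
  pos b & h_ b = i].
Proof.
move=> [b [e b0 bi]]; exists b; split=> //; first exact: pos_coordP bi.
by apply: height_uniq => //; rewrite gt_eqF.
Qed.

Lemma root_from_simple i : root_from i (sv i).
Proof.
exists (al i); split=> //= [k ki|]; rewrite simple_vecE ?eqxx ?ltr01 //.
by rewrite -(inj_eq val_inj) gtn_eqF.
Qed.

Lemma eps_swap j k : eps_wt j = 1 -> sv j = eps j - eps j.+1 ->
  reflect_vec F (sv j) (eps k) =
   if k == j then eps j.+1 else if k == j.+1 then eps j else eps k.
Proof.
move=> w1 hj; rewrite reflect_eps hj /eps_coef w1 mulr1 ![_ == k]eq_sym.
have [->|kj] := eqVneq k j.
  by rewrite ltn_eqF // subr0 scale1r opprB addrC subrK.
have [->|kj'] := eqVneq k j.+1; last by rewrite subrr scale0r subr0.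
by rewrite sub0r scaleN1r opprK addrC subrK.
Qed.

Lemma root_from_sub i k : (i < k)%N ->
  (forall j : 'I_n, (j < k)%N -> eps_wt j = 1 /\ sv j = eps j - eps j.+1) ->
    (k <= n)%N ->
  root_from i (eps i - eps k).
Proof.
elim: k => // k IH; rewrite ltnS leq_eqVlt => /orP[/eqP e|ik] h kn.
  by rewrite -e; have [_ <-] := h i (eq_leq (congr1 S e));
    exact: root_from_simple.
have {}IH := IH ik (fun j jk => h j (leqW jk)) (ltnW kn).
have [w1 hj] := h (Ordinal kn) (leqnn _).
have := @root_from_refl i (Ordinal kn) _ ik IH; rewrite reflectB !eps_swap //=.
by rewrite eqxx !ltn_eqF // ltnS ltnW.
Qed.

End Eps.

(** * Orbits of the fundamental weights in type A *)

Lemma typeA_cartan : type_A Phi -> forall i j, pairing F (sv i) (sv j) =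
  if i == j then 2%:R else - (adjacent i j)%:R.
Proof.
move=> [_ h] i j; case: eqVneq => [->|ij]; first exact: cartan_self.
have := h _ _ ij; case: adjacent => /= e; first exact: cartan_bond1.
by rewrite oppr0; exact: cartan_bond0.
Qed.

Lemma eps_wt1 j : eps_wt 1 j = 1.
Proof. by rewrite /eps_wt if_same. Qed.

Lemma typeA_simple : type_A Phi -> forall j, sv j = eps 1 j - eps 1 j.+1.
Proof.
move=> hA j; apply: pairing_ext => l;
  rewrite pairingBl !pairing_eps typeA_cartan //.
rewrite /eps_coef eps_wt1 !mulr1 eqSS /adjacent -(inj_eq val_inj) /=.
move: (nat_of_ord j) (nat_of_ord l) => a b.
by repeat (case: eqP => ? /=); first [exfalso; lia | ring].
Qed.

Lemma typeA_wact_eps p k : type_A Phi -> p \in W -> (k <= n)%N ->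
  exists2 l, (l <= n)%N & wact p (eps 1 k) = eps 1 l.
Proof.
move=> hA pW kn; apply: (weyl_stable (S := fun x => exists2 l,
  (l <= n)%N & x = eps 1 l)) => //.
  move=> j x [l ln ->]; rewrite eps_swap ?eps_wt1 //; last exact: typeA_simple.
  case: ifP => _; first by exists j.+1.
  by case: ifP => _; [exists j => //; apply: ltnW | exists l].
by exists k.
Qed.

(** om_i - p om_i = eps_i - p eps_i = eps_i - eps_k with k > i, which is a positive root of height
    i. *)
Lemma small_orbitsA : type_A Phi -> small_orbits Phi (fun k => k = 1).
Proof.
move=> hA i p pW fx ne.
have q0 : 1 != 0 :> R by exact: oner_neq0.
have [k kn ek] := typeA_wact_eps hA pW (ltnW (ltn_ord i)).
have := wact_eps_om 1 fx; rewrite eps_wt1 scale1r ek => eo.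
have ik : (i < k)%N.
  rewrite ltn_neqAle (@wact_eps_ge _ q0 p i k 1) ?scale1r // andbT.
  by apply: contra ne => /eqP ik; move: eo; rewrite -ik subrr => /esym/eqP;
    rewrite subr_eq0 eq_sym.
have [|b [bv pb hb]] := root_fromP (@root_from_sub 1 i k ik _ kn).
  by move=> j _; rewrite eps_wt1; split=> //; exact: typeA_simple.
by exists 1, b; rewrite ltr01 scale1r bv eo.
Qed.

(** The Cartan matrices of type B (q = 2) and type C (q = 1) at once; they differ only in the two
    entries of the double bond. *)
Definition cartan_BC (q : R) := forall i j, pairing F (sv i) (sv j) =
  if i == j then 2%:R else if i.+1 == j then - (if j.+1 == n then q else 1)
  else if j.+1 == i then - (if i.+1 == n then 2%:R / q else 1) else 0.

Lemma cartan_BCP (q : R) : double_bonded_path Phi ->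
  (forall i j : 'I_n, i.+1 = j -> j.+1 = n ->
     pairing F (sv i) (sv j) = - q /\ pairing F (sv j) (sv i) = - (2%:R / q)) ->
  cartan_BC q.
Proof.
move=> [n1 hb] hq i j; case: eqVneq => [->|ij]; first exact: cartan_self.
have := hb _ _ ij; rewrite /adjacent.
have en (k : nat) : (k == n.-1) = (k.+1 == n) by case: n n1 => // m _;
  rewrite eqSS.
case: (i.+1 =P j) => [eij|nij] /=.
  rewrite (maxn_idPr _) -?eij // en eij.
  case: (j.+1 =P n) => [jn _|_]; first by have [] := hq i j eij jn.
  exact: cartan_bond1.
case: (j.+1 =P i) => [eji|nji] /=; last exact: cartan_bond0.
rewrite (maxn_idPl _) -?eji // en eji.
case: (i.+1 =P n) => [jn _|_]; first by have [] := hq j i eji jn.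
exact: cartan_bond1.
Qed.

Lemma cartanC : type_C Phi -> cartan_BC 1.
Proof.
move=> [hd hc]; apply: cartan_BCP => // i j ij jn; rewrite divr1.
have ne : i != j by rewrite -(inj_eq val_inj) /= -ij ltn_eqF.
have := hd.2 _ _ ne; rewrite /adjacent ij eqxx /= (maxn_idPr _) -?ij // ij.
rewrite (_ : ((j : nat) == n.-1) = true); last by apply/eqP; lia.
move=> e; exact: cartan_bond2 (hc _ _ ij jn).
Qed.

Lemma cartanB : type_B Phi -> cartan_BC 2%:R.
Proof.
move=> [hd hc]; apply: cartan_BCP => // i j ij jn;
  rewrite divff ?(pnatr_eq0 _ 2) //.
have ne : j != i by rewrite -(inj_eq val_inj) /= -ij gtn_eqF.
have := hd.2 _ _ ne; rewrite /adjacent ij eqxx orbT /= (maxn_idPl _) -?ij // ij.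
rewrite (_ : ((j : nat) == n.-1) = true); last by apply/eqP; lia.
move=> e; have [-> ->] := cartan_bond2 ne e (hc _ _ ij jn).
by [].
Qed.

(** * Orbits of the fundamental weights in types B and C *)

Section BC.
Variable q : R.
Hypotheses (q_gt0 : 0 < q) (hq : cartan_BC q).

Let q_neq0 : q != 0. Proof. by rewrite gt_eqF. Qed.

Lemma cartan_BC_simple j : (j.+1 < n)%N -> sv j = eps q j - eps q j.+1.
Proof.
move=> jn; apply: pairing_ext => l; rewrite pairingBl !pairing_eps hq /eps_coef.
rewrite /eps_wt eqSS -!(inj_eq val_inj) /= (ltn_eqF jn).
have := ltn_ord l; move: (nat_of_ord j) (nat_of_ord l) jn => a b jn bn.
by repeat (case: eqP => ? /=); first [exfalso; lia | ring].
Qed.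

Lemma cartan_BC_last j : j.+1 = n -> sv j = (2%:R / q) *: eps q j.
Proof.
move=> jn; apply: pairing_ext => l; rewrite pairingZl pairing_eps hq /eps_coef.
rewrite /eps_wt -!(inj_eq val_inj) /=.
have := ltn_ord l; move: (nat_of_ord j) (nat_of_ord l) jn => a b jn bn.
by repeat (case: eqP => ? /=); first [exfalso; lia | field | ring].
Qed.

Lemma eps_wt_BC j : (j.+1 < n)%N -> eps_wt q j = 1.
Proof. by move=> jn; rewrite /eps_wt ltn_eqF. Qed.

Lemma reflect_last j k : j.+1 = n -> (k < n)%N ->
  reflect_vec F (sv j) (eps q k) = if k == j then - eps q j else eps q k.
Proof.
move=> jn kn; rewrite reflect_eps cartan_BC_last // /eps_coef jn (gtn_eqF kn)
  subr0.
rewrite (eq_sym k); case: eqP => [->|_]; last by rewrite mul0r scale0r subr0.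
rewrite /eps_wt jn eqxx mul1r scalerA mulrCA divff // mulr1 scaler_nat mulr2n
  opprD addrA.
by rewrite subrr sub0r.
Qed.

Lemma BC_wact_eps p k : p \in W -> (k < n)%N ->
  exists l e, [/\ (l < n)%N, e = 1 \/ e = -1 & wact p (eps q k) = e *: eps q l].
Proof.
move=> pW kn; pose S x := exists l (e : R), [/\ (l < n)%N,
  e = 1 \/ e = -1 & x = e *: eps q l].
apply: (weyl_stable (S := S)) => //; last by exists k, 1; rewrite scale1r;
  split=> //; left.
move=> j x [l [e [ln he ->]]]; rewrite reflectZ.
have := ltn_ord j; rewrite leq_eqVlt => /orP[/eqP jn|jn].
  rewrite reflect_last //; case: eqP => [elj|_]; last by exists l, e.
  exists j, (- e); rewrite scalerN scaleNr; split=> //.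
  by case: he => ->; [right|left]; rewrite ?opprK.
rewrite eps_swap ?eps_wt_BC //; last exact: cartan_BC_simple.
case: ifP => _; first by exists j.+1, e.
by case: ifP => _; [exists j, e | exists l, e].
Qed.

Lemma root_from_eps i : root_from i ((2%:R / q) *: eps q i).
Proof.
have [m] := ubnP (n - i); elim: m i => // m IH i; rewrite ltnS => im.
have := ltn_ord i; rewrite leq_eqVlt => /orP[/eqP jn|jn].
  by rewrite -cartan_BC_last //; exact: root_from_simple.
have [b [bv b0 bi]] : root_from (Ordinal jn) ((2%:R / q) *: eps q i.+1).
  by apply: IH; rewrite /=; lia.
exists (s_ (al i) b).
have e : val (s_ (al i) b) = (2%:R / q) *: eps q i.
  by rewrite srefl_root bv reflectZ eps_swap ?eps_wt_BC ?cartan_BC_simple //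
    gtn_eqF // eqxx.
have e' : (2%:R / q) *: eps q i = (2%:R / q) *: sv i + val b.
  by rewrite bv cartan_BC_simple // scalerBr subrK.
have zb (k : 'I_n) : (k <= i)%N -> val b 0 k = 0 by move=> ki; apply: b0;
  rewrite /= ltnS.
split=> // [k ki|]; rewrite e e' 2!mxE simple_vecE zb ?addr0 ?(ltnW ki) //.
  by rewrite -(inj_eq val_inj) gtn_eqF // mulr0.
by rewrite eqxx mulr1 divr_gt0 // ltr0n.
Qed.

Lemma root_from_add i j : (i < j)%N -> root_from i (eps q i + eps q j).
Proof.
have [m] := ubnP (n - j); elim: m j => // m IH j; rewrite ltnS => jm ij.
have := ltn_ord j; rewrite leq_eqVlt => /orP[/eqP jn|jn].
  have := root_from_refl ij (@root_from_sub q i j ij _ (ltnW (ltn_ord j))).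
  rewrite reflectB !reflect_last // ?eqxx ?(ltn_eqF ij) ?opprK //; apply.
  move=> l lj; have ln : (l.+1 < n)%N by apply: leq_trans (ltn_ord j).
  by rewrite eps_wt_BC //; split=> //; exact: cartan_BC_simple.
have := root_from_refl ij (IH (Ordinal jn) _ _); rewrite /= reflectD.
rewrite !eps_swap ?eps_wt_BC ?cartan_BC_simple //.
rewrite (ltn_eqF ij) (ltn_eqF (ltnW _)) ?ltnS // (gtn_eqF (ltnSn _)) eqxx.
by apply; [lia | rewrite /= ltnW].
Qed.

(** p eps_i is eps_k or -eps_k with k >= i. If k > i, the difference is the root eps_i - eps_k or
    eps_i + eps_k. If k = i, the sign is negative and om_i moves by a multiple of the root (2 / q)
    eps_i: the factor is 1 for the last index and q for the others. *)
Lemma small_orbitsBC : small_orbits Phi (fun k => k = 1 \/ k = q).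
Proof.
move=> i p pW fx ne.
have [k [e [kn he ek]]] := BC_wact_eps pW (ltn_ord i).
have := wact_eps_om q fx; rewrite ek => eo.
have ik : (i <= k)%N by exact: wact_eps_ge q_neq0 _ _ _ _ pW fx ek.
have om0 : om i - wact p (om i) != 0 by rewrite subr_eq0 eq_sym.
have simpl (l : 'I_n) : (l < k)%N ->
  eps_wt q l = 1 /\ sv l = eps q l - eps q l.+1.
  move=> lk; have ln : (l.+1 < n)%N by apply: leq_trans kn.
  by rewrite eps_wt_BC //; split=> //; exact: cartan_BC_simple.
have fin x (c : R) : root_from i x -> c = 1 \/ c = q ->
  om i - wact p (om i) = c *: x ->
    exists (c' : R) b, [/\ c' = 1 \/ c' = q, 0 < c', pos b,
      h_ b = i & om i - wact p (om i) = c' *: val b].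
  move=> /root_fromP [b [bv pb hb]] hc ex; exists c, b; rewrite bv; split=> //.
  by case: hc => ->.
case: (ltngtP i k) ik => // [ik|eik] _.
  have ieq1 : eps_wt q i = 1 by case: (simpl i ik).
  rewrite ieq1 scale1r in eo.
  case: he => he; rewrite he ?scale1r ?scaleN1r ?opprK in eo.
    apply: (fin (eps q i - eps q k) 1); last by rewrite scale1r eo.
      exact: root_from_sub simpl (ltnW kn).
    by left.
  apply: (fin (eps q i + eps q k) 1); last by rewrite scale1r eo.
    exact: (@root_from_add i (Ordinal kn)).
  by left.
rewrite -eik in eo; case: he => he; rewrite he ?scale1r ?scaleN1r ?opprK in eo.
  move: eo; rewrite subrr => /esym/eqP;
    rewrite scaler_eq0 (negPf (eps_wt_neq0 q_neq0 i)).
  by rewrite (negPf om0).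
have eq2 : om i - wact p (om i) = (q / eps_wt q i) *: ((2%:R / q) *: eps q i).
  apply: (scalerI (eps_wt_neq0 q_neq0 i));
    rewrite -eo !scalerA -mulr2n -scaler_nat.
  by congr (_ *: _); field; rewrite q_neq0 eps_wt_neq0.
apply: fin (root_from_eps i) _ eq2.
by rewrite /eps_wt; case: ifP => _; [left; rewrite divff | right;
  rewrite divr1].
Qed.

End BC.

Lemma small_orbitsC : type_C Phi -> small_orbits Phi (fun k => k = 1).
Proof.
move=> /cartanC /(small_orbitsBC ltr01) h i p pW fx ne.
by have [k [b [hk k0 pb hb e]]] := h i p pW fx ne; exists k, b; split=> //;
  case: hk.
Qed.

Lemma small_orbitsB : type_B Phi -> small_orbits Phi (fun k =>
  k = 1 \/ k = 2%:R).
Proof. by move=> /cartanB /small_orbitsBC; apply; rewrite ltr0n. Qed.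

Lemma E_nonneg_AC : type_A Phi \/ type_C Phi -> forall u v,
  u \in W -> v \in W ->
  forall c : (ell v - ell u).-tuple T,
    c \in C0 u v -> nonneg_poly_over 1 (E u v c).
Proof.
move=> hAC u v uW vW c; rewrite C0E => /and3P[a _ s].
have so : small_orbits Phi (fun k => k = 1) by case: hAC =>
  [/small_orbitsA|/small_orbitsC].
have := @nonneg_part _ _ _ _ 1 _ _ _ c so _ uW a s; rewrite exp1n; apply.
by move=> x y -> ->; exists 1%N.
Qed.

Lemma E_nonneg_B : type_B Phi -> forall u v, u \in W -> v \in W ->
  forall c : (ell v - ell u).-tuple T,
    c \in C0 u v -> nonneg_poly_over (2 ^ size c) (E u v c).
Proof.
move=> hB u v uW vW c; rewrite C0E => /and3P[a _ s].
apply: (nonneg_part (small_orbitsB hB)) => // x y [->|->] [->|->].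
- by exists 2%N; rewrite divr1 divff ?(pnatr_eq0 _ 2).
- by exists 1%N.
- by exists 4%N; field.
- by exists 2%N.
Qed.

End Types.

(** * Chains and subwords in type A *)

Section PartThree.
Variables (R : realFieldType) (n : nat) (Phi : root_system R n).
Local Notation F := (gram Phi).
Local Notation T := (rootT Phi).
Local Notation V := 'rV[R]_n.
Local Notation W := (weyl Phi).
Local Notation s_ := (srefl (Phi := Phi)).
Local Notation al := (simple Phi).
Local Notation om := (fund_weight Phi).
Local Notation "p ** q" := (wmul p q) (at level 40, left associativity).
Implicit Types (b : T) (c : seq T) (u v : {perm T}) (p q : {perm T}) (x y : V)
  (i j : 'I_n).
Hint Resolve srefl_weyl one_weyl word_prod_weyl : core.
Local Notation h_ := (@height_index R n Phi).
Local Notation heights := (map (fun b => val (h_ b))).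
Local Notation sv := (simple_vec R).
Local Notation wp := (word_prod Phi).

Lemma size_denoms u v c : size (denoms u v c) = size c.
Proof. by elim: c u => //= b c IH u; rewrite IH. Qed.

Lemma asc_start u u' v c : asc u v c -> asc u' v c -> u = u'.
Proof.
elim: c u u' => [|b c IH] u u' /=; first by move=> /eqP -> /eqP ->.
move=> /and3P[_ _ a] /and3P[_ _ a']; have e := IH _ _ a a'.
by rewrite -(sreflK u b) e sreflK.
Qed.

(* The height i of the edge with denominator x can be read off x. *)
Definition in_block v x i := (forall j,
  (j < i)%N -> inner F (wact v (om j)) x = 0) /\
  inner F (wact v (om i)) x != 0.

Lemma in_block_uniq v x i j : in_block v x i -> in_block v x j -> i = j.
Proof.
move=> [h1 h2] [h3 h4]; apply/val_inj/eqP; rewrite /= eqn_leq; apply/andP;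
  split.
  by rewrite leqNgt; apply: contra h4 => /h1 ->.
by rewrite leqNgt; apply: contra h2 => /h3 ->.
Qed.

Lemma in_block_head u v b c : u \in W -> asc u v (b :: c) ->
  sorted leq (heights (b :: c)) ->
  in_block v (wact u (om (h_ b)) - wact v (om (h_ b))) (h_ b).
Proof.
move=> uW a s; have vW := asc_weyl uW a; split=> [j ji|].
  by rewrite innerBr -{1}(asc_sorted_fix uW a s ji) !inner_wact // subrr.
set x := wact u _; set y := wact v _.
have xy : x != y by exact: asc_head_neq uW a.
(* x and y have equal norms, so (y, x - y) = 0 would give |x - y|^2 = |x|^2 - |y|^2 = 0. *)
apply: contra xy => /eqP; rewrite innerBr => h.
have hx : inner F x x = inner F y y by rewrite !inner_wact.
rewrite -subr_eq0; apply/eqP/(inner_eq0 (Phi := Phi)).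
rewrite innerBr !innerBl (innerC _ x y).
by move: h hx; set p1 := inner F x x; set p2 := inner F y x;
  set p3 := inner F y y; lra.
Qed.

Lemma denoms_mem u v c x : u \in W -> asc u v c -> sorted leq (heights c) ->
  x \in denoms u v c -> exists i, [/\ val i \in heights c, in_block v x i &
    nnv (wact u (om i) - wact v (om i) - x)].
Proof.
elim: c u => // b c IH u uW a s; rewrite [denoms _ _ _]/= inE => /orP[/eqP ->|].
  exists (h_ b); split; first by rewrite mem_head.
    exact: in_block_head uW a s.
  by rewrite subrr nnv0.
move: (a) => /= /and3P[pb pub a'].
have s' : sorted leq (heights c) by move: s => /= /path_sorted.
case/(IH _ (wmul_weyl uW (srefl_weyl b)) a' s') => i [hi bi ni]; exists i;
  split=> //.
  by rewrite inE hi orbT.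
rewrite wact_up // in ni.
have -> : wact u (om i) - wact v (om i) - x =
   wact u (om i) - pairing F (om i) (val b) *: val (u b) - wact v (om i) - x
     + pairing F (om i) (val b) *: val (u b).
  rewrite -[LHS](subrK (pairing F (om i) (val b) *: val (u b))).
  by congr (_ + _); rewrite addrAC (addrAC (wact u _)).
by apply: nnvD ni _; apply: nnvZ; rewrite ?pairing_om_ge0 // nnv_pos.
Qed.

Lemma denoms_head_notin u v b c : u \in W -> asc u v (b :: c) ->
  sorted leq (heights (b :: c)) ->
  wact u (om (h_ b)) - wact v (om (h_ b)) \notin denoms (u ** s_ b) v c.
Proof.
move=> uW a s; apply/negP; move: (a) => /= /and3P[pb pub a'].
have s' : sorted leq (heights c) by move: s => /= /path_sorted.
case/(denoms_mem (wmul_weyl uW (srefl_weyl b)) a' s') => i [_ bi].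
rewrite -(in_block_uniq (in_block_head uW a s) bi) wact_up //.
rewrite opprB addrA subrK addrAC subrr add0r nnv_opp_pos //.
by rewrite pairing_om_gt0 // height_neq0.
Qed.

Lemma denoms_uniq u v c : u \in W -> asc u v c -> sorted leq (heights c) ->
  uniq (denoms u v c).
Proof.
elim: c u => // b c IH u uW a s;
  rewrite [denoms _ _ _]/= cons_uniq denoms_head_notin //=.
move: a s => /= /and3P[_ _ a] /path_sorted s;
  exact: IH (wmul_weyl uW (srefl_weyl b)) a s.
Qed.

(** The lowest height among the denominators is that of the first edge, and the first denominator
    exceeds all others of its height by a sum of positive roots. So the two heads have the same
    denominator d. Removing it, induction gives equal tails, hence u s_b = u' s_b', and then d
    determines b. *)
Lemma denoms_inj u u' v c c' : u \in W -> u' \in W -> asc u v c ->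
  asc u' v c' ->
  sorted leq (heights c) -> sorted leq (heights c') ->
  denoms u v c =i denoms u' v c' -> c = c'.
Proof.
elim: c c' u u' => [|b c IH] [|b' c'] u u' uW u'W a a' s s' e //.
- by have := e (wact u' (om (h_ b')) - wact v (om (h_ b')));
    rewrite /= mem_head.
- by have := e (wact u (om (h_ b)) - wact v (om (h_ b))); rewrite /= mem_head.
set d := wact u (om (h_ b)) - wact v (om (h_ b)).
set d' := wact u' (om (h_ b')) - wact v (om (h_ b')).
have bd : in_block v d (h_ b) := in_block_head uW a s.
have bd' : in_block v d' (h_ b') := in_block_head u'W a' s'.
have : d \in denoms u' v (b' :: c') by rewrite -e mem_head.
case/(denoms_mem u'W a' s') => i [hi /(in_block_uniq bd) ei ni];
  rewrite -{i}ei in hi ni.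
have : d' \in denoms u v (b :: c) by rewrite e mem_head.
case/(denoms_mem uW a s) => i [hi' /(in_block_uniq bd') ei ni'];
  rewrite -{i}ei in hi' ni'.
have le1 : (h_ b' <= h_ b)%N.
  move: hi; rewrite inE => /orP[/eqP -> //|].
  by move/mapP => [x xc ->]; exact: (allP (sorted_all s')).
have le2 : (h_ b <= h_ b')%N.
  move: hi'; rewrite inE => /orP[/eqP -> //|].
  by move/mapP => [x xc ->]; exact: (allP (sorted_all s)).
have hbb : h_ b = h_ b' by apply/val_inj/eqP; rewrite /= eqn_leq le1 le2.
rewrite hbb -/d' in ni; rewrite -hbb -/d in ni'.
have dd : d = d' := nnv_antisymB ni' ni.
have n1 := denoms_head_notin uW a s; have n2 := denoms_head_notin u'W a' s'.
move: (a) (a') => /= /and3P[pb pub a1] /and3P[pb' pub' a1'].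
have cc : c = c'.
  have s1 : sorted leq (heights c) by move: s => /= /path_sorted.
  have s1' : sorted leq (heights c') by move: s' => /= /path_sorted.
  apply: (IH c' (u ** s_ b) (u' ** s_ b')); rewrite ?wmul_weyl // => x.
  have := e x; rewrite /= !inE -/d -/d' -dd.
  by case: eqP => // -> _; rewrite (negPf n1) dd (negPf n2).
rewrite -cc in a1' *; congr (_ :: _).
have e1 := asc_start a1 a1'.
have euu : wact u (om (h_ b)) = wact u' (om (h_ b)).
  by apply: (addIr (- wact v (om (h_ b)))); rewrite -/d dd /d' hbb.
move: euu; rewrite -[in X in X = _](sreflK u b) -[in X in _ = X](sreflK u' b')
  -e1.
have w1W : u ** s_ b \in W by rewrite wmul_weyl.
rewrite !(wactM _ _ w1W); move/(wact_inj w1W);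
  rewrite !wact_srefl /reflect_vec => /addrI/oppr_inj.
set k := pairing F _ _; set k' := pairing F _ _ => ek.
apply: (@pos_prop _ _ _ _ _ (k^-1 * k')) => //.
have k0 : k != 0 by rewrite gt_eqF // pairing_om_gt0 // height_neq0.
by rewrite -scalerA -ek scalerA mulVf // scale1r.
Qed.

Lemma inner_om_simple_neq i j : i != j -> inner F (om i) (sv j) = 0.
Proof. by move=> ij; rewrite inner_om simple_vecE eq_sym (negPf ij) mulr0. Qed.

Lemma pairing_eq0 x b : inner F x (val b) = 0 -> pairing F x (val b) = 0.
Proof. by rewrite /pairing => ->; rewrite mulr0 mul0r. Qed.

Lemma word_fix (I : seq 'I_n) x : (forall j,
  j \in I -> inner F x (sv j) = 0) -> wact (wp I) x = x.
Proof.
elim: I => [|j I IH] h /=; first by rewrite wact1.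
rewrite wactM // IH => [|k kI]; last by apply: h; rewrite inE kI orbT.
by rewrite wact_srefl /reflect_vec (pairing_eq0 (b := al j)) ?scale0r ?subr0 //
  h ?mem_head.
Qed.

Lemma word_fix_om (I : seq 'I_n) (i : nat) j : (forall k,
  k \in I -> (i <= k)%N) -> (j < i)%N ->
  wact (wp I) (om j) = om j.
Proof.
move=> h ji; apply: word_fix => k /h ik; apply: inner_om_simple_neq.
by rewrite -(inj_eq val_inj) /= ltn_eqF //; apply: leq_trans ik.
Qed.

Lemma coord_wact p i b : p \in W -> wact p (om i) = om i ->
  val (p b) 0 i = val b 0 i.
Proof.
move=> pW fx; have : inner F (om i) (val (p b)) = inner F (om i) (val b).
  by rewrite -{1}fx -wact_root // inner_wact.
rewrite !inner_om => /mulfI; apply; rewrite gt_eqF //.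
by rewrite divr_gt0 ?gram_diag_gt0 ?ltr0n.
Qed.

(* The descending word b-1, ..., i. *)
Definition blk (i b : nat) : seq 'I_n := pmap insub (rev (iota i (b - i))).

Lemma mem_blk (i b : nat) (j : 'I_n) : j \in blk i b = (i <= j < b)%N.
Proof.
rewrite mem_pmap_sub mem_rev mem_iota.
by case: (leqP i j) => //= ij; lia.
Qed.

Lemma blk_nil (i : nat) : blk i i = [::].
Proof. by rewrite /blk subnn. Qed.

Lemma blk_cat (i l b : nat) : (i <= l <= b)%N -> blk i b = blk l b ++ blk i l.
Proof.
move=> /andP[il lb]; rewrite /blk -pmap_cat -rev_cat; congr (pmap _ (rev _)).
have -> : (b - i = (l - i) + (b - l))%N by lia.
by rewrite iotaD subnKC.
Qed.

Lemma blk1 (l : 'I_n) : blk l l.+1 = [:: l].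
Proof.
rewrite /blk subSnn /= /oapp; case: insubP => [u _ e|]; last by rewrite ltn_ord.
by congr (_ :: _); apply/val_inj.
Qed.

Lemma blk_rcons (l : 'I_n) (b : nat) : (l < b)%N ->
  blk l b = rcons (blk l.+1 b) l.
Proof. by move=> lb; rewrite (@blk_cat l l.+1 b) ?leqnSn // blk1 cats1. Qed.

Lemma blk_cons (i : nat) (b : 'I_n) : (i <= b)%N -> blk i b.+1 = b :: blk i b.
Proof. by move=> ib; rewrite (@blk_cat i b b.+1) ?ib ?leqnSn // blk1. Qed.

Hypothesis hA : type_A Phi.
Local Notation ep := (eps Phi 1).

Lemma blk_eps (i b : nat) : (i <= b <= n)%N ->
  wact (wp (blk i b)) (ep i) = ep b.
Proof.
elim: b => [|b IH]; first by rewrite leqn0 => /andP[/eqP -> _];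
  rewrite blk_nil wact1.
rewrite leq_eqVlt => /andP[/orP[/eqP ->|ib bn]]; first by rewrite blk_nil wact1.
have e := blk_cons (b := Ordinal bn) ib; rewrite /= in e;
  rewrite e /= wactM // wact_srefl.
rewrite IH ?(ltnW bn) ?andbT // (eps_swap b (eps_wt1 R (Ordinal bn))
  (typeA_simple hA _)) /=.
by rewrite eqxx.
Qed.

Lemma wact_om_eps p i (k : nat) : (forall j : 'I_n,
  (j < i)%N -> wact p (om j) = om j) ->
  wact p (ep i) = ep k -> wact p (om i) = om i - ep i + ep k.
Proof.
move=> h e; have := wact_eps_om 1 h; rewrite eps_wt1 scale1r e => e'.
have -> : om i - ep i + ep k = om i - (ep i - ep k) by rewrite opprB addrA
  addrAC.
by rewrite e' opprB addrC subrK.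
Qed.

Lemma blk_om i (b : nat) : (i <= b <= n)%N ->
  wact (wp (blk i b)) (om i) = om i - ep i + ep b.
Proof.
move=> h; apply: wact_om_eps; last exact: blk_eps.
by move=> j; apply: word_fix_om => k; rewrite mem_blk => /andP[].
Qed.

Lemma pairing_blk_om i (b : nat) (l : 'I_n) : (i <= b <= n)%N -> (b <= l)%N ->
  pairing F (wact (wp (blk i b)) (om i)) (sv l) = (b == l :> nat)%:R.
Proof.
move=> h bl; rewrite blk_om // -[X in pairing _ X _]opprK opprD.
have -> : - (- (om i - ep i) - ep b) = om i - (ep i - ep b).
  by rewrite !opprD !opprK addrA.
rewrite !pairingBl !pairing_eps fund_weightE /eps_coef eps_wt1 !mulr1.
rewrite -(inj_eq val_inj) /= (eq_sym (l : nat)).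
rewrite (gtn_eqF (_ : i < l.+1)%N) ?(gtn_eqF (_ : b < l.+1)%N) ?ltnS //.
  by rewrite (eq_sym (l : nat)); ring.
by apply: leq_trans bl; case/andP: h.
Qed.

(** A letter b of the block acts on a positive root B r, where B is the part to its right. That root
    is not alpha_b, since <B om_i, alpha_b> = 1 while <B om_i, B r> = <om_i, r> = 0. *)
Lemma blk_pos i (b : nat) r : (i <= b <= n)%N -> pos r -> val r 0 i = 0 ->
  pos (wp (blk i b) r).
Proof.
elim: b => [|b IH] h pr r0; first by rewrite /blk sub0n /= perm1.
move: h; rewrite leq_eqVlt => /andP[/orP[/eqP eb|ib bn]];
  first by rewrite -eb blk_nil perm1.
have hb : (i <= b <= n)%N by rewrite ltnS in ib; rewrite ib ltnW.
rewrite (blk_cons (b := Ordinal bn) ib) /= wmulE.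
apply: srefl_simple_pos; first exact: IH.
apply/eqP => e; have := @pairing_blk_om i b (Ordinal bn) hb (leqnn _).
rewrite eqxx -[sv _]/(val (al (Ordinal bn))) -e pairing_wact // => h.
by have := pairing_om_eq0 i r; rewrite h r0 eqxx oner_eq0.
Qed.

Lemma word_roots_coord (I : seq 'I_n) i r : (forall k,
  k \in I -> (i < k)%N) -> r \in word_roots Phi I ->
  val r 0 i = 0.
Proof.
elim: I r => // l I IH r h; rewrite inE => /orP[/eqP ->|/mapP [r' r'I ->]].
  by rewrite simple_vecE -(inj_eq val_inj) gtn_eqF // h // mem_head.
have il : (i < l)%N by rewrite h // mem_head.
rewrite coord_wact ?IH // => [k kI|]; first by apply: h; rewrite inE kI orbT.
rewrite wact_srefl /reflect_vec (pairing_eq0 (b := al l)) ?scale0r ?subr0 //.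
by apply: inner_om_simple_neq; rewrite -(inj_eq val_inj) ltn_eqF.
Qed.

(** Letters above l do not change the l-th coordinate, which stays 1. *)
Lemma blk_prefix_pos (l : 'I_n) (I : seq 'I_n) : (forall k,
  k \in I -> (l < k)%N) ->
  pos (wp I (al l)).
Proof.
move=> h; apply: (@pos_coordP _ _ _ _ l); rewrite coord_wact //.
  by rewrite simple_vecE eqxx ltr01.
exact: (word_fix_om h).
Qed.

Lemma word_roots_blk_pos (i b : nat) : (b <= n)%N ->
  all (@pos R n Phi) (word_roots Phi (blk i b)).
Proof.
move=> bn; move: {2}(b - i)%N (leqnn (b - i)) => d; elim: d i => [|d IH] i hd.
  by rewrite /blk (_ : (b - i = 0)%N) //; lia.
have [ib|bi] := ltnP i b; last by rewrite /blk (_ : (b - i = 0)%N) //; lia.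
have i_n : (i < n)%N by apply: leq_trans bn.
rewrite (blk_rcons (l := Ordinal i_n) ib) -cats1 word_roots_cat all_cat IH /=;
  last by lia.
by rewrite blk_prefix_pos // => k; rewrite mem_blk => /andP[].
Qed.

(** All vertices of the chain fix om_i, as v does and the edges have height above i. Hence the roots
    u_(k-1) beta_k have i-th coordinate 0, and w keeps them positive. *)
Lemma asc_left w u v c i : w \in W -> u \in W -> asc u v c ->
  (forall j : 'I_n, (j <= i)%N -> wact v (om j) = om j) ->
  all (fun b => (i < h_ b)%N) c ->
  (forall r, pos r -> val r 0 i = 0 -> pos (w r)) ->
  asc (w ** u) (w ** v) c.
Proof.
move=> wW uW a hv hc hw; elim: c u uW a hc => [|b c IH] u uW /=;
  first by move=> /eqP ->.
move=> /and3P[pb pub a] /andP[ib hc];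
  rewrite pb -wmulA IH ?wmul_weyl // andbT wmulE.
apply: hw => //; rewrite coord_wact // ?height_min //.
have asb : asc u v (b :: c) by rewrite /= pb pub.
rewrite (asc_fix uW asb) ?hv //= ib.
by [].
Qed.

Lemma denoms_left w u v c : w \in W -> u \in W -> v \in W ->
  denoms (w ** u) (w ** v) c = map (wact w) (denoms u v c).
Proof.
move=> wW uW vW; elim: c u uW => //= b c IH u uW.
by rewrite -wmulA IH ?wmul_weyl // wactB !wactM.
Qed.

(* The roots of the factors that SC omits for the subword m. *)
Definition deleted (m : bitseq) (I : seq 'I_n) : seq V :=
  mask (map negb m) (map val (word_roots Phi I)).

(* Deleting the letter l of the block i prepends to the chain the edge with   *)
(* label (B u)^-1 alpha_l, where B is the part of the block after l; the      *)
(* denominator of this edge is the root of SC attached to l.                  *)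
Lemma block_chains i (b : nat) u v c (l : nat) m : (i <= b <= n)%N ->
  (i <= l <= b)%N ->
  u \in W -> v \in W -> (forall j : 'I_n, (j <= i)%N -> wact u (om j) = om j) ->
  (forall j : 'I_n, (j <= i)%N -> wact v (om j) = om j) ->
  asc u v c -> all (fun b => (i < h_ b)%N) c -> sorted leq (heights c) ->
  size m = size (blk l b) ->
  let w := wp (blk i b) in
  let u' := wp (mask m (blk l b)) ** (wp (blk i l) ** u) in
  exists c', [/\ asc u' (w ** v) c', sorted leq (heights c'),
     all (fun b => (i <= h_ b)%N) c' &
     denoms u' (w ** v) c' =i deleted m (blk l b) ++ map (wact w) (denoms u v
       c)].
Proof.
move=> hb hl uW vW fu fv a hc s sm w.
move: {2}(b - l)%N (leqnn (b - l)) => d;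
  elim: d l m hl sm => [|d IH] l m hl sm hd.
  have el : l = b by lia.
  move: sm; rewrite el blk_nil => /size0nil -> /=; rewrite wmul1p.
  exists c; split=> //.
  - exact: (@asc_left w u v c i (word_prod_weyl Phi _) uW a fv hc (fun r =>
      @blk_pos i b r hb)).
  - by apply: sub_all hc => x; apply: ltnW.
  - by move=> x; rewrite (@denoms_left w u v c) //; apply: word_prod_weyl.
have [lb|bl] := ltnP l b; last by apply: IH => //; lia.
have ln : (l < n)%N by apply: leq_trans lb _; case/andP: hb.
pose lo := Ordinal ln.
have eblk := blk_rcons (l := lo) lb; rewrite /= in eblk.
move: sm; rewrite eblk; case/lastP: m => [|m e];
  rewrite !size_rcons // => -[sm].
have hl' : (i <= l.+1 <= b)%N by lia.
have hd' : (b - l.+1 <= d)%N by lia.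
have [c' [a' s' h' d']] := IH l.+1 m hl' sm hd'.
have il : (i <= l)%N by case/andP: hl.
have lbn : (i <= l <= n)%N by rewrite il ltnW.
set A := blk l.+1 b in eblk sm a' d' *; set B := wp (blk i l).
have eB : wp (blk i l.+1) = s_ (al lo) ** B by rewrite (blk_cons (b := lo) il).
rewrite eB in a' d'.
have del e0 : deleted (rcons m e0) (rcons A lo) =
    deleted m A ++ (if e0 then [::] else [:: val (wp A (al lo))]).
  rewrite /deleted -(cats1 A) word_roots_cat map_cat -(cats1 m) map_cat
    mask_cat.
    by case: e0.
  by rewrite !size_map size_word_roots.
have mE e0 : wp (mask (rcons m e0) (rcons A lo)) =
    wp (mask m A) ** (if e0 then s_ (al lo) else 1%g).
  rewrite -(cats1 A) -(cats1 m) mask_cat // word_prod_cat.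
  by case: e0 => //=; rewrite wmulp1.
rewrite mE {}del; case: e.
  by exists c'; rewrite cats0 -wmulA (wmulA (s_ _)).
rewrite wmulp1; set M := wp (mask m A) in a' d' *.
have ltA k : k \in A -> (l < k)%N by rewrite mem_blk => /andP[].
have ltM k : k \in mask m A -> (l < k)%N by move=> /mem_mask /ltA.
have MW : M \in W by rewrite word_prod_weyl.
have BW : B \in W by rewrite word_prod_weyl.
have BuW : B ** u \in W by rewrite wmul_weyl.
set p := M ** (B ** u); have pW : p \in W by rewrite wmul_weyl.
set r := (B ** u)^-1%g (al lo).
have Bfix j : (j < i)%N -> wact B (om j) = om j.
  by move=> ji; apply: (word_fix_om (i := i)) => // k;
    rewrite mem_blk => /andP[].
have r0 j : (j < i)%N -> val r 0 j = 0.
  move=> ji; rewrite coord_wact ?inv_weyl //; last first.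
    by rewrite -{1}(_ : wact (B ** u) (om j) = om j) ?wactK // wactM // fu
      ?Bfix // ltnW.
  by rewrite simple_vecE -(inj_eq val_inj) gtn_eqF //=; apply: leq_trans il.
(* <om_i, r> = <B u om_i, alpha_l> = <B om_i, alpha_l> = 1; this makes r positive of height i. *)
have ri : pairing F (om i) (val r) = 1.
  rewrite -(pairing_wact (om i) r BuW) permKV wactM // fu //.
  by rewrite (pairing_blk_om (l := lo) lbn) //= eqxx.
have ri0 : 0 < val r 0 i.
  have := ltr01 (R := R); rewrite -ri pairing_om pmulr_rgt0 //.
  by rewrite divr_gt0 ?gram_diag_gt0 // inner_root_gt0.
have pr : pos r by exact: pos_coordP ri0.
have hr : h_ r = i by apply: height_uniq; rewrite ?gt_eqF.
have prE : p r = M (al lo) by rewrite /p wmulE permKV.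
have ppr : pos (p r) by rewrite prE; apply: blk_prefix_pos.
have psr : p ** s_ r = M ** (s_ (al lo) ** B ** u).
  by rewrite /p -wmulA -srefl_conj // permKV -[in RHS]wmulA.
(* With y = B om_i, the letters above l fix y, so p om_i = M y = y, whereas w om_i = A s_l y = A (y
   - alpha_l) = y - A alpha_l. *)
have dE : wact p (om i) - wact (w ** v) (om i) = val (wp A (al lo)).
  rewrite wactM ?word_prod_weyl // fv // /p wactM // wactM // fu //.
  set y := wact B (om i).
  have hy (k : 'I_n) : (l <= k)%N -> pairing F y (sv k) = (l == k)%:R.
    exact: pairing_blk_om.
  have iy (k : 'I_n) : (l < k)%N -> inner F y (sv k) = 0.
    move=> lk; have := pairingE y (al k);
      rewrite /= hy ?(ltnW lk) // ltn_eqF // mul0r.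
    by move/esym/eqP; rewrite mulf_eq0 (pnatr_eq0 _ 2) => /eqP.
  have -> : wact w (om i) = y - val (wp A (al lo)).
    have -> : w = wp A ** (s_ (al lo) ** B).
      by rewrite /w (@blk_cat i l b) // eblk -cats1 !word_prod_cat /= wmulp1
        wmulA.
    rewrite !wactM ?word_prod_weyl ?wmul_weyl // -/y wact_srefl /reflect_vec hy
      //= eqxx scale1r.
    by rewrite wactB wact_simple word_fix // => k /ltA /iy.
  by rewrite word_fix => [|k /ltM /iy //]; rewrite opprB addrC subrK.
exists (r :: c'); split.
- by rewrite /= pr ppr psr.
- rewrite /= path_sortedE; last exact: leq_trans.
  rewrite s' andbT all_map hr; apply: sub_all h' => x; exact.
- by rewrite /= hr leqnn.
- move=> x; rewrite /= hr dE psr inE d' !mem_cat inE.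
  by rewrite -!orbA; bool_congr; rewrite orbC.
Qed.

End PartThree.

(** * The word I and the bijection between chains and reduced subwords *)

Section PartThreeA.
Variables (R : realFieldType) (n : nat) (Phi : root_system R n).
Local Notation F := (gram Phi).
Local Notation T := (rootT Phi).
Local Notation V := 'rV[R]_n.
Local Notation W := (weyl Phi).
Local Notation s_ := (srefl (Phi := Phi)).
Local Notation al := (simple Phi).
Local Notation om := (fund_weight Phi).
Local Notation "p ** q" := (wmul p q) (at level 40, left associativity).
Implicit Types (b : T) (c : seq T) (u v : {perm T}) (p q : {perm T}) (x y : V)
  (i j : 'I_n).
Hint Resolve srefl_weyl one_weyl word_prod_weyl : core.
Local Notation h_ := (@height_index R n Phi).
Local Notation heights := (map (fun b => val (h_ b))).
Local Notation sv := (simple_vec R).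
Local Notation wp := (word_prod Phi).
Hypothesis hA : type_A Phi.
Local Notation ep := (eps Phi 1).

Lemma deleted_cat m1 m2 I J : size m1 = size I ->
  deleted Phi (m1 ++ m2) (I ++ J) =
  deleted Phi m1 I ++ map (wact (wp I)) (deleted Phi m2 J).
Proof.
move=> s1; rewrite /deleted word_roots_cat !map_cat mask_cat; last first.
  by rewrite !size_map size_word_roots.
congr (_ ++ _); rewrite map_mask -!map_comp; congr mask; apply: eq_map => b /=.
by rewrite wact_root.
Qed.

(** Blocks are split off from the left. If v fixes the weights before om_i, then v eps_i = eps_b
    selects the block b-1, ..., i, whose product w satisfies w om_i = v om_i, so w^-1 v fixes one
    weight more. [block_chains] with l = i extends the chains of the rest by the deleted letters of
    the block. *)
Lemma word_chains (i : nat) v : (i <= n)%N -> v \in W ->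
  (forall j : 'I_n, (j < i)%N -> wact v (om j) = om j) ->
  exists I, [/\ wp I = v, (forall k, k \in I -> (i <= k)%N),
    all (@pos R n Phi) (word_roots Phi I) &
   forall m, size m = size I -> exists c, [/\ asc (wp (mask m I)) v c,
     sorted leq (heights c), all (fun b => (i <= h_ b)%N) c &
     denoms (wp (mask m I)) v c =i deleted Phi m I]].
Proof.
move: {2}(n - i)%N (leqnn (n - i)) => d;
  elim: d i v => [|d IH] i v hd i_n vW fv.
  exists [::]; have v1 : v = 1%g.
    by apply: om_fix => // j; apply: fv; apply: leq_trans (ltn_ord j) _; lia.
  rewrite v1; split=> // m /size0nil ->.
  by exists [::]; rewrite /= eqxx.
have [ni|i_n'] := leqP n i; first by apply: IH => //; lia.
pose io := Ordinal i_n'.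
have [b bn eb] := typeA_wact_eps hA vW i_n.
have ib : (i <= b)%N.
  by apply: (wact_eps_ge (oner_neq0 R) (i := io) (e := 1) vW fv);
    rewrite scale1r.
have hb : (io <= b <= n)%N by rewrite ib bn.
set w := wp (blk n i b); have wW : w \in W by rewrite /w.
have fw (j : 'I_n) : (j < i)%N -> wact w (om j) = om j.
  by move=> ji; apply: (word_fix_om Phi (i := i)) => // k;
    rewrite mem_blk => /andP[].
have wom : wact w (om io) = wact v (om io).
  by rewrite (wact_om_eps (k := b) (i := io) fv eb) /w (blk_om hA hb).
set v' := w^-1%g ** v; have v'W : v' \in W by rewrite wmul_weyl ?inv_weyl.
have wv : w ** v' = v by rewrite /v' wmulA wmulpV wmul1p.
have fv' (j : 'I_n) : (j < i.+1)%N -> wact v' (om j) = om j.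
  rewrite ltnS leq_eqVlt wactM ?inv_weyl // => /orP[/eqP ji|ji].
    have -> : j = io by apply/val_inj.
    by rewrite -wom wactK.
  by rewrite fv // -{1}(fw j ji) wactK.
have hd1 : (n - i.+1 <= d)%N by lia.
have [I [eI lI pI cI]] := IH i.+1 v' hd1 i_n' v'W fv'.
exists (blk n i b ++ I); split.
- by rewrite word_prod_cat eI wv.
- move=> k; rewrite mem_cat mem_blk => /orP[/andP[]//|/lI]; exact: ltnW.
- rewrite word_roots_cat all_cat word_roots_blk_pos //= all_map;
    apply/allP => r rI /=.
  apply: (blk_pos hA hb); first exact: (allP pI).
  exact: word_roots_coord rI.
move=> m; rewrite size_cat => sm.
have s1 : size (take (size (blk n i b)) m) = size (blk n i b) by rewrite
  size_take sm; case: ltnP; lia.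
have s2 : size (drop (size (blk n i b)) m) = size I by rewrite size_drop sm
  addKn.
rewrite -(cat_take_drop (size (blk n i b)) m); move: s1 s2.
set m1 := take _ m; set m2 := drop _ m => s1 s2.
rewrite mask_cat // word_prod_cat.
have [c' [a' s' h' d']] := cI m2 s2.
set u := wp (mask m2 I) in a' d' *.
have uW : u \in W by rewrite /u.
have fu (j : 'I_n) : (j <= io)%N -> wact u (om j) = om j.
  by move=> ji; apply: (word_fix_om Phi (i := i.+1)) => // k /mem_mask /lI.
have hl : (io <= i <= b)%N by rewrite leqnn.
have [c [a s h dd]] := block_chains hA hb hl uW v'W fu fv' a' h' s' s1.
rewrite [blk n io i]blk_nil /= wmul1p -/w wv in a dd.
exists c; split=> // x; rewrite dd deleted_cat // !mem_cat; congr (_ || _).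
exact: eq_mem_map.
Qed.

Lemma notin_deleted (A : eqType) (s : seq A) (m : bitseq) : uniq s ->
  size m = size s ->
  map (fun a : A => a \notin mask (map negb m) s) s = m.
Proof.
elim: s m => [|a s IH] [|e m] //= /andP[xs us] [sm].
congr (_ :: _); first by case: e;
  rewrite /= ?mem_head // (contra (@mem_mask _ _ _ _) xs).
rewrite -[RHS](IH m us sm); apply/eq_in_map => a' ys; case: e => //=.
by rewrite inE; case: eqP => // yx; rewrite yx (negPf xs) in ys.
Qed.

(** The map F_I: a letter is kept when its root is not a denominator of the chain. *)
Definition kept_bits u v (I : seq 'I_n) (c : seq T) : (size I).-tuple bool :=
  [tuple val (wp (take j I) (al (tnth (in_tuple I) j))) \notin denoms u v c | j
    < size I].

Lemma kept_bitsE u v I c :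
  kept_bits u v I c = map (fun r =>
    val r \notin denoms u v c) (word_roots Phi I) :> bitseq.
Proof.
apply: (@eq_from_nth _ true) => [|j]; rewrite size_tuple;
  first by rewrite size_map size_word_roots.
move=> jI; set b0 := al (tnth (in_tuple I) (Ordinal jI)).
rewrite (nth_map b0) ?size_word_roots // (nth_word_roots b0 (Ordinal jI)).
by rewrite -(tnth_nth true _ (Ordinal jI)) tnth_mktuple.
Qed.

Lemma denoms_invs u v c : u \in W -> asc u v c -> sorted leq (heights c) ->
  exists2 ds : seq T, {subset ds <= invs v} &
    denoms u v c = map (fun d => val (oproot (v d))) ds.
Proof.
move=> uW a s; have so := small_orbitsA hA.
have [||ds [_ sds eds _ _]] :=
  Eprod_factor (K := fun _ _ => True) so _ _ uW a s => //.
exists ds => //; rewrite -eds; apply/eq_in_map => d /sds;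
  rewrite inE => /andP[pd _].
by rewrite /scaled_root (small_orbits_pairing so pd) scale1r.
Qed.

Lemma denoms_sub_word_roots u v I c : u \in W -> wp I = v ->
  all (@pos R n Phi) (word_roots Phi I) ->
  asc u v c -> sorted leq (heights c) ->
    {subset denoms u v c <= map val (word_roots Phi I)}.
Proof.
move=> uW eI pI a s x; have [ds sds ->] := denoms_invs uW a s.
have vW : v \in W := asc_weyl uW a.
move/mapP => [d /sds]; rewrite inE => /andP[pd nd] ->; apply: map_f.
rewrite mem_word_roots // eI -neg_opp nd -perm_opp // permK neg_opp.
by have -> : oproot (oproot d) = d by exact: oppK.
Qed.

(** With all pairings equal to 1, E is the product of the roots of Lambda_v^- that are not
    denominators. The roots of Lambda_v^- are those of the word, and the remaining ones belong to
    the kept letters. *)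
Lemma E_eq_SC u v I (c : (ell v - ell u).-tuple T) : u \in W -> wp I = v ->
  all (@pos R n Phi) (word_roots Phi I) -> c \in C0 u v ->
  E u v c = (SC Phi I (kept_bits u v I c))%:F.
Proof.
move=> uW eI pI; rewrite C0E => /and3P[a _ s]; have vW := asc_weyl uW a.
have so := small_orbitsA hA.
have [//|m z x y -> -> ->|ds [uds sds eds [_ -> ->]]] :=
  E_factor (K := fun _ z => z = 1) so _ _ uW a s.
  by rewrite divff ?oner_neq0 // mul1r.
rewrite scale1r; congr (_%:F).
have eds' : denoms u v c = map (fun d => val (oproot (v d))) ds.
  rewrite -eds; apply/eq_in_map => d /sds; rewrite inE => /andP[pd _].
  by rewrite /scaled_root (small_orbits_pairing so pd) scale1r.
have -> : SC Phi I (kept_bits u v I c) =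
    \prod_(r <- word_roots Phi I | val r \notin denoms u v c) lin (val r).
  rewrite /SC; case E : I => [|i0 J]; first by rewrite big_ord0 big_nil.
  rewrite -E (big_nth (al i0)) size_word_roots big_mkord; apply: eq_big => j.
    by rewrite tnth_mktuple nth_word_roots.
  by rewrite nth_word_roots.
rewrite big_mkcond [RHS]big_mkcond [RHS]big_uniq ?word_roots_uniq //=
  -!big_mkcondr /=.
rewrite [RHS](reindex_inj (h := fun b => oproot (v b))) /=; last first.
  by move=> b b' /(can_inj (@oppK _ _ _)) /perm_inj.
apply: eq_bigl => d; rewrite mem_word_roots // eI -neg_opp -perm_opp // permK.
rewrite -pos_opp inE eds' perm_opp // [neg _ && _]andbC; congr (_ && ~~ _).
apply/idP/mapP => [dd|[d' dd' /val_inj]]; first by exists d.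
by move/(can_inj (@oppK _ _ _))/perm_inj ->.
Qed.

Lemma chains_subwords_A u v : u \in W -> v \in W ->
  exists2 I : seq 'I_n, reduced_word v I &
  exists FI : (ell v - ell u).-tuple T -> (size I).-tuple bool,
    [/\ {in C0 u v &, injective FI}, [set FI c | c in C0 u v] = subwords u I
      & {in C0 u v, forall c : (ell v - ell u).-tuple T,
        E u v c = (SC Phi I (FI c))%:F}].
Proof.
move=> uW vW; have [|I [eI _ pI cI]] := word_chains (leq0n n) vW; first by [].
have rI : reduced_word v I by rewrite -eI; exact: reduced_word_roots.
have lI : ell v = size I by move: rI => /andP[_ /eqP ->].
have uval : uniq (map val (word_roots Phi I)) by rewrite map_inj_uniq
  ?word_roots_uniq //; exact: val_inj.
have szr : size (map val (word_roots Phi I)) = size I by rewrite size_map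
  size_word_roots.
have del_size m : size m = size I ->
  (size (deleted Phi m I) + size (mask m I) = size I)%N.
  move=> sm; rewrite !size_mask ?size_map ?size_word_roots // count_map -sm.
  by rewrite addnC -(count_predC id m).
(* The letters deleted by [kept_bits] are exactly the denominators of c, so the chain that
   [word_chains] attaches to these bits is c itself, by [denoms_inj]. This gives injectivity and
   shows that the kept letters multiply to u. *)
have det c c' (m := kept_bits u v I c) : asc u v c -> sorted leq (heights c) ->
    asc (wp (mask m I)) v c' -> sorted leq (heights c') ->
    denoms (wp (mask m I)) v c' =i deleted Phi m I -> c = c'.
  move=> a s a' s' e; apply: (denoms_inj uW _ a a' s s') => [|x];
    first exact: word_prod_weyl.
  rewrite e /deleted kept_bitsE -map_comp.
  rewrite (eq_map (g := (fun x => x \in denoms u v c) \o val)); last first.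
    by move=> r /=; rewrite negbK.
  rewrite map_comp -filter_mask mem_filter andbC.
  by case: (boolP (x \in denoms u v c)) =>
    [/(denoms_sub_word_roots uW eI pI a s) ->|]; rewrite ?andbF.
exists I => //; exists (fun c => kept_bits u v I c); split; last first.
- by move=> c hc; exact: E_eq_SC.
- apply/setP => m; rewrite !inE;
    apply/imsetP/andP => [[c hc ->]|[/eqP em /eqP sm]].
    move: hc; rewrite C0E => /and3P[a _ s].
    have [c' [a' s' _ d']] := cI _ (size_tuple (kept_bits u v I c)).
    have cc := det c c' a s a' s' d'; rewrite -cc in a' d'.
    have eu := asc_start a' a; split; first by rewrite eu.
    (* One deleted letter per edge: ell v - ell u letters are deleted, so ell u are kept and the
       subword is reduced. *)
    have sd : size (denoms u v c) = size (deleted Phi (kept_bits u v I c) I).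
      rewrite eu in d'; apply/eqP; rewrite -uniq_size_uniq ?denoms_uniq //.
      by rewrite mask_uniq.
    have := del_size _ (size_tuple (kept_bits u v I c)).
    have := asc_ell uW a; rewrite -sd size_denoms size_tuple => h1 h2.
    by apply/eqP; move: h1 h2 lI; set k1 := size (mask _ _); lia.
  have [c [a s _ d]] := cI m (size_tuple m); rewrite em in a d.
  have sd : size (denoms u v c) = size (deleted Phi m I).
    apply/eqP; rewrite -uniq_size_uniq ?denoms_uniq //.
    by rewrite mask_uniq.
  have dm := del_size _ (size_tuple m); rewrite -sd size_denoms sm -lI in dm.
  have sc : size c == (ell v - ell u)%N by apply/eqP; lia.
  exists (Tuple sc).
    by rewrite C0E /= a s (asc_coversE uW a) andbT addnC dm eqxx.
  apply: val_inj; rewrite /= kept_bitsE /=.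
  rewrite (eq_map (g := (fun x => x \notin deleted Phi m I) \o val)) =>
    [|r /=]; last by rewrite d.
  by rewrite map_comp notin_deleted // size_tuple.
move=> c c'; rewrite !C0E => /and3P[a _ s] /and3P[a' _ s'] e.
have [c1 [a1 s1 _ d1]] := cI _ (size_tuple (kept_bits u v I c)).
have e1 := det c c1 a s a1 s1 d1.
rewrite e in a1 d1; have e2 := det c' c1 a' s' a1 s1 d1.
by apply: val_inj; exact: etrans e1 (esym e2).
Qed.

End PartThreeA.

(** * Chains and subwords in type C *)

Section PartThreeC.
Variables (R : realFieldType) (n : nat) (Phi : root_system R n).
Local Notation F := (gram Phi).
Local Notation T := (rootT Phi).
Local Notation V := 'rV[R]_n.
Local Notation W := (weyl Phi).
Local Notation s_ := (srefl (Phi := Phi)).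
Local Notation al := (simple Phi).
Local Notation om := (fund_weight Phi).
Local Notation "p ** q" := (wmul p q) (at level 40, left associativity).
Implicit Types (b : T) (c : seq T) (u v : {perm T}) (p q : {perm T}) (x y : V)
  (i j : 'I_n).
Hint Resolve srefl_weyl one_weyl word_prod_weyl : core.
Local Notation h_ := (@height_index R n Phi).
Local Notation heights := (map (fun b => val (h_ b))).
Local Notation sv := (simple_vec R).
Local Notation wp := (word_prod Phi).

Lemma simple_inj : injective al.
Proof.
move=> i j /(congr1 val) /= /rowP /(_ i); rewrite !simple_vecE eqxx.
by case: eqP => // _ /eqP; rewrite oner_eq0.
Qed.

Lemma height_simple i : h_ (al i) = i.
Proof.
apply: height_uniq => [j ji|]; rewrite simple_vecE ?eqxx ?oner_neq0 //.
by rewrite -(inj_eq val_inj) gtn_eqF.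
Qed.

Lemma simple_not_sum i j k (x y : R) : j != k -> 0 < x -> 0 < y ->
  sv i = x *: sv j + y *: sv k -> False.
Proof.
move=> jk x0 y0 /rowP e.
have ej : (j == i)%:R = x.
  by have := e j; rewrite !mxE !eqxx /= (negPf jk) mulr1 mulr0 addr0.
have ek : (k == i)%:R = y.
  by have := e k; rewrite !mxE !eqxx /= (eq_sym k j) (negPf jk) mulr1 mulr0
    add0r.
move: x0 y0; rewrite -ej -ek; have [ji|_] := eqVneq j i; last by rewrite ltxx.
by have [ki|_] := eqVneq k i; rewrite ?ltxx // -ki in ji *;
  rewrite ji eqxx in jk.
Qed.

Lemma reduced_last p I i : p \in W -> reduced_word p (rcons I i) ->
  neg (p (al i)).
Proof.
move=> pW /andP[/eqP e /eqP s]; rewrite negE; apply/negP => /(ell_simple pW).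
rewrite -s -{1}e word_prod_rcons sreflK size_rcons => h.
by have := Ninv_word Phi I; rewrite -ell_Ninv // h; lia.
Qed.

(** * The pair u = s_a, v = s_a s_z s_a for the two ends a, z of the double bond *)

Section Counterexample.
Hypothesis hC : type_C Phi.
Variables a z : 'I_n.
Hypotheses (az : a.+1 = z) (zn : z.+1 = n).

Let ane : a != z. Proof. by rewrite -(inj_eq val_inj) /= -az ltn_eqF. Qed.

Let pair_az : pairing F (sv a) (sv z) = -1.
Proof. by rewrite (cartanC hC) (negPf ane) az eqxx zn eqxx. Qed.

Let pair_za : pairing F (sv z) (sv a) = - 2%:R.
Proof.
rewrite (cartanC hC) eq_sym (negPf ane) az eqxx zn eqxx divr1.
by rewrite (gtn_eqF (_ : a < n)%N) //.
Qed.

Let sz_a : val (s_ (al z) (al a)) = 1 *: sv a + 1 *: sv z.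
Proof. by rewrite srefl_root /reflect_vec /= pair_az scaleN1r opprK !scale1r.
  Qed.

Let sa_z : val (s_ (al a) (al z)) = 2%:R *: sv a + 1 *: sv z.
Proof. by rewrite srefl_root /reflect_vec /= pair_za scaleNr opprK scale1r
  addrC. Qed.

Let sa_sz_a : val (s_ (al a) (s_ (al z) (al a))) = 1 *: sv a + 1 *: sv z.
Proof.
rewrite srefl_root sz_a !scale1r /reflect_vec.
have -> : pairing F (sv a + sv z) (val (al a)) = 0.
  by rewrite -[sv z]opprK pairingBl -scaleN1r pairingZl /= pair_za cartan_self;
    ring.
by rewrite scale0r subr0.
Qed.

Let v := wp [:: a; z; a].
Let u := wp [:: a].

Let pos_comb b (x y : R) : 0 < x -> 0 < y -> val b = x *: sv a + y *: sv z ->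
  pos b.
Proof.
move=> x0 y0 e; apply: (@pos_coordP _ _ _ _ a).
by rewrite e !mxE !eqxx /= mulr1 (negPf ane) mulr0 addr0.
Qed.

Let word_roots_v : all (@pos R n Phi) (word_roots Phi [:: a; z; a]).
Proof.
rewrite /= simple_pos (pos_comb _ _ sa_z) ?ltr0n ?ltr01 //.
by rewrite (pos_comb _ _ sa_sz_a) ?ltr01.
Qed.

Let ell_v : ell v = 3.
Proof. by have /andP[_ /eqP] := reduced_word_roots word_roots_v. Qed.

Let ell_u : ell u = 1.
Proof.
have /andP[_ /eqP] : reduced_word u [:: a] by apply: reduced_word_roots;
  rewrite /= simple_pos.
by [].
Qed.

Let ell_az : reduced_word (wp [:: a; z]) [:: a; z].
Proof. by apply: reduced_word_roots;
  rewrite /= simple_pos (pos_comb _ _ sa_z) ?ltr0n ?ltr01. Qed.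

(** v makes the simple root of the last letter negative. By the exchange condition this root is
    alpha_a, s_a alpha_z or s_a s_z alpha_a, and the last two are not simple. The same argument for
    s_a s_z gives the second letter. *)
Lemma counterexample_word I : reduced_word v I -> I = [:: a; z; a].
Proof.
move=> rI; have /andP[/eqP eI /eqP sI] := rI; rewrite ell_v in sI.
case: I rI eI sI => [|x [|y [|w [|? ?]]]] // rI eI _.
have nw : neg (v (al w)) by apply: reduced_last (word_prod_weyl Phi _) (rI :
  reduced_word v (rcons [:: x; y] w)).
have [P [l [Q [eP eQ]]]] := word_inv (simple_pos Phi w) nw.
have ew : w = a.
  move: eP eQ; case: P => [|p1 [|p2 [|p3 P]]] //= [] =>
    [<- <-|_ <- <-|_ _ <- <-|] //=.
  - rewrite !wmulE perm1 => e; exfalso.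
    have := congr1 (fun r => s_ (al a) (s_ (al z) r)) e;
      rewrite !srefl_rootK => ew.
    by apply: (@simple_not_sum w a z 1 1); rewrite ?ltr01 // -sa_sz_a -ew.
  - rewrite !wmulE perm1 => e; exfalso.
    have := congr1 (s_ (al a)) e; rewrite !srefl_rootK => ew.
    by apply: (@simple_not_sum w a z 2%:R 1);
      rewrite ?ltr01 ?ltr0n // -sa_z -ew.
  - by rewrite perm1 => /simple_inj.
  - by case: P.
have e2 : wp [:: x; y] = wp [:: a; z].
  move: eI; rewrite ew /v -[[:: a; z; a]]/(rcons [:: a; z] a).
  rewrite word_prod_rcons -[LHS]/(wp (rcons [:: x; y] a)) word_prod_rcons.
  by move/(congr1 (fun p => p ** s_ (al a))); rewrite !sreflK.
have ny : neg (wp [:: a; z] (al y)).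
  apply: (reduced_last (I := [:: x]) (word_prod_weyl Phi _));
    rewrite /reduced_word e2 eqxx /=.
  by case/andP: ell_az => _ /eqP <-.
have [P' [l' [Q' [eP' eQ']]]] := word_inv (simple_pos Phi y) ny.
have ey : y = z.
  move: eP' eQ'; case: P' => [|p1 [|p2 P']] //= [] => [<- <-|_ <- <-|] //=.
  - rewrite !wmulE perm1 => e; exfalso.
    have := congr1 (s_ (al z)) e; rewrite !srefl_rootK => ey.
    by apply: (@simple_not_sum y a z 1 1); rewrite ?ltr01 // -sz_a -ey.
  - by rewrite perm1 => /simple_inj.
  - by case: P'.
have ex : x = a.
  move: e2; rewrite ey /= !wmulp1 => /(congr1 (fun p => p ** s_ (al z))).
  rewrite !sreflK => e; apply: simple_inj; apply: srefl_inj e;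
    exact: simple_pos.
by rewrite ex ey ew.
Qed.

Lemma counterexample_subwords : (1 < #|subwords u [:: a; z; a]|)%N.
Proof.
pose t1 : (size [:: a; z; a]).-tuple bool := [tuple true; false; false].
pose t2 : (size [:: a; z; a]).-tuple bool := [tuple false; false; true].
have h1 : t1 \in subwords u [:: a; z;
  a] by rewrite inE /reduced_word ell_u /= !eqxx.
have h2 : t2 \in subwords u [:: a; z;
  a] by rewrite inE /reduced_word ell_u /= !eqxx.
rewrite (cardD1 t1) h1 (cardD1 t2) /= inE h2 andbT.
by have -> : (t2 != t1) = true by [].
Qed.

(** The middle vertex is v with one letter deleted. Deleting z gives 1, which is too short; deleting
    the last a gives the labels alpha_z, alpha_a, whose heights decrease. Only the deletion of the
    first a remains. *)
Lemma counterexample_chain b1 b2 : asc u v [:: b1; b2] -> covers u [:: b1;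
  b2] ->
  sorted leq (heights [:: b1; b2]) ->
  wp [:: z; a] b2 = al a /\ u ** s_ b1 = wp [:: z; a].
Proof.
move=> /= /and5P[pb1 pub1 pb2 pub2 /eqP ev] /andP[/eqP l1 _] hs.
have uW : u \in W by rewrite /u.
have u1W : u ** s_ b1 \in W by rewrite wmul_weyl.
have nb2 : neg (wp [:: a; z; a] b2).
  by rewrite -/v -ev wmulE -/(oproot b2) perm_opp // -pos_opp.
have [P [l [Q [eP eQ]]]] := word_inv pb2 nb2.
have u1E : u ** s_ b1 = wp (P ++ Q).
  rewrite -[LHS](sreflK _ b2) ev /v eP (word_prod_inv_simple _ eQ).
  by rewrite sreflK.
move: eP eQ u1E; case: P => [|p1 [|p2 [|p3 P]]] //= [] =>
  [<- <-|<- <- <-|<- <- <- <-|] //=.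
- move=> _ e; exfalso; move: l1; rewrite e ell_u.
  by rewrite wmulp1 srefl_sq ell_Ninv // Ninv1.
- rewrite perm1 => eb2 /(congr1 (fun p => s_ (al a) ** p)) e; exfalso.
  have eb1 : b1 = al z.
    apply: srefl_inj (pb1) (simple_pos Phi z) _.
    by move: e; rewrite /u /= !wmulp1 !wmulA srefl_sq !wmul1p.
  by move: hs; rewrite eb1 eb2 !height_simple -az andbT ltnn.
by case: P.
Qed.

Lemma counterexample_C0 : (#|C0 u v| <= 1)%N.
Proof.
apply/card_le1_eqP => c c'; rewrite !C0E.
have sz (t : (ell v - ell u).-tuple T) : exists b1 b2, t = [:: b1; b2] :> seq T.
  have := size_tuple t; rewrite {2}ell_v {2}ell_u.
  by case: (tval t) => [|b1 [|b2 []]] // _; exists b1, b2.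
have [b1 [b2 e]] := sz c; have [b1' [b2' e']] := sz c'; rewrite e e'.
move=> /and3P[a1 c1 s1] /and3P[a1' c1' s1'].
have [h1 h2] := counterexample_chain a1 c1 s1.
have [h1' h2'] := counterexample_chain a1' c1' s1'.
have eb2 : b2 = b2' by apply: (perm_inj (s := wp [:: z; a])); rewrite h1 h1'.
have eb1 : b1 = b1'.
  move: a1 a1' => /= /and3P[pb1 _ _] /and3P[pb1' _ _].
  by apply: srefl_inj => //; exact: wmulI (etrans h2 (esym h2')).
by apply: val_inj; rewrite /= e e' eb1 eb2.
Qed.

End Counterexample.

Lemma chains_subwords_C : type_C Phi -> exists u v, [/\ u \in W, v \in W &
  forall I : seq 'I_n, reduced_word v I -> #|subwords u I| <> #|C0 u v|].
Proof.
move=> hC; have n1 : (1 < n)%N by case: hC => -[].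
have hz : (n.-1 < n)%N by lia.
have ha : (n.-2 < n)%N by lia.
pose z := Ordinal hz; pose a := Ordinal ha.
have az : a.+1 = z by rewrite /=; lia.
have zn : z.+1 = n by rewrite /=; lia.
exists (wp [:: a]), (wp [:: a; z; a]); split=> //; try exact: word_prod_weyl.
move=> I /(counterexample_word hC az zn) -> e.
have := counterexample_subwords a z; have := counterexample_C0 hC az zn.
by rewrite -e; lia.
Qed.

End PartThreeC.

Theorem theorem6p1 (R : realFieldType) (n : nat) (Phi : root_system R n) :
  [/\ (* Part I *)
      forall u v : {perm rootT Phi}, u \in weyl Phi -> v \in weyl Phi ->
      forall tau : {perm rootT Phi} -> {mpoly rat[n]}, schubert_class u tau ->
        (ext_scalars R (tau v))%:F = \sum_(c in C0 u v) E u v c,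
      (* Part II *)
      (type_A Phi \/ type_C Phi ->
       forall u v : {perm rootT Phi}, u \in weyl Phi -> v \in weyl Phi ->
       forall c, c \in C0 u v -> nonneg_poly_over 1 (E u v c))
      /\
      (type_B Phi ->
       forall u v : {perm rootT Phi}, u \in weyl Phi -> v \in weyl Phi ->
       forall c, c \in C0 u v -> nonneg_poly_over (2 ^ size c) (E u v c))
    & (* Part III *)
      (type_A Phi ->
       forall u v : {perm rootT Phi}, u \in weyl Phi -> v \in weyl Phi ->
       exists2 I : seq 'I_n, reduced_word v I &
       exists FI : (ell v - ell u).-tuple (rootT Phi) -> (size I).-tuple bool,
         [/\ {in C0 u v &, injective FI},
             [set FI c | c in C0 u v] = subwords u I
           & {in C0 u v, forall c, E u v c = (SC Phi I (FI c))%:F}])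
      /\
      (type_C Phi ->
       exists u v : {perm rootT Phi}, [/\ u \in weyl Phi, v \in weyl Phi &
         forall I : seq 'I_n, reduced_word v I -> #|subwords u I| <> #|C0 u v|])].
Proof.
split; first by move=> u v uW vW tau; exact: chain_formula.
  by split; [exact: E_nonneg_AC | exact: E_nonneg_B].
split; last exact: chains_subwords_C.
by move=> hA u v uW vW; exact: chains_subwords_A.
Qed.
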